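(* For each $K\ge2$ let $n_{\mathrm t}=n_{\mathrm t}(K)\ge K$ be an integer, let $\sigma^2=\sigma^2(K)\in[0,1)$ and $P=P(K)>0$, and consider zero-forcing precoding with imperfect channel state information of error variance $\sigma^2$ and uniform power allocation $p=P/K$ per user. Let $\bar R_{\mathrm{sym}}=\mathbb E[\ln(1+\mathsf{SINR}_k)]$ be the resulting average rate per user (it does not depend on $k$). If $\liminf_{K\to\infty}\frac{n_{\mathrm t}}{K}>1$, then as $K\to\infty$: (i) when $(n_{\mathrm t}-K+1)(1-\sigma^2)=O(1)$, $$\bar R_{\mathrm{sym}}\sim\frac{1+(n_{\mathrm t}-K+1)(1-\sigma^2)}{p^{-1}+K-1};$$ (ii) when $(n_{\mathrm t}-K+1)(1-\sigma^2)\to\infty$, $$\bar R_{\mathrm{sym}}\sim\ln\left(1+\frac{(n_{\mathrm t}-K+1)(1-\sigma^2)}{p^{-1}+(K-1)\sigma^2}\right).$$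
   Context: Setting: a base station with $n_{\mathrm t}\ge K$ antennas serves $K$ single-antenna users. The channel vectors are $\mathbf H_k=\hat{\mathbf H}_k+\tilde{\mathbf H}_k\in\mathbb C^{n_{\mathrm t}}$, $k\in[K]=\{1,\dots,K\}$, where all $\hat{\mathbf H}_k\sim\mathcal{CN}(0,(1-\sigma^2)\mathrm I_{n_{\mathrm t}})$ and $\tilde{\mathbf H}_k\sim\mathcal{CN}(0,\sigma^2\mathrm I_{n_{\mathrm t}})$ are mutually independent circularly symmetric complex Gaussian vectors ($\hat{\mathbf H}_k$ is the estimate known to the transmitter, $\tilde{\mathbf H}_k$ the estimation error). Zero-forcing precoder: $\mathbf W_k=\alpha_k\mathbf U_k\mathbf U_k^{\mathsf H}\hat{\mathbf H}_k^*$, where $^*$ denotes complex conjugation, $^{\mathsf T}$ transpose and $^{\mathsf H}$ conjugate transpose. The columns of $\mathbf U_k\in\mathbb C^{n_{\mathrm t}\times(n_{\mathrm t}-K+1)}$ form an orthonormal basis of the orthogonal complement of $\mathrm{span}\{\hat{\mathbf H}_l^*:l\ne k\}$, with $\mathbf U_k$ independent of $\hat{\mathbf H}_k$, and $\alpha_k=1/\|\hat{\mathbf H}_k^{\mathsf T}\mathbf U_k\|$, so that $\|\mathbf W_k\|=1$. Put $\mathrm G_k=\mathbf H_k^{\mathsf T}\mathbf W_k$ and $\tilde{\mathrm G}_{k,l}=\tilde{\mathbf H}_k^{\mathsf T}\mathbf W_l$ for $l\neq k$. With uniform power $p=P/K$ on each stream, $$\mathsf{SINR}_k=\frac{|\mathrm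 G_k|^2}{p^{-1}+\sum_{l\ne k}|\tilde{\mathrm G}_{k,l}|^2}.$$ Asymptotics are for $K\to\infty$: $f\sim g$ means $f/g\to1$, and $f=O(1)$ means bounded for large $K$. *)

(* Defs.v *)
From HB Require Import structures.
From mathcomp Require Import all_boot all_order all_algebra.
From mathcomp Require Import complex.
From mathcomp Require Import all_classical all_reals all_analysis.

Set Implicit Arguments.
Unset Strict Implicit.
Unset Printing Implicit Defensive.

Import Order.TTheory GRing.Theory Num.Theory.
Import numFieldNormedType.Exports.

Local Open Scope classical_set_scope.
Local Open Scope complex_scope.
Local Open Scope sesquilinear_scope.
Local Open Scope ring_scope.

(* Squared modulus, as an element of R (the norm `|z| lives in R[i]). *)
Definition sqmod (R : realType) (z : R[i]) : R := ComplexField.Normc.normc z ^+ 2.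

(* Euclidean (Hermitian) norm of a row or column vector. *)
Definition l2norm (R : realType) (m n : nat) (A : 'M[R[i]]_(m, n)) : R :=
  Num.sqrt (\sum_i \sum_j sqmod (A i j)).

Section random_matrices.
Context {d : measure_display} {T : measurableType d} {R : realType}.
Implicit Type P : probability T R.

(* The real random variables making up a random complex matrix: real parts
   (false) and imaginary parts (true) of its entries. *)
Definition real_comp (m n : nat) (X : T -> 'M[R[i]]_(m, n))
    (c : 'I_m * 'I_n * bool) (w : T) : R :=
  let z := X w c.1.1 c.1.2 in if c.2 then complex.Im z else complex.Re z.

Definition random_mx (m n : nat) (X : T -> 'M[R[i]]_(m, n)) : Prop :=
  forall c, measurable_fun setT (real_comp X c).

Definition sigma_rv (f : T -> R) : set_system T :=
  preimage_set_system setT f measurable.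

Definition sigma_mx (m n : nat) (X : T -> 'M[R[i]]_(m, n)) : set_system T :=
  <<s \bigcup_(c in [set: 'I_m * 'I_n * bool]) sigma_rv (real_comp X c) >>.

Definition mutually_independent (I : finType) P (F : I -> set_system T) : Prop :=
  forall (J : {set I}) (A : I -> set T), (forall i, i \in J -> F i (A i)) ->
    P (\bigcap_(i in [set` J]) A i) = (\prod_(i in J) P (A i))%E.

Definition independent P (F G : set_system T) : Prop :=
  forall A B, F A -> G B -> P (A `&` B) = (P A * P B)%E.

(* Centred real Gaussian law of variance v; [normal_prob] is parametrised by
   the standard deviation and is not the point mass when the latter is 0. *)
Definition gauss_law (v : R) (B : set R) : \bar R :=
  if v == 0 then \d_(0 : R) B else normal_prob 0 (Num.sqrt v) B.

(* CN(0, v I_n): the entries are independent, and each has independent real and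
   imaginary parts distributed as N(0, v / 2). *)
Definition CN0 P (n : nat) (v : R) (X : T -> 'cV[R[i]]_n) : Prop :=
  [/\ random_mx X,
      mutually_independent P (fun c => sigma_rv (real_comp X c)) &
      forall c (B : set R), measurable B ->
        P (real_comp X c @^-1` B) = gauss_law (v / 2) B].

End random_matrices.

Section orthonormal_basis.
Variables (R : realType) (n m : nat).

Definition orthogonal_to (S : {vspace 'cV[R[i]]_n}) (v : 'cV[R[i]]_n) : Prop :=
  forall w, w \in S -> w ^t* *m v = 0.

Definition onb_orthocomplement (U : 'M[R[i]]_(n, m))
    (S : {vspace 'cV[R[i]]_n}) : Prop :=
  U ^t* *m U = 1%:M /\
  (forall v, v \in <<[seq col j U | j : 'I_m]>>%VS <-> orthogonal_to S v).

End orthonormal_basis.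

Section zero_forcing.
Context {d : measure_display} {T : measurableType d} {R : realType}.
Variables (K n : nat).
Variables (Hhat Htilde : 'I_K -> T -> 'cV[R[i]]_n).
Variable (U : 'I_K -> T -> 'M[R[i]]_(n, n - K + 1)).

(* The span of the conjugated estimates of the other users has dimension K - 1,
   hence U k can exist, only almost surely. *)
Record zf_model (P : probability T R) (sigma2 : R) : Prop := ZfModel {
  zf_Hhat : forall k, CN0 P (1 - sigma2) (Hhat k) ;
  zf_Htilde : forall k, CN0 P sigma2 (Htilde k) ;
  zf_indep : mutually_independent P
    (fun x : 'I_K + 'I_K => match x with
       | inl k => sigma_mx (Hhat k)
       | inr k => sigma_mx (Htilde k)
     end) ;
  zf_U_random : forall k, random_mx (U k) ;
  zf_U_onb : forall k, {ae P, forall w, onb_orthocomplement (U k w)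
    <<[seq map_mx Num.conj (Hhat l w) | l : 'I_K in predC1 k]>>%VS} ;
  zf_U_indep : forall k, independent P (sigma_mx (U k)) (sigma_mx (Hhat k))
}.

Definition channel (k : 'I_K) (w : T) : 'cV[R[i]]_n := Hhat k w + Htilde k w.

Definition zf_alpha (k : 'I_K) (w : T) : R :=
  (l2norm ((Hhat k w)^T *m U k w))^-1.

Definition zf_precoder (k : 'I_K) (w : T) : 'cV[R[i]]_n :=
  (zf_alpha k w)%:C *: (U k w *m (U k w) ^t* *m map_mx Num.conj (Hhat k w)).

Definition gain (k : 'I_K) (w : T) : R[i] :=
  ((channel k w)^T *m zf_precoder k w) 0 0.

Definition leakage (k l : 'I_K) (w : T) : R[i] :=
  ((Htilde k w)^T *m zf_precoder l w) 0 0.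

Definition SINR (p : R) (k : 'I_K) (w : T) : R :=
  sqmod (gain k w) / (p^-1 + \sum_(l < K | l != k) sqmod (leakage k l w)).

Definition average_rate (P : probability T R) (p : R) (k : 'I_K) : \bar R :=
  'E_P[fun w => ln (1 + SINR p k w)]%E.

End zero_forcing.

(* Main.v *)
Require Import Defs.
From HB Require Import structures.
From mathcomp Require Import all_boot all_order all_algebra.
From mathcomp Require Import complex.
From mathcomp Require Import all_classical all_reals all_analysis.
From mathcomp Require Import measurable_realfun perm ring lra.
Set Implicit Arguments.
Unset Strict Implicit.
Unset Printing Implicit Defensive.
Import Order.TTheory GRing.Theory Num.Theory.
Import numFieldNormedType.Exports.
Local Open Scope classical_set_scope.
Local Open Scope complex_scope.
Local Open Scope ring_scope.

(** Notation: N = nt - K + 1, v = 1 - sigma2, a = N v, S the interference power [leaksum], S0 =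
    sigma2 (K - 1), D = 1/p + S0.

    The orthonormal bases disappear first. Almost surely the product of [U k] and its adjoint is the
    orthogonal projection onto the complement of the other conjugated estimates, so the precoder is
    a vector [beam] depending on the estimates only, and the SINR is a function [csinr] of one
    centred Gaussian vector ([onb_proj], [precoder_ae], [average_rateE]). The signal power is
    |sqrt(sig) + e|^2, where [sig] is the squared norm of an estimate projected on N dimensions, of
    mean a, and e is an error coefficient of variance sigma2; its mean is a + sigma2 ([cgain_mean]).
    The interference S has mean S0 ([leaksum_mean]).

    All moments come from Gaussian integration by parts ([stein]), applied to Q phi(Q) for a sum Q
    of squared moduli of linear forms in one user's vector ([cquad_stein]). Powers phi give moments;
    phi(q) = 1/(q + e)^k gives inverse moments, of order up to half the rank.

    The variance of S is sigma2^2 times the mean sum of squared correlations between beams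
    ([leaksum_variance]). Two distinct beams have mean squared correlation at most 13/(2N)
    ([beam_corr_pair]), and the liminf hypothesis makes N at least of order K, so S/D deviates from
    S0/D by O(K^-1/2) in mean square. To divide by 1/p + S one also needs a bounded fourth moment of
    S0/S ([leaksum_inverse_moment]); it rests on the Cauchy-Schwarz bound [leakage_lower_bound].

    When a is bounded, v = a/N tends to 0, so sigma2 tends to 1, the SINR is small, and x - x^2 <=
    ln(1 + x) <= x reduces the rate to the mean SINR ([mean_rate_weak]); D may then be replaced by
    1/p + K - 1 ([weak_ratio]). When a tends to infinity the signal power has relative fluctuation
    O(a^-1/2) ([gain_sqr_dev]), and |ln(1 + r x) - ln(1 + r)| <= |x - 1| ln(1 + r)
    ([ln1D_scale_dist]) turns a relative error on the SINR into one on the rate, whatever the size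
    of a/D ([mean_rate_strong]). *)

(** * Integrals against a normal law as weighted Lebesgue integrals *)

Section gaussian_law.
Context {R : realType}.
Local Notation mu := (@lebesgue_measure R).

(** The Radon-Nikodym derivative agrees with the density only almost everywhere, so the change of
    variables is followed by a replacement under the integral. *)
Lemma ge0_integral_normal_prob (s : R) (f : R -> \bar R) :
  measurable_fun [set: R] f -> (forall x, 0 <= f x)%E ->
  (\int[normal_prob 0 s]_x f x = \int[mu]_x (f x * (normal_pdf 0 s x)%:E))%E.
Proof.
move=> mf f0; pose numu := @normal_prob_dominates R 0 s.
rewrite -(Radon_Nikodym_SigmaFinite.change_of_variables numu)//.
have mpdf : measurable_fun [set: R] (fun x : R => (normal_pdf 0 s x)%:E).
  by apply/measurable_EFinP; exact: measurable_normal_pdf.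
apply: ae_eq_integral => //.
- apply: emeasurable_funM => //.
  exact: measurable_int (Radon_Nikodym_SigmaFinite.f_integrable numu).
- exact: emeasurable_funM.
- apply: ae_eqe_mul2l => /=.
  apply: integral_ae_eq => //=.
  + exact: Radon_Nikodym_SigmaFinite.f_integrable.
  + by move=> E E01 mE; rewrite -Radon_Nikodym_SigmaFinite.f_integral.
Qed.

Lemma integrable_normal_probP (s : R) (f : R -> R) : measurable_fun [set: R] f ->
  mu.-integrable [set: R] (fun x => (f x * normal_pdf 0 s x)%:E) ->
  (normal_prob 0 s).-integrable [set: R] (EFin \o f).
Proof.
move=> mf /integrableP[_ fi]; apply/integrableP; split.
  exact/measurable_EFinP.
rewrite ge0_integral_normal_prob//; last first.
  by apply: measurableT_comp => //; exact/measurable_EFinP.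
apply: le_lt_trans fi; rewrite le_eqVlt; apply/orP; left; apply/eqP.
apply: eq_integral => x _ /=.
by rewrite -EFinM normrM (ger0_norm (normal_pdf_ge0 _ _ _)).
Qed.

Lemma integral_normal_prob (s : R) (f : R -> R) : measurable_fun [set: R] f ->
  mu.-integrable [set: R] (fun x => (f x * normal_pdf 0 s x)%:E) ->
  (\int[normal_prob 0 s]_x (f x)%:E = \int[mu]_x (f x * normal_pdf 0 s x)%:E)%E.
Proof.
move=> mf fi; have nfi := integrable_normal_probP mf fi.
rewrite integralE [RHS]integralE.
rewrite !ge0_integral_normal_prob//; [|exact/measurable_funeneg/measurable_EFinP|exact/measurable_funepos/measurable_EFinP].
have p0 x := normal_pdf_ge0 (0:R) s x.
congr (_ - _)%E; apply: eq_integral => x _.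
- by rewrite !funeposE/= maxe_pMl ?lee_fin// mul0e EFinM.
- by rewrite !funenegE/= maxe_pMl ?lee_fin// mul0e -EFinM mulNr.
Qed.

End gaussian_law.

(** * Stein's identity in one variable *)

Section gaussian_stein.
Context {R : realType}.
Local Notation mu := (@lebesgue_measure R).
Implicit Types (v x : R) (m : nat).

Let gd v x : R := normal_peak (Num.sqrt v) * expR (- (x ^+ 2 / (v *+ 2))).

Lemma normal_pdf_sqrtE v x : 0 < v -> normal_pdf 0 (Num.sqrt v) x = gd v x.
Proof.
move=> v0; rewrite /normal_pdf gt_eqF ?sqrtr_gt0// /normal_fun subr0.
by rewrite sqr_sqrtr ?ltW// mulNr.
Qed.

(** The exponent splits into two halves: one is the Gaussian factor of doubled variance, the other
    absorbs the polynomial. This gives both integrability and decay at infinity. *)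
Lemma poly_normal_pdf_le v m : 0 < v -> exists2 C : R, 0 <= C &
  forall x, (1 + x ^+ 2) ^+ m * normal_pdf 0 (Num.sqrt v) x
            <= C * normal_pdf 0 (Num.sqrt (v *+ 2)) x.
Proof.
move=> v0; have v20 : 0 < v *+ 2 by rewrite pmulrn_lgt0.
have s0 := normal_peak_gt0 (lt0r_neq0 (etrans (sqrtr_gt0 v) v0)).
have s20 := normal_peak_gt0 (lt0r_neq0 (etrans (sqrtr_gt0 (v *+ 2)) v20)).
(* The value comes from t^(m+1) <= (m+1)! e^t at t = (1 + x^2) / (4v). *)
pose c : R := (v *+ 4) ^+ m.+1 * (m.+1)`!%:R * expR ((v *+ 4)^-1).
have v40 : 0 < v *+ 4 by rewrite pmulrn_lgt0.
have c0 : 0 <= c by rewrite !mulr_ge0 ?expR_ge0 ?exprn_ge0 ?ltW.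
exists (normal_peak (Num.sqrt v) * c / normal_peak (Num.sqrt (v *+ 2))).
  by apply: divr_ge0; [apply: mulr_ge0; [exact: ltW|]|exact: ltW].
move=> x; rewrite !normal_pdf_sqrtE// /gd.
rewrite [leRHS]mulrA divfK ?gt_eqF//.
rewrite mulrCA -[leRHS]mulrA ler_pM2l//.
have -> : x ^+ 2 / (v *+ 2) = x ^+ 2 / (v *+ 4) + x ^+ 2 / (v *+ 4).
  by field; rewrite gt_eqF.
rewrite opprD expRD mulrA -mulrnA /=; apply: ler_pM; rewrite ?mulr_ge0 ?expR_ge0//.
  by rewrite exprn_ge0 // addr_ge0 // sqr_ge0.
set t := (1 + x ^+ 2) / (v *+ 4).
have x1 : 1 <= 1 + x ^+ 2 by rewrite lerDl sqr_ge0.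
have t0 : 0 <= t by rewrite divr_ge0 ?ltW// (lt_le_trans ltr01).
apply: (@le_trans _ _ ((1 + x ^+ 2) ^+ m.+1 * expR (- (x ^+ 2 / (v *+ 4))))).
  by rewrite ler_wpM2r ?expR_ge0// ler_weXn2l.
set E := expR (- _).
have E0 : 0 <= E by exact: expR_ge0.
have -> : 1 + x ^+ 2 = t * (v *+ 4) by rewrite divfK ?gt_eqF.
have -> : c = (v *+ 4) ^+ m.+1 * (m.+1)`!%:R * (expR t * E).
  rewrite /c -expRD; congr (_ * expR _).
  by rewrite /t; field; rewrite gt_eqF.
have key : t ^+ m.+1 <= (m.+1)`!%:R * expR t.
  rewrite -ler_pdivrMl ?ltr0n ?fact_gt0// mulrC.
  by rewrite (le_trans _ (expR_ge1Dxn m t0))// lerDr.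
rewrite exprMn [leRHS](_ : _ = (m.+1)`!%:R * expR t * (v *+ 4) ^+ m.+1 * E).
  by rewrite ler_wpM2r// ler_wpM2r// exprn_ge0// ltW.
ring.
Qed.

Lemma integrable_poly_normal_pdf v m (f : R -> R) C : 0 < v ->
  measurable_fun [set: R] f -> (forall x, `|f x| <= C * (1 + x ^+ 2) ^+ m) ->
  mu.-integrable [set: R] (fun x => (f x * normal_pdf 0 (Num.sqrt v) x)%:E).
Proof.
move=> v0 mf fC; have [C' C'0 C'P] := poly_normal_pdf_le m v0.
have C0 : 0 <= C.
  by have := le_trans (normr_ge0 _) (fC 0); rewrite expr0n addr0 expr1n mulr1.
have gi : mu.-integrable [set: R]
    (fun x => ((C * C')%:E * (normal_pdf 0 (Num.sqrt (v *+ 2)) x)%:E)%E).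
  by apply: integrableZl => //; exact: integrable_normal_pdf.
apply: le_integrable gi => //.
- apply/measurable_EFinP; apply: measurable_funM => //.
  exact: measurable_normal_pdf.
- move=> x _ /=; rewrite lee_fin normrM (ger0_norm (normal_pdf_ge0 _ _ _)).
  rewrite [leRHS]ger0_norm ?mulr_ge0 ?normal_pdf_ge0//.
  apply: le_trans (ler_wpM2r (normal_pdf_ge0 _ _ _) (fC x)) _.
  by rewrite -!mulrA ler_wpM2l.
Qed.

Section stein.
Variables (v : R) (f f' : R -> R) (C : R) (m : nat).
Hypotheses (v0 : 0 < v) (ff' : forall x, is_derive x 1 f (f' x))
  (cf' : continuous f')
  (fC : forall x, `|f x| <= C * (1 + x ^+ 2) ^+ m)
  (f'C : forall x, `|f' x| <= C * (1 + x ^+ 2) ^+ m).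

Let g' x := (f' x - x * f x / v) * gd v x.

Let cf : continuous f.
Proof.
by move=> x; apply: differentiable_continuous; apply/derivable1_diffP; case: (ff' x).
Qed.

Let C0 : 0 <= C.
Proof.
by have := le_trans (normr_ge0 _) (fC 0); rewrite expr0n addr0 expr1n mulr1.
Qed.

Let is_derive_gd x : is_derive x 1 (gd v) (- (x / v) * gd v x).
Proof.
rewrite /gd; apply: is_derive_eq.
by rewrite /GRing.scale/=; field; rewrite gt_eqF.
Qed.

Let is_derive_g x : is_derive x 1 (fun x => f x * gd v x) (g' x).
Proof.
have d1 := ff' x; have d2 := is_derive_gd x.
apply: (@is_derive_eq _ _ _ _ _ _ _ _ (is_deriveM d1 d2)).
rewrite /GRing.scale/= /g'; ring.
Qed.

Let mf : measurable_fun [set: R] f. Proof. exact: continuous_measurable_fun. Qed.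
Let mf' : measurable_fun [set: R] f'. Proof. exact: continuous_measurable_fun. Qed.

Let fi : mu.-integrable [set: R] (fun x => (x * f x * gd v x)%:E).
Proof.
have := @integrable_poly_normal_pdf v m.+1 (fun x => x * f x) C v0.
have -> : (fun x => (x * f x * normal_pdf 0 (Num.sqrt v) x)%:E) =
          (fun x => (x * f x * gd v x)%:E).
  by apply/funext => x; rewrite normal_pdf_sqrtE.
apply; first exact: measurable_funM.
move=> x; rewrite normrM exprS mulrCA.
apply: ler_pM => //.
have := sqr_ge0 (`|x| - 1); have := sqr_ge0 x.
rewrite sqrrB real_normK ?num_real//; lra.
Qed.

Let f'i : mu.-integrable [set: R] (fun x => (f' x * gd v x)%:E).
Proof.
have := @integrable_poly_normal_pdf v m f' C v0 mf' f'C.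
have -> // : (fun x => (f' x * normal_pdf 0 (Num.sqrt v) x)%:E) =
              (fun x => (f' x * gd v x)%:E).
by apply/funext => x; rewrite normal_pdf_sqrtE.
Qed.

Let g'E x : (g' x)%:E = ((f' x * gd v x)%:E + (- v^-1)%:E * (x * f x * gd v x)%:E)%E.
Proof. by rewrite -EFinM -EFinD; congr EFin; rewrite /g'; ring. Qed.

Let g'i : mu.-integrable [set: R] (EFin \o g').
Proof.
have -> : EFin \o g' =
    (fun x => (f' x * gd v x)%:E + (- v^-1)%:E * (x * f x * gd v x)%:E)%E.
  by apply/funext => x /=; rewrite g'E.
by apply: integrableD => //; exact: integrableZl.
Qed.

Let cg' : continuous g'.
Proof.
move=> x; apply: cvgM; last first.
  by apply: differentiable_continuous; apply/derivable1_diffP; case: (is_derive_gd x).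
apply: cvgB; first exact: cf'.
apply: cvgM; last exact: cvg_cst.
by apply: cvgM; [exact: cvg_id|exact: cf].
Qed.

(** One spare factor 1 + x^2 in the comparison with the wider density leaves this decay, which kills
    the boundary terms of the integration by parts. *)
Let g_small : exists2 B : R, 0 <= B & forall x, `|f x * gd v x| <= B / (1 + x ^+ 2).
Proof.
have [C' C'0 C'P] := poly_normal_pdf_le m.+1 v0.
pose p := normal_peak (Num.sqrt (v *+ 2)).
have p0 : 0 <= p by exact: normal_peak_ge0.
exists (C * (C' * p)); first by rewrite !mulr_ge0.
move=> x; have x1 : 0 < 1 + x ^+ 2 by rewrite ltr_pwDl// sqr_ge0.
rewrite ler_pdivlMr// normrM.
have gd0 : 0 <= gd v x by rewrite -normal_pdf_sqrtE// normal_pdf_ge0.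
rewrite (ger0_norm gd0) -mulrA.
apply: le_trans (ler_wpM2r _ (fC x)) _; first by rewrite mulr_ge0// ltW.
rewrite -mulrA ler_wpM2l// mulrCA mulrA -[X in X * _]mulrC.
have := C'P x; rewrite normal_pdf_sqrtE// exprS => h.
rewrite [leLHS](_ : _ = (1 + x ^+ 2) * (1 + x ^+ 2) ^+ m * gd v x); last by ring.
apply: le_trans h _; rewrite ler_wpM2l//.
by apply: normal_pdf_ub; rewrite gt_eqF// sqrtr_gt0 pmulrn_lgt0.
Qed.

Let integral_g'_itv n : (\int[mu]_(x in `[(- n.+1%:R)%R, n.+1%:R]) (g' x)%:E =
  (f n.+1%:R * gd v n.+1%:R - f (- n.+1%:R) * gd v (- n.+1%:R))%:E)%E.
Proof.
have dg x : derivable (fun x => f x * gd v x) x 1 by case: (is_derive_g x).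
have cg : continuous (fun x => f x * gd v x).
  by move=> x; apply: differentiable_continuous; apply/derivable1_diffP.
rewrite (@continuous_FTC2 _ _ (fun x => f x * gd v x)) ?EFinB//.
- by rewrite gtrN// ltr0n.
- exact: continuous_subspaceT.
- split => //; [exact/cvg_at_right_filter/cg|exact/cvg_at_left_filter/cg].
- by move=> x _; rewrite derive1E; exact: derive_val.
Qed.

(** On a symmetric interval the integral is a boundary difference tending to 0; by dominated
    convergence it also tends to the full integral. *)
Let integral_g' : (\int[mu]_x (g' x)%:E = 0)%E.
Proof.
pose f_ n := (EFin \o g') \_ `[(- n.+1%:R)%R, (n.+1%:R : R)].
have mg' : measurable_fun [set: R] (EFin \o g').
  by apply/measurable_EFinP; exact: continuous_measurable_fun.
have [|||||_ _ cvgf] := @dominated_convergence _ _ _ mu setT measurableT f_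
    (EFin \o g') (abse \o (EFin \o g')).
- by move=> n; rewrite /f_; apply/(measurable_restrictT _ _).1 => //; exact: measurable_funTS.
- exact: mg'.
- apply: aeW => x _; apply: cvg_near_cst.
  exists (Num.truncn `|x|).+1 => // n /= hn; rewrite /f_ patchE ifT// inE/= in_itv/=.
  rewrite -ler_norml; apply: le_trans (ltW (truncnS_gt _)) _ => //.
  by rewrite ler_nat (leq_trans hn)// leqnSn.
- exact: integrable_abse.
- apply: aeW => x n _; rewrite /f_ patchE; case: ifP => // _.
  by rewrite abse0 lee_fin normr_ge0.
have : (\int[mu]_x f_ n x)%E @[n --> \oo] --> 0%E.
  have [B B0 gB] := g_small.
  under eq_fun do rewrite /f_ -integral_mkcond integral_g'_itv.
  apply/cvg_EFin; first exact: nearW.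
  have hB : (B *+ 2) * (n.+1%:R^-1) @[n --> \oo] --> (0 : R).
    by rewrite -(mulr0 (B *+ 2)); apply: cvgMr; exact: cvg_harmonic.
  apply/norm_cvg0P; apply: (squeeze_cvgr (f := cst 0) _ _ hB); last exact: cvg_cst.
  apply: nearW => n; rewrite normr_ge0/=.
  apply: le_trans (ler_normB _ _) _.
  have h (x : R) : x ^+ 2 = n.+1%:R ^+ 2 -> `|f x * gd v x| <= B * n.+1%:R^-1.
    move=> xn; apply: le_trans (gB x) _; rewrite ler_wpM2l// xn.
    rewrite lef_pV2 ?posrE ?ltr0n// ?ltr_pwDl ?sqr_ge0//.
    rewrite (@le_trans _ _ (n.+1%:R ^+ 2)) ?lerDr// expr2 ler_peMr// ler1n//.
  by rewrite mulrnAl mulr2n lerD// h// sqrrN.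
move=> cvg0; exact: (cvg_unique _ cvgf cvg0).
Qed.

(** [g'] is the derivative of [f] times the density and has integral zero; its two terms are the two
    sides. *)
Lemma normal_prob_stein :
  (\int[normal_prob 0 (Num.sqrt v)]_x (x * f x)%:E =
   v%:E * \int[normal_prob 0 (Num.sqrt v)]_x (f' x)%:E)%E.
Proof.
have pdfE (h : R -> R) : (fun x => (h x * normal_pdf 0 (Num.sqrt v) x)%:E) =
    (fun x => (h x * gd v x)%:E).
  by apply/funext => x; rewrite normal_pdf_sqrtE.
rewrite !integral_normal_prob ?pdfE//; last exact: measurable_funM.
have := integral_g'.
under eq_integral do rewrite g'E.
rewrite integralD//; last exact: integrableZl.
rewrite integralZl//.
have /fineK <- := integrable_fin_num measurableT fi.
have /fineK <- := integrable_fin_num measurableT f'i.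
rewrite -!EFinM -EFinD => -[h]; congr EFin.
move: h; set b := fine _; set a := fine _ => h.
have -> : b = v^-1 * a by lra.
by rewrite mulrA divff ?mul1r// gt_eqF.
Qed.

End stein.
End gaussian_stein.

(** * The Gaussian law, zero variance included *)

Section gauss_prob.
Context {R : realType}.
Implicit Types (v x : R) (m : nat).

(** [gauss_law] packaged as a probability measure. The Dirac branch is reached when the error
    variance is 0, that is, under perfect channel knowledge. *)
Definition gauss_prob v : probability (measurableTypeR R) R :=
  if v == 0 then (dirac (0 : measurableTypeR R) : probability (measurableTypeR R) R)
  else (normal_prob 0 (Num.sqrt v) : probability (measurableTypeR R) R).

Lemma gauss_probE v (B : set R) : gauss_prob v B = gauss_law v B.
Proof. by rewrite /gauss_prob /gauss_law; case: ifP. Qed.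

Lemma gauss_prob_integrable v m (f : R -> R) C : 0 <= v ->
  measurable_fun [set: R] f -> (forall x, `|f x| <= C * (1 + x ^+ 2) ^+ m) ->
  (gauss_prob v).-integrable [set: R] (EFin \o f).
Proof.
rewrite le_eqVlt /gauss_prob eq_sym; case: eqVneq => /= [_ _|_ v0] mf fC.
  apply/integrableP; split; first exact/measurable_EFinP.
  rewrite integral_dirac//=; first by rewrite diracT mul1e ltry.
  by apply/measurable_EFinP; exact: measurableT_comp.
apply: integrable_normal_probP => //.
exact: integrable_poly_normal_pdf v0 mf fC.
Qed.

Lemma gauss_prob_stein v (f f' : R -> R) C m : 0 <= v ->
  (forall x, is_derive x 1 f (f' x)) -> continuous f' ->
  (forall x, `|f x| <= C * (1 + x ^+ 2) ^+ m) ->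
  (forall x, `|f' x| <= C * (1 + x ^+ 2) ^+ m) ->
  (\int[gauss_prob v]_x (x * f x)%:E = v%:E * \int[gauss_prob v]_x (f' x)%:E)%E.
Proof.
rewrite le_eqVlt /gauss_prob eq_sym; case: eqVneq => /= [-> _|_ v0] ff' cf' fC f'C.
  have cf : continuous f.
    move=> x; apply: differentiable_continuous; apply/derivable1_diffP.
    by case: (ff' x).
  rewrite mul0e integral_dirac//= ?mul0r ?mule0//.
  by apply/measurable_EFinP; apply: measurable_funM => //; exact: continuous_measurable_fun.
exact: normal_prob_stein v0 ff' cf' fC f'C.
Qed.

End gauss_prob.

(** * Finite products of the real line and laws of random vectors *)

Section product_space.
Context {I : finType} {R : realType}.

Definition rectangle (B : I -> set R) : set (I -> R) := [set x | forall i, B i (x i)].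

Definition rectangles : set_system (I -> R) :=
  [set rectangle B | B in [set B | forall i, measurable (B i)]].

(** Rectangles are stable under intersection and include the whole space, so a probability is
    determined by its values on them. *)
Definition prodR : measurableType _ := g_sigma_algebraType rectangles.

Lemma measurable_rectangle (B : I -> set R) : (forall i, measurable (B i)) ->
  measurable (rectangle B : set prodR).
Proof. by move=> mB; apply: sub_sigma_algebra; exists B. Qed.

Lemma measurable_coord i : measurable_fun setT (fun x : prodR => x i).
Proof.
move=> _ B mB; rewrite setTI.
rewrite (_ : _ @^-1` B = rectangle (fun j => if j == i then B else setT)).
  by apply: measurable_rectangle => j; case: ifP.
apply/seteqP; split => x /=; first by move=> Bx j; case: eqP => // ->.
by move=> /(_ i); rewrite eqxx.
Qed.

Lemma measurable_prodR d (T : measurableType d) (f : T -> prodR) :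
  (forall i, measurable_fun setT (fun w => f w i)) -> measurable_fun setT f.
Proof.
move=> mf; apply: (@measurability _ _ T prodR setT f rectangles) => //.
move=> _ [_ [B mB <-] <-]; rewrite setTI.
rewrite (_ : _ @^-1` _ = \bigcap_(i in [set: I]) ((fun w => f w i) @^-1` B i)).
  apply: fin_bigcap_measurable => // i _.
  by rewrite -[X in measurable X]setTI; exact: mf.
by apply/seteqP; split => w /= h i; [move=> _; exact: h|exact: (h i)].
Qed.

Lemma rectangles_setI : setI_closed rectangles.
Proof.
move=> _ _ [B mB <-] [C mC <-]; exists (fun i => B i `&` C i).
  by move=> i; exact: measurableI.
by apply/seteqP; split => x /= => [h|[hB hC] i]; [split=> i; case: (h i)|split].
Qed.

Lemma rectanglesT : rectangles setT.
Proof. by exists (fun _ => setT) => //; apply/seteqP; split. Qed.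

End product_space.
Arguments prodR : clear implicits.

Section law.
Context {I : finType} {R : realType} d (T : measurableType d).
Variables (P : probability T R) (X : T -> prodR I R).
Variable m : probability (prodR I R) R.
Hypotheses (mX : measurable_fun setT X)
  (Xm : forall B : I -> set R, (forall i, measurable (B i)) ->
    P (X @^-1` rectangle B) = m (rectangle B)).

Let Xp : {mfun T >-> prodR I R} := HB.pack X (isMeasurableFun.Build _ _ _ _ X mX).

Lemma law_measure A : measurable A -> P (X @^-1` A) = m A.
Proof.
move=> mA.
apply: (@measure_unique _ R (prodR I R) rectangles (fun _ => setT) _ _ _ _ (pushforward P Xp) m) => //.
- exact: rectangles_setI.
- by move=> _; exact: rectanglesT.
- by rewrite bigcup_const.
- by move=> _ [B mB <-]; exact: Xm.
- by move=> _; apply: le_lt_trans (probability_le1 P (@measurableT _ T)) _; exact: ltry.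
Qed.

Lemma ge0_integral_law (f : prodR I R -> \bar R) : measurable_fun setT f ->
  (forall x, 0 <= f x)%E -> (\int[P]_w f (X w) = \int[m]_x f x)%E.
Proof.
move=> mf f0; have := @ge0_integral_pushforward _ _ _ _ R X mX P setT f measurableT mf.
rewrite preimage_setT => <-; last by move=> x _; exact: f0.
by apply: eq_measure_integral => A mA _; exact: law_measure.
Qed.

Lemma integral_law (f : prodR I R -> \bar R) : measurable_fun setT f ->
  (\int[P]_w f (X w) = \int[m]_x f x)%E.
Proof.
move=> mf; rewrite integralE [RHS]integralE; congr (_ - _)%E.
- by rewrite -(@ge0_integral_law (f^\+)%E)//; [by apply: eq_integral => w _; rewrite !funeposE|exact: measurable_funepos].
- by rewrite -(@ge0_integral_law (f^\-)%E)//; [by apply: eq_integral => w _; rewrite !funenegE|exact: measurable_funeneg].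
Qed.

Lemma integrable_law (f : prodR I R -> \bar R) : measurable_fun setT f ->
  m.-integrable setT f <-> P.-integrable setT (fun w => f (X w)).
Proof.
move=> mf; have e : (\int[P]_w `|f (X w)| = \int[m]_x `|f x|)%E.
  by apply: (@ge0_integral_law (abse \o f)) => [|x]; [exact: measurableT_comp|exact: abse_ge0].
split=> /integrableP[_ fi]; apply/integrableP; split => //.
- exact: (measurableT_comp mf mX).
- by rewrite e.
- by rewrite -e.
Qed.

End law.

Section resampling.
Context {I : finType} {R : realType}.
Implicit Types (v : I -> R) (x : I -> R) (c : I).

(** Independence of the coordinates and their Gaussian marginals, in a single equation. *)
Definition gauss_product v (m : set (prodR I R) -> \bar R) : Prop :=
  forall B, (forall i, measurable (B i)) ->
    m (rectangle B) = (\prod_i gauss_prob (v i) (B i))%E.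

Definition upd x c (y : R) : I -> R := fun i => if i == c then y else x i.

Lemma upd_id x c : upd x c (x c) = x.
Proof. by apply/funext => i; rewrite /upd; case: eqP => // ->. Qed.

Lemma upd_upd x c y y' : upd (upd x c y) c y' = upd x c y'.
Proof. by apply/funext => i; rewrite /upd; case: eqP. Qed.

Lemma upd_eq x c y : upd x c y c = y. Proof. by rewrite /upd eqxx. Qed.

Lemma measurable_upd c :
  measurable_fun setT (fun z : prodR I R * measurableTypeR R => upd z.1 c z.2 : prodR I R).
Proof.
apply: measurable_prodR => i; rewrite /upd; case: eqP => _.
  exact: measurable_snd.
exact: (measurableT_comp (measurable_coord i) measurable_fst).
Qed.

Variables (v : I -> R) (m : probability (prodR I R) R).
Hypothesis mv : gauss_product v m.

(** Redrawing the coordinate [c] independently does not change the law, as both sides factor over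
    the coordinates. This plays the part of conditioning on the other coordinates. *)
Lemma resample_law c B : (forall i, measurable (B i)) ->
  (m \x gauss_prob (v c))%E ((fun z => upd z.1 c z.2) @^-1` rectangle B) = m (rectangle B).
Proof.
move=> mB.
rewrite (_ : _ @^-1` _ = rectangle (fun i => if i == c then setT else B i) `*` B c); last first.
  apply/seteqP; split => [[x y]|[x y]] /= h.
    split; last by have := h c; rewrite upd_eq.
    by move=> i; case: eqP => // /eqP/negbTE ic; have := h i; rewrite /upd ic.
  by case: h => h1 h2 i; rewrite /upd; have := h1 i; case: eqP => // ->.
have mA : measurable (rectangle (fun i => if i == c then setT else B i) : set (prodR I R)).
  by apply: measurable_rectangle => i; case: ifP.
transitivity (m (rectangle (fun i => if i == c then setT else B i)) *
    gauss_prob (v c) (B c))%E; first exact: (product_measure1E m (gauss_prob (v c)) mA (mB c)).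
rewrite !mv//; last by move=> i; case: ifP.
rewrite (bigD1 c)//= eqxx probability_setT mul1e [RHS](bigD1 c)//= muleC.
by congr (_ * _)%E; apply: eq_bigr => i /negbTE ->.
Qed.

(** Fubini after the redraw; one-dimensional identities can then be applied to the inner
    integral. *)
Lemma integral_resample c (f : prodR I R -> R) : m.-integrable setT (EFin \o f) ->
  (\int[m]_x (f x)%:E = \int[m]_x \int[gauss_prob (v c)]_y (f (upd x c y))%:E)%E.
Proof.
move=> fi; have mf : measurable_fun setT (EFin \o f) by exact: measurable_int fi.
have law := @resample_law c.
have fi' := (integrable_law (measurable_upd c) law mf).1 fi.
by rewrite -(integral_law (measurable_upd c) law mf) -integral12_prod_meas1.
Qed.

End resampling.

(** * Functions of polynomial growth *)

Lemma sum_expn_le {R : realDomainType} (I : finType) (a : I -> R) k :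
  (forall i, 0 <= a i) -> (\sum_i a i) ^+ k.+1 <= #|I|%:R ^+ k.+1 * \sum_i a i ^+ k.+1.
Proof.
move=> a0; have sX0 (J : pred I) l : 0 <= \sum_(i | J i) a i ^+ l.
  by apply: sumr_ge0 => i _; exact: exprn_ge0.
case: (pickP (predT : pred I)) => [i0 _|no].
  have [j _ jmax] := arg_maxP a (isT : predT i0).
  have : \sum_i a i <= #|I|%:R * a j.
    rewrite mulr_natl -sumr_const; apply: ler_sum => i _; exact: jmax.
  move=> /(lerXn2r k.+1 (sumr_ge0 _ (fun i _ => a0 i)) (mulr_ge0 (ler0n _ _) (a0 j))).
  move=> /le_trans; apply; rewrite exprMn ler_wpM2l ?exprn_ge0//.
  by rewrite (bigD1 j)//= lerDl.
by rewrite big_pred0// expr0n mulr_ge0// exprn_ge0.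
Qed.

Section polynomial_growth.
Context {I : finType} {R : realType}.
Implicit Types (f g : (I -> R) -> R) (x : I -> R).

Definition sqsum x : R := \sum_i x i ^+ 2.

Lemma sqsum_ge0 x : 0 <= sqsum x.
Proof. by apply: sumr_ge0 => i _; exact: sqr_ge0. Qed.

Lemma sqsum1 x : 1 <= 1 + sqsum x. Proof. by rewrite lerDl sqsum_ge0. Qed.

Lemma sqsum_upd x c y : sqsum (upd x c y) <= sqsum x + y ^+ 2.
Proof.
rewrite /sqsum (bigD1 c)//= upd_eq [X in _ <= X + _](bigD1 c)//= addrC.
rewrite lerD2r -[leLHS]add0r lerD ?sqr_ge0//.
by apply: ler_sum => i /negbTE; rewrite /upd => ->.
Qed.

(** The working class of integrands: closed under sums and products, and contained in the integrable
    functions of every Gaussian product ([polyg_integrable]), so integrability is read off the shape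
    of the integrand. *)
Definition polyg f : Prop := measurable_fun [set: prodR I R] f /\
  exists C k, forall x, `|f x| <= C * (1 + sqsum x) ^+ k.

Lemma polyg_bounded f C : measurable_fun [set: prodR I R] f ->
  (forall x, `|f x| <= C) -> polyg f.
Proof. by move=> mf fC; split => //; exists C, 0 => x; rewrite expr0 mulr1. Qed.

Lemma polyg_cst (r : R) : polyg (fun=> r).
Proof. exact: (@polyg_bounded _ `|r|). Qed.

Lemma polyg_coord c : polyg (fun x => x c).
Proof.
split; first exact: measurable_coord.
exists 1, 1%N => x; rewrite mul1r expr1.
have : x c ^+ 2 <= sqsum x.
  by rewrite /sqsum (bigD1 c)//= lerDl sumr_ge0// => i _; exact: sqr_ge0.
have := sqr_ge0 (`|x c| - 1); have := sqr_ge0 (x c); rewrite sqrrB real_normK ?num_real//; lra.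
Qed.

Lemma polyg_bound f : polyg f ->
  exists C k, 0 <= C /\ forall x, `|f x| <= C * (1 + sqsum x) ^+ k.
Proof.
move=> [_ [C [k fC]]]; exists C, k; split => //.
have := le_trans (normr_ge0 _) (fC (fun=> 0)).
by rewrite pmulr_lge0// exprn_gt0// (lt_le_trans ltr01 (sqsum1 _)).
Qed.

Lemma polyg_bound2 f g : polyg f -> polyg g -> exists C k, 0 <= C /\
  forall x, `|f x| <= C * (1 + sqsum x) ^+ k /\ `|g x| <= C * (1 + sqsum x) ^+ k.
Proof.
move=> /polyg_bound[C [k [C0 fC]]] /polyg_bound[C' [k' [C'0 gC]]].
exists (C + C'), (maxn k k'); split; first exact: addr_ge0.
move=> x; split.
  apply: le_trans (fC x) _; apply: ler_pM; rewrite ?exprn_ge0 ?lerDl//.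
    exact: le_trans ler01 (sqsum1 _).
  by apply: ler_weXn2l; [exact: sqsum1|exact: leq_maxl].
apply: le_trans (gC x) _; apply: ler_pM; rewrite ?exprn_ge0 ?lerDr//.
  exact: le_trans ler01 (sqsum1 _).
by apply: ler_weXn2l; [exact: sqsum1|exact: leq_maxr].
Qed.

Lemma polygD f g : polyg f -> polyg g -> polyg (fun x => f x + g x).
Proof.
move=> pf pg; have [C [k [C0 fgC]]] := polyg_bound2 pf pg.
split; first by apply: measurable_funD; [exact: pf.1|exact: pg.1].
exists (C + C), k => x; rewrite mulrDl (le_trans (ler_normD _ _))//.
by have [? ?] := fgC x; exact: lerD.
Qed.

Lemma polygM f g : polyg f -> polyg g -> polyg (fun x => f x * g x).
Proof.
move=> pf pg; have [C [k [C0 fgC]]] := polyg_bound2 pf pg.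
split; first by apply: measurable_funM; [exact: pf.1|exact: pg.1].
exists (C * C), (k + k)%N => x; rewrite normrM exprD mulrACA.
by have [? ?] := fgC x; exact: ler_pM.
Qed.

Lemma polygN f : polyg f -> polyg (fun x => - f x).
Proof.
by move=> pf; have := polygM (polyg_cst (-1)) pf; under eq_fun do rewrite mulN1r.
Qed.

Lemma polygZ (r : R) f : polyg f -> polyg (fun x => r * f x).
Proof. exact/polygM/polyg_cst. Qed.

Lemma polygB f g : polyg f -> polyg g -> polyg (fun x => f x - g x).
Proof. by move=> pf pg; exact/polygD/polygN. Qed.

Lemma polygX n f : polyg f -> polyg (fun x => f x ^+ n).
Proof.
move=> pf; elim: n => [|n IH]; first by under eq_fun do rewrite expr0; exact: polyg_cst.
under eq_fun do rewrite exprS; exact: polygM.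
Qed.

Lemma polyg_sum (J : Type) (s : seq J) (P : pred J) (F : J -> (I -> R) -> R) :
  (forall j, P j -> polyg (F j)) -> polyg (fun x => \sum_(j <- s | P j) F j x).
Proof.
move=> pF; elim: s => [|j s IH].
  by under eq_fun do rewrite big_nil; exact: polyg_cst.
case Pj: (P j); under eq_fun do rewrite big_cons Pj.
  by apply: polygD => //; exact: pF.
exact: IH.
Qed.

Lemma polyg_le f g : measurable_fun [set: prodR I R] f -> polyg g ->
  (forall x, `|f x| <= g x) -> polyg f.
Proof.
move=> mf [_ [C [k gC]]] fg; split => //; exists C, k => x.
exact: le_trans (fg x) (le_trans (ler_norm _) (gC x)).
Qed.

End polynomial_growth.

(** * Stein's identity for a product of Gaussian laws *)

Section multivariate_stein.
Context {I : finType} {R : realType}.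
Variables (v : I -> R) (m : probability (prodR I R) R).
Hypotheses (v0 : forall i, 0 <= v i) (mv : gauss_product v m).
Implicit Types (f g : (I -> R) -> R) (x : I -> R) (c : I).

Lemma ge0_integral_coord c (h : R -> \bar R) : measurable_fun [set: R] h ->
  (forall y, 0 <= h y)%E ->
  (\int[m]_x h (x c) = \int[gauss_prob (v c)]_y h y)%E.
Proof.
move=> mh h0.
have mc : measurable_fun setT (fun x : prodR I R => x c : measurableTypeR R).
  exact: measurable_coord.
have := @ge0_integral_pushforward _ _ _ _ R _ mc m setT h measurableT mh.
rewrite preimage_setT => <-; last by move=> x _; exact: h0.
apply: eq_measure_integral => A mA _.
have mR i : measurable ((if i == c then A else setT) : set R) by case: ifP.
transitivity (m (rectangle (fun i => if i == c then A else setT))).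
  rewrite /pushforward; congr (m _); apply/seteqP; split => x /=.
    by move=> Ax j; case: eqP => // ->.
  by move=> /(_ c); rewrite eqxx.
rewrite mv// (bigD1 c)//= eqxx big1 ?mule1// => i /negbTE ->.
exact: probability_setT.
Qed.

Lemma integrable_coord c k : m.-integrable setT (fun x : prodR I R => (x c ^+ 2 ^+ k)%:E).
Proof.
have mk : measurable_fun [set: R] (fun y : R => y ^+ 2 ^+ k).
  by apply: measurable_funX; exact: measurable_funX.
apply/integrableP; split.
  by apply/measurable_EFinP; exact: (measurableT_comp mk (measurable_coord c)).
have mk' : measurable_fun [set: R] (fun y : R => `|(y ^+ 2 ^+ k)%:E|%E).
  by apply/measurable_EFinP; exact: measurableT_comp.
have h0 (y : R) : (0 <= `|(y ^+ 2 ^+ k)%:E|)%E by exact: abse_ge0.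
rewrite [ltLHS](ge0_integral_coord c mk' h0).
have ck (y : R) : `|y ^+ 2 ^+ k| <= 1 * (1 + y ^+ 2) ^+ k.
  rewrite mul1r ger0_norm; last by rewrite exprn_ge0// sqr_ge0.
  by apply: lerXn2r; rewrite ?nnegrE ?addr_ge0 ?sqr_ge0// lerDr.
by have /integrableP[] := gauss_prob_integrable (v0 c) mk ck.
Qed.

(** The growth bound is dominated by a combination of even powers of single coordinates, each
    integrable by [integrable_coord]. *)
Lemma polyg_integrable f : polyg f -> m.-integrable setT (EFin \o f).
Proof.
move=> pf; have [C [k [C0 fC]]] := polyg_bound pf.
have mf : measurable_fun setT (EFin \o f : prodR I R -> \bar R).
  by apply/measurable_EFinP; exact: pf.1.
(* The exponent is raised from [k] to [k.+1] because [sum_expn_le] needs a positive power. *)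
pose h (x : prodR I R) := (C * 2 ^+ k.+1) *
  (1 + #|I|%:R ^+ k.+1 * \sum_i x i ^+ 2 ^+ k.+1).
have ih : m.-integrable setT (EFin \o h).
  have -> : EFin \o h = (fun x => (C * 2 ^+ k.+1)%:E *
      ((1 : R)%:E + (#|I|%:R ^+ k.+1)%:E * \sum_i (x i ^+ 2 ^+ k.+1)%:E))%E.
    by apply/funext => x; rewrite /h /= sumEFin.
  apply: integrableZl => //; apply: integrableD => //.
    exact: finite_measure_integrable_cst.
  apply: integrableZl => //; apply: integrable_sum => // i _.
  exact: integrable_coord.
apply: le_integrable ih => // x _; rewrite /= lee_fin; apply: le_trans (fC x) _.
apply: le_trans (ler_norm _); rewrite /h -mulrA ler_wpM2l//.
apply: (@le_trans _ _ ((1 + sqsum x) ^+ k.+1)).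
  by apply: ler_weXn2l; [exact: sqsum1|exact: leqnSn].
have Sk : sqsum x ^+ k.+1 <= #|I|%:R ^+ k.+1 * \sum_i x i ^+ 2 ^+ k.+1.
  by apply: sum_expn_le => i; exact: sqr_ge0.
apply: (@le_trans _ _ (2 ^+ k.+1 * (1 + sqsum x ^+ k.+1))); last first.
  by rewrite ler_wpM2l ?exprn_ge0// lerD2l.
have S0 := sqsum_ge0 x.
have [S1|/ltW S1] := lerP (sqsum x) 1.
  apply: (@le_trans _ _ (2 ^+ k.+1)).
    by rewrite lerXn2r ?nnegrE ?addr_ge0//; lra.
  by rewrite ler_peMr ?exprn_ge0// lerDl exprn_ge0.
apply: (@le_trans _ _ ((2 * sqsum x) ^+ k.+1)).
  by rewrite lerXn2r ?nnegrE ?addr_ge0 ?mulr_ge0//; lra.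
by rewrite exprMn ler_wpM2l ?exprn_ge0// lerDr.
Qed.

(** After resampling [c], the inner integral on each side is the one-dimensional identity with the
    other coordinates frozen. *)
Lemma stein c f f' : polyg f -> polyg f' ->
  (forall x, is_derive (x c) 1 (fun t => f (upd x c t)) (f' x)) ->
  (forall x, continuous (fun t => f' (upd x c t))) ->
  \int[m]_x (x c * f x) = v c * \int[m]_x f' x.
Proof.
move=> pf pf' ff' cf'; have [C [k [C0 fC]]] := polyg_bound2 pf pf'.
have if' := polyg_integrable pf'.
rewrite /Rintegral.
have -> : (\int[m]_x (x c * f x)%:E = (v c)%:E * \int[m]_x (f' x)%:E)%E.
  rewrite [LHS](@integral_resample _ _ _ _ mv c (fun x => x c * f x)); last first.
    exact: polyg_integrable (polygM (polyg_coord c) pf).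
  rewrite -integralZl//.
  have mf' : measurable_fun setT (fun x : prodR I R => v c * f' x).
    by apply: measurable_funM => //; exact: pf'.1.
  have -> : (\int[m]_x ((v c)%:E * (f' x)%:E) = \int[m]_x (v c * f' x)%:E)%E.
    by apply: eq_integral => x _; rewrite EFinM.
  rewrite [RHS](@integral_resample _ _ _ _ mv c (fun x => v c * f' x)); last first.
    exact: polyg_integrable (polygZ (v c) pf').
  apply: eq_integral => x _.
  under eq_integral do rewrite upd_eq.
  have growth y : (1 + sqsum (upd x c y)) ^+ k <= (1 + sqsum x) ^+ k * (1 + y ^+ 2) ^+ k.
    rewrite -exprMn; apply: lerXn2r; rewrite ?nnegrE ?mulr_ge0 ?addr_ge0 ?sqsum_ge0 ?sqr_ge0//.
    have := sqsum_upd x c y.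
    have := mulr_ge0 (sqsum_ge0 x) (sqr_ge0 y); lra.
  have gC g y : (forall z, `|g z| <= C * (1 + sqsum z) ^+ k) ->
      `|g (upd x c y)| <= C * (1 + sqsum x) ^+ k * (1 + y ^+ 2) ^+ k.
    move=> h; apply: le_trans (h _) _; rewrite -mulrA ler_wpM2l//.
  have dfx (t : R) : is_derive t 1 (fun t : R => f (upd x c t)) (f' (upd x c t)).
    have := ff' (upd x c t); rewrite upd_eq.
    by under eq_fun do rewrite upd_upd.
  have gf (y : R) := gC f y (fun z => (fC z).1).
  have gf' (y : R) := gC f' y (fun z => (fC z).2).
  rewrite (gauss_prob_stein (v0 c) dfx (cf' x) gf gf').
  have ci : (gauss_prob (v c)).-integrable setT (EFin \o (fun y => f' (upd x c y))).
    exact: gauss_prob_integrable (v0 c) (continuous_measurable_fun (cf' x)) gf'.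
  by rewrite -integralZl//; apply: eq_integral => y _; rewrite EFinM.
by rewrite fineM//; exact: integrable_fin_num.
Qed.

End multivariate_stein.

(** * Expectations of finite sums, and Stein's identity for quadratic forms *)

Section expectation.
Context d (T : measurableType d) {R : realType} (m : probability T R).
Implicit Types f g : T -> R.

Lemma Rintegral_prob_cst (r : R) : \int[m]_(x in setT) r = r.
Proof.
rewrite Rintegral_cst// -[RHS]mulr1; congr (_ * _).
by have -> : 1 = fine (1%:E : \bar R) by []; congr fine; exact: probability_setT.
Qed.

Lemma integrable_Rsum (J : Type) (r : seq J) (P : pred J) (F : J -> T -> R) :
  (forall j, P j -> m.-integrable setT (EFin \o F j)) ->
  m.-integrable setT (EFin \o (fun x => \sum_(j <- r | P j) F j x)).
Proof.
move=> iF; elim: r => [|j r IH].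
  have -> : (fun x : T => \sum_(j <- [::] | P j) F j x) = (fun=> 0).
    by apply/funext => x; rewrite big_nil.
  exact: finite_measure_integrable_cst.
case Pj : (P j); last first.
  have -> // : (fun x : T => \sum_(i <- j :: r | P i) F i x) =
              (fun x => \sum_(i <- r | P i) F i x).
  by apply/funext => x; rewrite big_cons Pj.
have -> : (fun x : T => \sum_(i <- j :: r | P i) F i x) =
          (fun x => F j x + \sum_(i <- r | P i) F i x).
  by apply/funext => x; rewrite big_cons Pj.
have -> : EFin \o (fun x => F j x + \sum_(i <- r | P i) F i x) =
    (fun x => (F j x)%:E + (\sum_(i <- r | P i) F i x)%:E)%E by [].
by apply: integrableD => //; exact: iF.
Qed.

Lemma Rintegral_sum (J : Type) (r : seq J) (P : pred J) (F : J -> T -> R) :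
  (forall j, P j -> m.-integrable setT (EFin \o F j)) ->
  \int[m]_x (\sum_(j <- r | P j) F j x) = \sum_(j <- r | P j) \int[m]_x F j x.
Proof.
move=> iF; elim: r => [|j r IH].
  under eq_Rintegral do rewrite big_nil.
  by rewrite big_nil Rintegral_cst// mul0r.
rewrite big_cons -IH; case Pj : (P j).
  under eq_Rintegral do rewrite big_cons Pj.
  by rewrite RintegralD//; [exact: iF|exact: integrable_Rsum].
by apply: eq_Rintegral => x _; rewrite big_cons Pj.
Qed.

End expectation.

Section quadratic_form_stein.
Context {I : finType} {R : realType}.
Variables (v : I -> R) (m : probability (prodR I R) R).
Hypotheses (v0 : forall i, 0 <= v i) (mv : gauss_product v m).
Variables (J A : finType) (emb : J -> I) (s : R).
Hypotheses (emb_inj : injective emb) (vs : forall j, v (emb j) = s).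
Variables (l : A -> J -> (I -> R) -> R) (B : R).
Hypotheses (ml : forall a j, measurable_fun [set: prodR I R] (l a j))
  (lB : forall a j x, `|l a j x| <= B)
  (indep_l : forall a j x k t, l a j (upd x (emb k) t) = l a j x).

Definition linform a (x : I -> R) : R := \sum_j l a j x * x (emb j).
Definition quadform (x : I -> R) : R := \sum_a linform a x ^+ 2.
Definition gradform j (x : I -> R) : R := \sum_a l a j x * linform a x.
Definition coefsq j (x : I -> R) : R := \sum_a l a j x ^+ 2.

Lemma linform_upd a j x t :
  linform a (upd x (emb j) t) = linform a x + l a j x * (t - x (emb j)).
Proof.
rewrite /linform (bigD1 j)//= [in RHS](bigD1 j)//= indep_l upd_eq.
rewrite (eq_bigr (fun k => l a k x * x (emb k))); first by ring.
by move=> k kj; rewrite indep_l /upd (inj_eq emb_inj) (negbTE kj).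
Qed.

Lemma gradform_upd j x t :
  gradform j (upd x (emb j) t) = gradform j x + coefsq j x * (t - x (emb j)).
Proof.
rewrite /gradform /coefsq mulr_suml -big_split/=; apply: eq_bigr => a _.
rewrite linform_upd indep_l; ring.
Qed.

Lemma coefsq_upd j x k t : coefsq j (upd x (emb k) t) = coefsq j x.
Proof. by apply: eq_bigr => a _; rewrite indep_l. Qed.

Lemma quadform_upd j x t : quadform (upd x (emb j) t) =
  quadform x + 2 * gradform j x * (t - x (emb j)) + coefsq j x * (t - x (emb j)) ^+ 2.
Proof.
rewrite /quadform /gradform /coefsq mulr_sumr !mulr_suml -!big_split/=.
by apply: eq_bigr => a _; rewrite linform_upd; ring.
Qed.

Lemma quadform_ge0 x : 0 <= quadform x.
Proof. by apply: sumr_ge0 => a _; exact: sqr_ge0. Qed.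

(** Euler's identity for a homogeneous function of degree two. *)
Lemma sum_coord_gradform x : \sum_j x (emb j) * gradform j x = quadform x.
Proof.
rewrite /quadform /gradform; under eq_bigr do rewrite mulr_sumr.
rewrite exchange_big/=; apply: eq_bigr => a _.
by rewrite expr2 {2}/linform mulr_suml; apply: eq_bigr => j _; ring.
Qed.

Lemma polyg_l a j : polyg (l a j).
Proof. exact: polyg_bounded (ml a j) (lB a j). Qed.

Lemma polyg_linform a : polyg (linform a).
Proof. by apply: polyg_sum => j _; apply: polygM (polyg_l a j) (polyg_coord _). Qed.

Lemma polyg_quadform : polyg quadform.
Proof. by apply: polyg_sum => a _; apply: polygX; exact: polyg_linform. Qed.

Lemma polyg_gradform j : polyg (gradform j).
Proof. by apply: polyg_sum => a _; apply: polygM (polyg_l a j) (polyg_linform a). Qed.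

Lemma polyg_coefsq j : polyg (coefsq j).
Proof. by apply: polyg_sum => a _; apply: polygX; exact: polyg_l. Qed.

Variables (phi phi' : R -> R) (C : R) (k : nat).
Hypotheses (dphi : forall q : R, 0 <= q -> is_derive q 1 phi (phi' q))
  (cphi' : forall q : R, 0 <= q -> {for q, continuous phi'})
  (mphi : measurable_fun [set: R] phi) (mphi' : measurable_fun [set: R] phi')
  (phiC : forall q : R, 0 <= q -> `|phi q| <= C * (1 + q) ^+ k)
  (phi'C : forall q : R, 0 <= q -> `|phi' q| <= C * (1 + q) ^+ k).

Let polyg_comp (h : R -> R) : measurable_fun [set: R] h ->
  (forall q : R, 0 <= q -> `|h q| <= C * (1 + q) ^+ k) -> polyg (fun x => h (quadform x)).
Proof.
move=> mh hC; apply: (@polyg_le _ _ _ (fun x => C * (1 + quadform x) ^+ k)).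
- exact: measurableT_comp mh polyg_quadform.1.
- by apply: polygZ; apply: polygX; apply: polygD; [exact: polyg_cst|exact: polyg_quadform].
- by move=> x; apply: hC; exact: quadform_ge0.
Qed.

(** By Euler's identity Q phi(Q) is the sum over j of x_j times [gradform j] phi(Q); Stein's
    identity applies to each term, and the derivative of [gradform j] phi(Q) is [coefsq j] phi(Q) +
    2 ([gradform j])^2 phi'(Q). *)
Lemma quadform_stein :
  \int[m]_x (quadform x * phi (quadform x)) =
  s * (\int[m]_x ((\sum_j coefsq j x) * phi (quadform x)) +
       2 * \int[m]_x ((\sum_j gradform j x ^+ 2) * phi' (quadform x))).
Proof.
pose f j x := gradform j x * phi (quadform x).
pose f' j x := coefsq j x * phi (quadform x) + 2 * gradform j x ^+ 2 * phi' (quadform x).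
have pphi := polyg_comp mphi phiC.
have pphi' := polyg_comp mphi' phi'C.
have pf j : polyg (f j) by apply: polygM (polyg_gradform j) pphi.
have pf1 j : polyg (fun x => coefsq j x * phi (quadform x)).
  by apply: polygM (polyg_coefsq j) pphi.
have pf2 j : polyg (fun x => gradform j x ^+ 2 * phi' (quadform x)).
  by apply: polygM _ pphi'; apply: polygX; exact: polyg_gradform.
have pf' j : polyg (f' j).
  apply: polygD => //.
  have -> : (fun x => 2 * gradform j x ^+ 2 * phi' (quadform x)) =
     (fun x => 2 * (gradform j x ^+ 2 * phi' (quadform x))).
    by apply/funext => x; rewrite mulrA.
  exact: polygZ.
have st j : \int[m]_x (x (emb j) * f j x) = s * \int[m]_x f' j x.
  rewrite -(vs j); apply: (stein v0 mv) => // x.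
    rewrite /f; pose D := gradform j x; pose b := coefsq j x; pose y := x (emb j).
    pose Q (t : R) := quadform x + 2 * D * (t - y) + b * (t - y) ^+ 2.
    have -> : (fun t => gradform j (upd x (emb j) t) * phi (quadform (upd x (emb j) t))) =
        (fun t : R => D + b * (t - y)) * (phi \o Q).
      by apply/funext => t; rewrite gradform_upd quadform_upd.
    have dphiQ : is_derive (Q y) 1 phi (phi' (quadform x)).
      have -> : Q y = quadform x by rewrite /Q subrr expr0n !mulr0 !addr0.
      exact/dphi/quadform_ge0.
    have dQ : is_derive y 1 Q (2 * D).
      rewrite /Q; apply: is_derive_eq.
      rewrite /GRing.scale/= subrr; ring.
    have dL : is_derive y 1 (fun t : R => D + b * (t - y)) b.
      by apply: is_derive_eq; rewrite /GRing.scale/=; ring.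
    apply: (@is_derive_eq _ _ _ _ _ _ _ _ (is_deriveM dL (is_derive1_comp dphiQ dQ))).
    rewrite /GRing.scale/= /f' -/D -/b.
    have -> : Q y = quadform x by rewrite /Q subrr expr0n !mulr0 !addr0.
    rewrite subrr; ring.
  move=> y0; pose D := gradform j x; pose b := coefsq j x; pose y := x (emb j).
  pose Q (t : R) := quadform x + 2 * D * (t - y) + b * (t - y) ^+ 2.
  have QE t : quadform (upd x (emb j) t) = Q t by rewrite quadform_upd.
  have -> : (fun t => f' j (upd x (emb j) t)) =
      (fun t : R => b * phi (Q t) + 2 * (D + b * (t - y)) ^+ 2 * phi' (Q t)).
    by apply/funext => t; rewrite /f' gradform_upd QE coefsq_upd.
  have cid : {for y0, continuous (fun t : R => t - y)}.
    by apply: cvgB; [exact: cvg_id|exact: cvg_cst].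
  have cL : {for y0, continuous (fun t : R => D + b * (t - y))}.
    by apply: cvgD; [exact: cvg_cst|apply: cvgM => //; exact: cvg_cst].
  have cQ : {for y0, continuous Q}.
    apply: cvgD; last by apply: cvgM; [exact: cvg_cst|exact: (cvgM cid cid)].
    by apply: cvgD; [exact: cvg_cst|apply: cvgM => //; exact: cvg_cst].
  have Q0 : 0 <= Q y0 by rewrite -QE quadform_ge0.
  have cphi : {for Q y0, continuous phi}.
    apply: differentiable_continuous; apply/derivable1_diffP.
    by case: (dphi Q0).
  apply: cvgD; apply: cvgM; [exact: cvg_cst|exact: (continuous_comp cQ cphi)| |
    exact: (continuous_comp cQ (cphi' Q0))].
  by apply: cvgM; [exact: cvg_cst|exact: (cvgM cL cL)].
have pi g : polyg g -> m.-integrable setT (EFin \o g) by move=> pg; exact: (polyg_integrable v0 mv pg).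
transitivity (\sum_j \int[m]_x (x (emb j) * f j x)).
  rewrite -Rintegral_sum; last first.
    by move=> j _; exact: (pi _ (polygM (polyg_coord (emb j)) (pf j))).
  apply: eq_Rintegral => x _; rewrite -[X in X * _]sum_coord_gradform mulr_suml.
  by apply: eq_bigr => j _; rewrite /f mulrA.
under eq_bigr do rewrite st; rewrite -mulr_sumr; congr (_ * _).
rewrite -RintegralZl//; last first.
  apply: pi; apply: polygM _ pphi'; apply: polyg_sum => j _.
  by apply: polygX; exact: polyg_gradform.
rewrite -RintegralD//; last 2 first.
- by apply: pi; apply: polygM _ pphi; apply: polyg_sum => j _; exact: polyg_coefsq.
- apply: pi; apply: polygZ; apply: polygM _ pphi'; apply: polyg_sum => j _.
  by apply: polygX; exact: polyg_gradform.
rewrite -Rintegral_sum; last by move=> j _; exact: pi.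
apply: eq_Rintegral => x _; rewrite /f' big_split/= -!mulr_suml; congr (_ + _).
by rewrite -mulr_sumr mulrA.
Qed.

End quadratic_form_stein.

(** * Squared moduli and Hermitian norms of complex matrices *)

Local Notation "A ^H" := (map_mx Num.conj A^T) (at level 8, format "A ^H").

Section squared_modulus.
Context {R : realType}.
Implicit Types (z w : R[i]) (r : R).
Local Notation Re := complex.Re.
Local Notation Im := complex.Im.

Lemma conjE z : Num.conj z = conjc z. Proof. by []. Qed.

Lemma conjCR r : Num.conj r%:C = r%:C. Proof. exact: conjc_real. Qed.
Lemma ReD z w : Re (z + w) = Re z + Re w. Proof. by case: z w => [? ?] []. Qed.
Lemma ImD z w : Im (z + w) = Im z + Im w. Proof. by case: z w => [? ?] []. Qed.
Lemma ReM z w : Re (z * w) = Re z * Re w - Im z * Im w.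
Proof. by case: z w => [? ?] []. Qed.
Lemma ImM z w : Im (z * w) = Re z * Im w + Im z * Re w.
Proof. by case: z w => [? ?] []. Qed.
Lemma ReJ z : Re (Num.conj z) = Re z. Proof. by case: z. Qed.
Lemma ImJ z : Im (Num.conj z) = - Im z. Proof. by case: z. Qed.

Lemma Re_sum (J : Type) (s : seq J) (P : pred J) (F : J -> R[i]) :
  Re (\sum_(j <- s | P j) F j) = \sum_(j <- s | P j) Re (F j).
Proof. exact: (big_morph _ ReD (erefl : Re 0 = 0)). Qed.

Lemma Im_sum (J : Type) (s : seq J) (P : pred J) (F : J -> R[i]) :
  Im (\sum_(j <- s | P j) F j) = \sum_(j <- s | P j) Im (F j).
Proof. exact: (big_morph _ ImD (erefl : Im 0 = 0)). Qed.

Lemma sqmodE z : sqmod z = Re z ^+ 2 + Im z ^+ 2.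
Proof. by case: z => a b; rewrite /sqmod sqr_sqrtr// addr_ge0// sqr_ge0. Qed.

Lemma sqmod_ge0 z : 0 <= sqmod z. Proof. exact: sqr_ge0. Qed.

Lemma sqmod0 : sqmod (0 : R[i]) = 0.
Proof. by rewrite sqmodE /= expr0n addr0. Qed.

Lemma sqmodM z w : sqmod (z * w) = sqmod z * sqmod w.
Proof. by rewrite /sqmod ComplexField.Normc.normcM exprMn. Qed.

Lemma sqmodJ z : sqmod (Num.conj z) = sqmod z.
Proof. by rewrite !sqmodE ReJ ImJ sqrrN. Qed.

Lemma sqmodN z : sqmod (- z) = sqmod z.
Proof. by rewrite -mulN1r sqmodM sqmodE /= oppr0 expr0n sqrrN expr1n addr0 mul1r. Qed.

Lemma sqmodR r : sqmod r%:C = r ^+ 2.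
Proof. by rewrite sqmodE /= expr0n addr0. Qed.

Lemma sqmodC z : (sqmod z)%:C = z * Num.conj z.
Proof.
apply/eqP; rewrite eq_complex ReM ImM ReJ ImJ sqmodE /=.
by apply/andP; split; apply/eqP; ring.
Qed.

Lemma sqmod_eq0 z : (sqmod z == 0) = (z == 0).
Proof.
apply/idP/eqP => [|->]; last by rewrite sqmod0.
rewrite sqmodE paddr_eq0 ?sqr_ge0// !sqrf_eq0 => /andP[/eqP z1 /eqP z2].
by apply/eqP; rewrite eq_complex z1 z2 !eqxx.
Qed.

Lemma sqmodD_le z w : sqmod (z + w) <= 2 * (sqmod z + sqmod w).
Proof.
rewrite !sqmodE ReD ImD.
have := sqr_ge0 (Re z - Re w); have := sqr_ge0 (Im z - Im w); lra.
Qed.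

(** Lagrange's identity: twice the gap is the sum of the squares of all two by two minors. *)
Lemma sum_cauchy_schwarz (J : finType) (x y : J -> R) :
  (\sum_j x j * y j) ^+ 2 <= (\sum_j x j ^+ 2) * (\sum_j y j ^+ 2).
Proof.
have : 0 <= \sum_i \sum_j (x i * y j - x j * y i) ^+ 2.
  by do 2!(apply: sumr_ge0 => ? _); exact: sqr_ge0.
have -> : \sum_i \sum_j (x i * y j - x j * y i) ^+ 2 =
    (\sum_i x i ^+ 2) * (\sum_j y j ^+ 2) + (\sum_i y i ^+ 2) * (\sum_j x j ^+ 2)
    - 2 * (\sum_j x j * y j) ^+ 2.
  rewrite expr2 !mulr_suml mulr_sumr -big_split -sumrB/=; apply: eq_bigr => i _.
  rewrite !mulr_sumr -big_split -sumrB/=; apply: eq_bigr => j _; ring.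
by rewrite (mulrC (\sum_i y i ^+ 2)); lra.
Qed.

Lemma sqmod_sum_cauchy_schwarz (J : finType) (x y : J -> R[i]) :
  sqmod (\sum_j x j * y j) <= (\sum_j sqmod (x j)) * (\sum_j sqmod (y j)).
Proof.
apply: le_trans (sum_cauchy_schwarz (fun j => ComplexField.Normc.normc (x j)) _).
rewrite /sqmod; apply: lerXn2r.
- by case: (\sum_j _) => a b; rewrite nnegrE sqrtr_ge0.
- rewrite nnegrE sumr_ge0// => j _; rewrite mulr_ge0//; [case: (x j)|case: (y j)] => a b;
    exact: sqrtr_ge0.
have normc_sum (F : J -> R[i]) : ComplexField.Normc.normc (\sum_j F j) <=
    \sum_j ComplexField.Normc.normc (F j).
  elim/big_rec2: _ => [|j a b _ ab]; first by rewrite ComplexField.Normc.normc0.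
  by apply: le_trans (le_normcD _ _) _; rewrite lerD2l.
apply: le_trans (normc_sum _) _.
by under eq_bigr do rewrite ComplexField.Normc.normcM.
Qed.

End squared_modulus.

Section squared_norm.
Context {R : realType}.
Implicit Types (m n p : nat).

Definition nrm2 m n (A : 'M[R[i]]_(m, n)) : R := \sum_i \sum_j sqmod (A i j).

Lemma l2normE m n (A : 'M[R[i]]_(m, n)) : l2norm A = Num.sqrt (nrm2 A).
Proof. by []. Qed.

Lemma nrm2_ge0 m n (A : 'M[R[i]]_(m, n)) : 0 <= nrm2 A.
Proof. by do 2!(apply: sumr_ge0 => ? _); exact: sqmod_ge0. Qed.

Lemma nrm2_col n (w : 'cV[R[i]]_n) : nrm2 w = \sum_i sqmod (w i 0).
Proof. by apply: eq_bigr => i _; rewrite big_ord1. Qed.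

Lemma nrm2_row n (w : 'rV[R[i]]_n) : nrm2 w = \sum_i sqmod (w 0 i).
Proof. by rewrite /nrm2 big_ord1. Qed.

Lemma nrm2_tr m n (A : 'M[R[i]]_(m, n)) : nrm2 A^T = nrm2 A.
Proof.
rewrite /nrm2 exchange_big/=; apply: eq_bigr => i _.
by apply: eq_bigr => j _; rewrite mxE.
Qed.

Lemma nrm2J m n (A : 'M[R[i]]_(m, n)) : nrm2 (map_mx Num.conj A) = nrm2 A.
Proof. by do 2!(apply: eq_bigr => ? _); rewrite mxE sqmodJ. Qed.

Lemma nrm2H m n (A : 'M[R[i]]_(m, n)) : nrm2 A^H = nrm2 A.
Proof. by rewrite nrm2J nrm2_tr. Qed.

Lemma nrm2Z m n (a : R[i]) (A : 'M[R[i]]_(m, n)) : nrm2 (a *: A) = sqmod a * nrm2 A.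
Proof.
by rewrite /nrm2 mulr_sumr; apply: eq_bigr => i _; rewrite mulr_sumr;
  apply: eq_bigr => j _; rewrite mxE sqmodM.
Qed.

Lemma nrm20 m n : nrm2 (0 : 'M[R[i]]_(m, n)) = 0.
Proof. by rewrite /nrm2 big1// => i _; rewrite big1// => j _; rewrite mxE sqmod0. Qed.

Lemma nrm2_eq0 m n (A : 'M[R[i]]_(m, n)) : nrm2 A = 0 -> A = 0.
Proof.
move=> A0; apply/matrixP => i j; rewrite mxE; apply/eqP; rewrite -sqmod_eq0.
have row0 := psumr_eq0P (fun i _ => sumr_ge0 _ (fun j _ => sqmod_ge0 (A i j))) A0.
by have /(_ j isT) -> := psumr_eq0P (fun j _ => sqmod_ge0 (A i j)) (row0 i isT).
Qed.

Lemma nrm2_trace m n (A : 'M[R[i]]_(m, n)) : (nrm2 A)%:C = \tr (A *m A^H).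
Proof.
rewrite /nrm2 /mxtrace rmorph_sum/=; apply: eq_bigr => i _.
rewrite mxE rmorph_sum/=; apply: eq_bigr => j _.
by rewrite !mxE sqmodC.
Qed.

Lemma conj_is_trmxCK m n (A : 'M[R[i]]_(m, n)) : (A^H)^H = A.
Proof. by apply/matrixP => i j; rewrite !mxE conjCK. Qed.

Lemma mulmxH m n p (A : 'M[R[i]]_(m, n)) (B : 'M[R[i]]_(n, p)) :
  (A *m B)^H = B^H *m A^H.
Proof. by rewrite trmx_mul map_mxM. Qed.

Lemma nrm2_colE n (w : 'cV[R[i]]_n) : (nrm2 w)%:C = (w^H *m w) 0 0.
Proof.
by rewrite -nrm2H nrm2_trace conj_is_trmxCK /mxtrace big_ord1.
Qed.

Lemma sqmod_mulmx_le n (u : 'rV[R[i]]_n) (w : 'cV[R[i]]_n) :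
  sqmod ((u *m w) 0 0) <= nrm2 u * nrm2 w.
Proof. by rewrite mxE nrm2_row nrm2_col; exact: sqmod_sum_cauchy_schwarz. Qed.

End squared_norm.

(** * Measurability of complex random matrices *)

Section complex_measurability.
Context {R : realType}.

(** The inverse is written x exp(-ln(x^2)), which is also 0 at x = 0. *)
Lemma measurable_inv : measurable_fun [set: R] (@GRing.inv R).
Proof.
have -> : @GRing.inv R = (fun x => x * expR (- ln (x ^+ 2))).
  apply/funext => x; have [->|x0] := eqVneq x 0; first by rewrite invr0 mul0r.
  have x20 : 0 < x ^+ 2 by rewrite exprn_even_gt0.
  by rewrite expRN lnK ?posrE// expr2 invfM mulrA divff// mul1r.
apply: measurable_funM => //; apply: measurableT_comp => //.
apply: measurableT_comp => //; apply: measurableT_comp; first exact: measurable_ln.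
exact: measurable_funX.
Qed.

Lemma measurable_funV d (T : measurableType d) (f : T -> R) :
  measurable_fun setT f -> measurable_fun setT (fun x => (f x)^-1).
Proof. by move=> mf; exact: (measurableT_comp measurable_inv). Qed.

Context d (T : measurableType d).
Implicit Types f g : T -> R[i].
Local Notation Re := complex.Re.
Local Notation Im := complex.Im.

Definition cmeas f := measurable_fun setT (fun x => Re (f x)) /\
  measurable_fun setT (fun x => Im (f x)).

Lemma cmeas_cst (z : R[i]) : cmeas (fun=> z). Proof. by []. Qed.

Lemma cmeasD f g : cmeas f -> cmeas g -> cmeas (fun x => f x + g x).
Proof.
move=> [f1 f2] [g1 g2]; split.
  by under eq_fun do rewrite ReD; exact: measurable_funD.
by under eq_fun do rewrite ImD; exact: measurable_funD.
Qed.

Lemma cmeasM f g : cmeas f -> cmeas g -> cmeas (fun x => f x * g x).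
Proof.
move=> [f1 f2] [g1 g2]; split.
  by under eq_fun do rewrite ReM; apply: measurable_funB; exact: measurable_funM.
by under eq_fun do rewrite ImM; apply: measurable_funD; exact: measurable_funM.
Qed.

Lemma cmeasJ f : cmeas f -> cmeas (fun x => Num.conj (f x)).
Proof.
move=> [f1 f2]; split; first by under eq_fun do rewrite ReJ.
by under eq_fun do rewrite ImJ; exact: measurableT_comp.
Qed.

Lemma cmeasR (f : T -> R) : measurable_fun setT f -> cmeas (fun x => (f x)%:C).
Proof. by []. Qed.

Lemma measurable_sqmod f : cmeas f -> measurable_fun setT (fun x => sqmod (f x)).
Proof.
move=> [f1 f2]; under eq_fun do rewrite sqmodE.
by apply: measurable_funD; exact: measurable_funX.
Qed.

Lemma cmeasV f : cmeas f -> cmeas (fun x => (f x)^-1).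
Proof.
move=> mf; have -> : (fun x => (f x)^-1) =
    (fun x => ((sqmod (f x))^-1)%:C * Num.conj (f x)).
  apply/funext => x; have [->|fx] := eqVneq (f x) 0; first by rewrite invr0 rmorph0 mulr0.
  by rewrite fmorphV /= sqmodC invfM -mulrA mulVf ?mulr1// conjC_eq0.
apply: cmeasM; last exact: cmeasJ.
exact/cmeasR/measurable_funV/measurable_sqmod.
Qed.

Lemma cmeas_sum (J : Type) (s : seq J) (P : pred J) (F : J -> T -> R[i]) :
  (forall j, cmeas (F j)) -> cmeas (fun x => \sum_(j <- s | P j) F j x).
Proof.
move=> mF; split.
  under eq_fun do rewrite Re_sum big_mkcond/=.
  by apply: measurable_sum => j; case: (P j) => //; exact: (mF j).1.
under eq_fun do rewrite Im_sum big_mkcond/=.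
by apply: measurable_sum => j; case: (P j) => //; exact: (mF j).2.
Qed.

Lemma cmeas_prod (J : Type) (s : seq J) (F : J -> T -> R[i]) :
  (forall j, cmeas (F j)) -> cmeas (fun x => \prod_(j <- s) F j x).
Proof.
move=> mF; elim: s => [|j s IH]; first by under eq_fun do rewrite big_nil.
by under eq_fun do rewrite big_cons; apply: cmeasM.
Qed.

Definition mxmeas p q (A : T -> 'M[R[i]]_(p, q)) := forall i j, cmeas (fun x => A x i j).

Lemma mxmeasM p q r (A : T -> 'M[R[i]]_(p, q)) (B : T -> 'M[R[i]]_(q, r)) :
  mxmeas A -> mxmeas B -> mxmeas (fun x => A x *m B x).
Proof.
move=> mA mB i j; under eq_fun do rewrite mxE.
by apply: cmeas_sum => k; exact: cmeasM.
Qed.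

Lemma mxmeasD p q (A B : T -> 'M[R[i]]_(p, q)) :
  mxmeas A -> mxmeas B -> mxmeas (fun x => A x + B x).
Proof. by move=> mA mB i j; under eq_fun do rewrite mxE; exact: cmeasD. Qed.

Lemma mxmeas_cst p q (A : 'M[R[i]]_(p, q)) : mxmeas (fun=> A).
Proof. by move=> i j; exact: cmeas_cst. Qed.

Lemma mxmeasZ p q (f : T -> R[i]) (A : T -> 'M[R[i]]_(p, q)) :
  cmeas f -> mxmeas A -> mxmeas (fun x => f x *: A x).
Proof. by move=> mf mA i j; under eq_fun do rewrite mxE; exact: cmeasM. Qed.

Lemma mxmeasN p q (A : T -> 'M[R[i]]_(p, q)) :
  mxmeas A -> mxmeas (fun x => - A x).
Proof.
move=> mA; under eq_fun do rewrite -scaleN1r.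
by apply: mxmeasZ mA; exact: cmeas_cst.
Qed.

Lemma mxmeasT p q (A : T -> 'M[R[i]]_(p, q)) : mxmeas A -> mxmeas (fun x => (A x)^T).
Proof. by move=> mA i j; under eq_fun do rewrite mxE; exact: mA. Qed.

Lemma mxmeasJ p q (A : T -> 'M[R[i]]_(p, q)) :
  mxmeas A -> mxmeas (fun x => map_mx Num.conj (A x)).
Proof. by move=> mA i j; under eq_fun do rewrite mxE; exact: cmeasJ. Qed.

Lemma cmeas_det p (A : T -> 'M[R[i]]_p) : mxmeas A -> cmeas (fun x => \det (A x)).
Proof.
move=> mA; apply: cmeas_sum => s; apply: cmeasM; first exact: cmeas_cst.
by apply: cmeas_prod => i; exact: mA.
Qed.

Lemma mxmeas_adj p (A : T -> 'M[R[i]]_p) : mxmeas A -> mxmeas (fun x => \adj (A x)).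
Proof.
move=> mA i j; under eq_fun do rewrite mxE.
apply: cmeasM; first exact: cmeas_cst.
by apply: cmeas_det => k l; under eq_fun do rewrite !mxE; exact: mA.
Qed.

Lemma measurable_nrm2 p q (A : T -> 'M[R[i]]_(p, q)) :
  mxmeas A -> measurable_fun setT (fun x => nrm2 (A x)).
Proof.
move=> mA; apply: measurable_sum => i; apply: measurable_sum => j.
exact/measurable_sqmod/mA.
Qed.

Lemma random_mxP p q (A : T -> 'M[R[i]]_(p, q)) : random_mx A <-> mxmeas A.
Proof.
split=> mA; last by case=> [[i j] []]; rewrite /real_comp/=; have [] := mA i j.
by move=> i j; split; [exact: (mA (i, j, false))|exact: (mA (i, j, true))].
Qed.

End complex_measurability.

(** * Quadratic forms in a complex Gaussian vector *)

Section complex_gaussian.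
Context {U : finType} {n : nat} {R : realType}.
Local Notation I := (U * ('I_n * 'I_1 * bool))%type.
Local Notation Re := complex.Re.
Local Notation Im := complex.Im.
Implicit Types (x : I -> R) (u : U).

Definition cvec x u : 'cV[R[i]]_n :=
  \col_i (x (u, (i, 0, false)) +i* x (u, (i, 0, true))).

Lemma mxmeas_cvec u : mxmeas (fun x : prodR I R => cvec x u).
Proof.
move=> i j; split.
  have -> : (fun x : prodR I R => Re (cvec x u i j)) = fun x => x (u, (i, 0, false)).
    by apply/funext => x; rewrite mxE.
  exact: measurable_coord.
have -> : (fun x : prodR I R => Im (cvec x u i j)) = fun x => x (u, (i, 0, true)).
  by apply/funext => x; rewrite mxE.
exact: measurable_coord.
Qed.

Lemma cvec_upd x u u' j t : u' != u -> cvec (upd x (u, j) t) u' = cvec x u'.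
Proof.
move=> u'u; apply/matrixP => i k; rewrite !mxE /upd !xpair_eqE.
by rewrite (negbTE u'u).
Qed.

Section quadratic_form.
Variables (v : U -> R) (m : probability (prodR I R) R).
Hypotheses (v0 : forall u, 0 <= v u) (mv : gauss_product (fun c => v c.1 / 2) m).
Variables (u : U) (A : finType) (w : A -> (I -> R) -> 'cV[R[i]]_n) (B : R).
Hypotheses (mw : forall a, mxmeas (w a : prodR I R -> _))
  (wB : forall a x, nrm2 (w a x) <= B)
  (indep_w : forall a x j t, w a (upd x (u, j) t) = w a x).

Definition cform a x : R[i] := ((cvec x u)^T *m w a x) 0 0.
Definition cquad x : R := \sum_a sqmod (cform a x).
(** In complex notation, the squared norm of half the real gradient of [cquad] with respect to the
    vector of [u]; [cweight] is a quarter of the Laplacian. *)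
Definition cgrad x : R := \sum_i sqmod (\sum_a Num.conj (w a x i 0) * cform a x).
Definition cweight x : R := \sum_a nrm2 (w a x).

Let coef (a : A * bool) (j : 'I_n * 'I_1 * bool) x : R :=
  let z := w a.1 x j.1.1 0 in
  if a.2 then (if j.2 then Re z else Im z) else (if j.2 then - Im z else Re z).

Let emb j : I := (u, j).

Let emb_inj : injective emb. Proof. by move=> ? ? []. Qed.

Let sum_index (F : 'I_n * 'I_1 * bool -> R) :
  \sum_j F j = \sum_i (F (i, 0, false) + F (i, 0, true)).
Proof.
transitivity (\sum_p \sum_b F (p, b)).
  by rewrite pair_bigA; apply: eq_bigr; case.
transitivity (\sum_i \sum_k \sum_b F (i, k, b)).
  by rewrite [RHS]pair_bigA; apply: eq_bigr; case.
by apply: eq_bigr => i _; rewrite big_ord1 big_bool /= addrC.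
Qed.

Let sum_forms (F : A * bool -> R) : \sum_a F a = \sum_a (F (a, false) + F (a, true)).
Proof.
transitivity (\sum_a \sum_b F (a, b)).
  by rewrite pair_bigA; apply: eq_bigr; case.
by apply: eq_bigr => a _; rewrite big_bool /= addrC.
Qed.

Let cformE a x : cform a x = \sum_i cvec x u i 0 * w a x i 0.
Proof. by rewrite /cform mxE; apply: eq_bigr => i _; rewrite mxE. Qed.

Let linform_false a x : linform emb coef (a, false) x = Re (cform a x).
Proof.
rewrite /linform sum_index cformE Re_sum; apply: eq_bigr => i _.
rewrite ReM !mxE /coef /emb/=; ring.
Qed.

Let linform_true a x : linform emb coef (a, true) x = Im (cform a x).
Proof.
rewrite /linform sum_index cformE Im_sum; apply: eq_bigr => i _.
rewrite ImM !mxE /coef /emb/=; ring.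
Qed.

Let quadformE x : quadform emb coef x = cquad x.
Proof.
rewrite /quadform sum_forms; apply: eq_bigr => a _.
by rewrite linform_false linform_true sqmodE.
Qed.

Let coefsqE x : \sum_j coefsq coef j x = 2 * cweight x.
Proof.
rewrite sum_index /cweight mulr_sumr; under [RHS]eq_bigr do rewrite nrm2_col mulr_sumr.
rewrite exchange_big/=; apply: eq_bigr => i _.
rewrite /coefsq !sum_forms -big_split/=; apply: eq_bigr => a _.
rewrite sqmodE /coef /=; ring.
Qed.

Let gradformE x : \sum_j gradform emb coef j x ^+ 2 = cgrad x.
Proof.
rewrite sum_index /cgrad; apply: eq_bigr => i _.
rewrite sqmodE Re_sum Im_sum /gradform !sum_forms; congr (_ ^+ 2 + _ ^+ 2);
  apply: eq_bigr => a _; rewrite linform_false linform_true ?ReM ?ImM ReJ ImJ /coef/=;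
  ring.
Qed.

Let mcoef a j : measurable_fun [set: prodR I R] (coef a j).
Proof.
have [mRe mIm] := mw a.1 j.1.1 0.
rewrite /coef; case: a.2; case: j.2 => //; exact: measurableT_comp.
Qed.

Let coefB a j x : `|coef a j x| <= 1 + B.
Proof.
have wz : sqmod (w a.1 x j.1.1 0) <= B.
  apply: le_trans (wB a.1 x); rewrite nrm2_col (bigD1 j.1.1)//= lerDl.
  by apply: sumr_ge0 => i _; exact: sqmod_ge0.
rewrite sqmodE in wz.
have abs_le (y : R) : `|y| <= 1 + y ^+ 2.
  have := sqr_ge0 (`|y| - 1); have := sqr_ge0 y.
  rewrite sqrrB real_normK ?num_real//; lra.
have := sqr_ge0 (Re (w a.1 x j.1.1 0)); have := sqr_ge0 (Im (w a.1 x j.1.1 0)).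
have := abs_le (Re (w a.1 x j.1.1 0)); have := abs_le (Im (w a.1 x j.1.1 0)).
by rewrite /coef; case: a.2; case: j.2; rewrite /= ?normrN; lra.
Qed.

Let indep_coef a j x k t : coef a j (upd x (emb k) t) = coef a j x.
Proof. by rewrite /coef indep_w. Qed.

Lemma cquad_ge0 x : 0 <= cquad x.
Proof. by apply: sumr_ge0 => a _; exact: sqmod_ge0. Qed.

Lemma polyg_cquad : polyg cquad.
Proof.
rewrite (_ : cquad = quadform emb coef); last by apply/funext => x; rewrite quadformE.
exact: polyg_quadform mcoef coefB.
Qed.

Lemma polyg_cweight : polyg cweight.
Proof.
apply: polyg_sum => a _; apply: (@polyg_bounded _ _ _ B).
  by apply: measurable_nrm2; exact: mw.
by move=> x; rewrite ger0_norm ?nrm2_ge0.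
Qed.

Lemma polyg_cgrad : polyg cgrad.
Proof.
rewrite (_ : cgrad = (fun x => \sum_j gradform emb coef j x ^+ 2)); last first.
  by apply/funext => x; rewrite gradformE.
by apply: polyg_sum => j _; apply: polygX; exact: polyg_gradform mcoef coefB _.
Qed.

(** Real coordinates have variance [v u / 2]; this half cancels against the 2 of [coefsqE] and the 2
    of [quadform_stein], which is why complex variances produce no constants. *)
Lemma cquad_stein (phi phi' : R -> R) (C : R) (k : nat) :
  (forall q : R, 0 <= q -> is_derive q 1 phi (phi' q)) ->
  (forall q : R, 0 <= q -> {for q, continuous phi'}) ->
  measurable_fun [set: R] phi -> measurable_fun [set: R] phi' ->
  (forall q : R, 0 <= q -> `|phi q| <= C * (1 + q) ^+ k) ->
  (forall q : R, 0 <= q -> `|phi' q| <= C * (1 + q) ^+ k) ->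
  \int[m]_x (cquad x * phi (cquad x)) =
  v u * (\int[m]_x (cweight x * phi (cquad x)) +
         \int[m]_x (cgrad x * phi' (cquad x))).
Proof.
move=> dphi cphi' mphi mphi' phiC phi'C.
have v20 (c : I) : 0 <= v c.1 / 2 by rewrite divr_ge0.
have := @quadform_stein I R _ m v20 mv _ _ emb (v u / 2) emb_inj (fun=> erefl) coef
  (1 + B) mcoef coefB indep_coef phi phi' C k dphi cphi' mphi mphi' phiC phi'C.
under eq_Rintegral do rewrite quadformE.
move=> ->; under eq_Rintegral do rewrite quadformE coefsqE -mulrA.
under [X in _ + 2 * X]eq_Rintegral do rewrite quadformE gradformE.
rewrite RintegralZl//; first by field.
apply: (polyg_integrable v20 mv); apply: polygM polyg_cweight _.
apply: (@polyg_le _ _ _ (fun x => C * (1 + cquad x) ^+ k)).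
- exact: measurableT_comp mphi polyg_cquad.1.
- by apply: polygZ; apply: polygX; apply: polygD; [exact: polyg_cst|exact: polyg_cquad].
- by move=> x; apply: phiC; exact: cquad_ge0.
Qed.

End quadratic_form.
End complex_gaussian.

(** * Moments and inverse moments of complex quadratic forms *)

Section moments.
Context {U : finType} {n : nat} {R : realType}.
Local Notation I := (U * ('I_n * 'I_1 * bool))%type.
Variables (v : U -> R) (m : probability (prodR I R) R).
Hypotheses (v0 : forall u, 0 <= v u) (mv : gauss_product (fun c => v c.1 / 2) m).
Variables (u : U) (A : finType) (w : A -> (I -> R) -> 'cV[R[i]]_n) (B : R).
Hypotheses (mw : forall a, mxmeas (w a : prodR I R -> _))
  (wB : forall a x, nrm2 (w a x) <= B)
  (indep_w : forall a x j t, w a (upd x (u, j) t) = w a x).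
Local Notation Q := (cquad u w).
Local Notation wt := (cweight w).
Local Notation gr := (cgrad u w).

Lemma polyg_integrable_gauss (f : (I -> R) -> R) : polyg f ->
  m.-integrable setT (EFin \o f).
Proof. by move=> pf; apply: (polyg_integrable _ mv pf) => c; rewrite divr_ge0. Qed.

Let pQ : polyg Q := polyg_cquad u mw wB.
Let pwt : polyg wt := polyg_cweight mw wB.
Let pgr : polyg gr := polyg_cgrad u mw wB.
Let pi := polyg_integrable_gauss.

Lemma cquad_mean : \int[m]_x Q x = v u * \int[m]_x wt x.
Proof.
have := @cquad_stein U n R v m v0 mv u A w B mw wB indep_w (fun=> 1) (fun=> 0) 1 0.
move=> h; have := h (fun q _ => is_derive_cst _ _ _) _ _ _ _ _ => {h}.
under eq_Rintegral do rewrite mulr1.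
under [X in _ = _ * (X + _)]eq_Rintegral do rewrite mulr1.
under [X in _ = _ * (_ + X)]eq_Rintegral do rewrite mulr0.
rewrite Rintegral_cst// mul0r addr0; apply => //.
- by move=> q _; exact: cvg_cst.
- by move=> q _; rewrite expr0 mulr1 normr1.
- by move=> q _; rewrite expr0 mulr1 normr0.
Qed.

Lemma cquad_stein_pow k :
  \int[m]_x Q x ^+ k.+1 =
  v u * (\int[m]_x (wt x * Q x ^+ k) + k%:R * \int[m]_x (gr x * Q x ^+ k.-1)).
Proof.
have := @cquad_stein U n R v m v0 mv u A w B mw wB indep_w (fun q => q ^+ k)
  (fun q => k%:R * q ^+ k.-1) k.+1%:R k.
under eq_Rintegral do rewrite -exprS.
under [X in _ = _ * (_ + X)]eq_Rintegral do rewrite mulrCA.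
rewrite RintegralZl//; last first.
  by apply: pi; apply: polygM pgr _; exact: polygX.
apply.
- move=> q q0; have -> : (fun q : R => q ^+ k) = (@id R) ^+ k by apply/funext => t; rewrite fctE.
  by apply: is_derive_eq; rewrite /GRing.scale/= mulr1.
- move=> q q0; apply: cvgM; first exact: cvg_cst.
  exact: exprn_continuous.
- exact: measurable_funX.
- by apply: measurable_funM => //; exact: measurable_funX.
- move=> q q0; rewrite ger0_norm ?exprn_ge0//.
  rewrite -[leLHS]mul1r ler_pM ?exprn_ge0 ?ler1n//.
  by rewrite lerXn2r ?nnegrE ?addr_ge0// lerDr.
- move=> q q0; rewrite ger0_norm ?mulr_ge0 ?exprn_ge0//.
  rewrite ler_pM ?exprn_ge0 ?ler_nat//.
  apply: (@le_trans _ _ ((1 + q) ^+ k.-1)).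
    by rewrite lerXn2r ?nnegrE ?addr_ge0// lerDr.
  by rewrite ler_weXn2l ?lerDl ?leq_pred.
Qed.

Lemma polyg_cquad_inv (e : R) k : 0 < e -> polyg (fun x => (Q x + e)^-1 ^+ k).
Proof.
move=> e0; apply: polygX; apply: (@polyg_bounded _ _ _ e^-1).
  by apply: measurable_funV; apply: measurable_funD => //; exact: pQ.1.
move=> x; have Q0 : 0 <= Q x := cquad_ge0 _ _ _.
have Qe : 0 < Q x + e by rewrite ltr_wpDl.
by rewrite ger0_norm ?invr_ge0 ?(ltW Qe)// lef_pV2 ?posrE// lerDr.
Qed.

Section grad_bound.
Hypothesis grQ : forall x, gr x <= Q x.

(** Integration by parts gives the recursion E Q^(k+1) <= v (tau + k) E Q^k. *)
Lemma cquad_moment_le (tau : R) k : (forall x, wt x <= tau) -> 0 <= tau ->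
  \int[m]_x Q x ^+ k <= (v u * (tau + k%:R)) ^+ k.
Proof.
move=> wt_le tau0; have Q0 x : 0 <= Q x := cquad_ge0 _ _ _.
elim: k => [|k IH].
  under eq_Rintegral do rewrite expr0.
  by rewrite Rintegral_prob_cst expr0.
have IX k' : m.-integrable setT (EFin \o (fun x => Q x ^+ k')).
  by apply: pi; exact: polygX.
rewrite cquad_stein_pow.
apply: (@le_trans _ _ (v u * ((tau + k%:R) * \int[m]_x Q x ^+ k))).
  rewrite ler_wpM2l// mulrDl lerD//.
    rewrite -RintegralZl//; apply: le_Rintegral => //.
    - by apply: pi; apply: polygM pwt _; exact: polygX.
    - by apply: pi; apply: polygZ; exact: polygX.
    - by move=> x _; rewrite ler_wpM2r ?exprn_ge0.
  case: k IH => [|k] IH; first by rewrite !mul0r.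
  rewrite ler_wpM2l//; apply: le_Rintegral => //.
  - by apply: pi; apply: polygM pgr _; exact: polygX.
  - by move=> x _; rewrite exprS ler_wpM2r ?exprn_ge0.
rewrite mulrA exprS.
have h : v u * (tau + k%:R) <= v u * (tau + k.+1%:R).
  by rewrite ler_wpM2l// lerD2l ler_nat.
have h0 : 0 <= v u * (tau + k%:R) by rewrite mulr_ge0// addr_ge0.
apply: ler_pM => //.
  by apply: Rintegral_ge0 => x _; rewrite exprn_ge0.
by apply: le_trans IH _; rewrite lerXn2r ?nnegrE// (le_trans h0).
Qed.

Section inverse_moments.
Variable N : nat.
Hypotheses (vu0 : 0 < v u) (wtN : forall x, N%:R <= wt x).

(** For phi(q) = (q + e)^-(k+1) the derivative enters with a minus sign: v (N - (k+1)) E (Q +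
    e)^-(k+1) <= E (Q + e)^-k. The condition on [k] keeps the factor above v N / 2, and induction
    follows. The shift [e] keeps phi and its derivative bounded. *)
Lemma inv_moment_eps_le e k : 0 < e -> (2 * k <= N)%N ->
  \int[m]_x (Q x + e)^-1 ^+ k <= (2 / (v u * N%:R)) ^+ k.
Proof.
move=> e0; have Q0 x : 0 <= Q x := cquad_ge0 _ _ _.
have Qe0 x : 0 < Q x + e by rewrite ltr_wpDl.
elim: k => [|k IH] kN.
  under eq_Rintegral do rewrite expr0.
  by rewrite Rintegral_prob_cst expr0.
have mV l : measurable_fun [set: R] (fun q => (q + e)^-1 ^+ l).
  by apply: measurable_funX; apply: measurable_funV; exact: measurable_funD.
have Vb q l : 0 <= q -> 0 <= (q + e)^-1 ^+ l <= e^-1 ^+ l.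
  move=> q0; have qe0 : 0 < q + e by rewrite ltr_wpDl.
  rewrite exprn_ge0 ?invr_ge0 ?(ltW qe0)//=.
  apply: lerXn2r; rewrite ?nnegrE ?invr_ge0 ?(ltW qe0) ?(ltW e0)//.
  by rewrite lef_pV2 ?posrE// lerDr.
have i1 : m.-integrable setT (EFin \o (fun x => (Q x + e)^-1 ^+ k.+1)) by exact/pi/polyg_cquad_inv.
have i2 : m.-integrable setT (EFin \o (fun x => gr x * (Q x + e)^-1 ^+ k.+2)).
  by apply/pi/polygM => //; exact: polyg_cquad_inv.
set V := fun l => \int[m]_x (Q x + e)^-1 ^+ l.
have st : \int[m]_x (Q x * (Q x + e)^-1 ^+ k.+1) = v u *
   (\int[m]_x (wt x * (Q x + e)^-1 ^+ k.+1) -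
    k.+1%:R * \int[m]_x (gr x * (Q x + e)^-1 ^+ k.+2)).
  rewrite -mulNr -(RintegralZl _ measurableT i2).
  rewrite [X in _ = _ * (_ + X)](_ : _ =
      \int[m]_x (gr x * (fun q => - (k.+1%:R * (q + e)^-1 ^+ k.+2)) (Q x))); last first.
    by apply: eq_Rintegral => x _ /=; ring.
  apply: (@cquad_stein U n R v m v0 mv u A w B mw wB indep_w
    (fun q => (q + e)^-1 ^+ k.+1) (fun q => - (k.+1%:R * (q + e)^-1 ^+ k.+2))
    (e^-1 ^+ k.+1 + k.+1%:R * e^-1 ^+ k.+2) 0).
  - move=> q q0; have qe : q + e != 0 by rewrite gt_eqF// ltr_wpDl.
    have dinv : is_derive q 1 (fun q : R => (q + e)^-1) (- (q + e)^-1 ^+ 2).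
      have dqe : is_derive q 1 (fun q : R => q + e) 1.
        by apply: is_derive_eq; rewrite addr0.
      have := @is_deriveV R (fun q : R => q + e) q 1 1 qe dqe.
      move=> h; apply: (is_derive_eq h).
      by rewrite /GRing.scale/= mulr1 exprVn.
    have -> : (fun q : R => (q + e)^-1 ^+ k.+1) = (fun q : R => (q + e)^-1) ^+ k.+1.
      by apply/funext => t; rewrite fctE.
    apply: (is_derive_eq (is_deriveX k.+1 dinv)).
    by rewrite /GRing.scale/= mulrN -mulrA -exprD addn2.
  - move=> q q0; apply: cvgN; apply: cvgM; first exact: cvg_cst.
    have qe : q + e != 0 by rewrite gt_eqF// ltr_wpDl.
    apply: (@continuous_comp _ _ _ (fun q : R => (q + e)^-1) (fun y => y ^+ k.+2)).
      apply: cvgV => //; apply: cvgD; [exact: cvg_id|exact: cvg_cst].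
    exact: exprn_continuous.
  - exact: mV.
  - by apply: measurableT_comp => //; apply: measurable_funM => //; exact: mV.
  - move=> q q0; have /andP[a b] := Vb q k.+1 q0; rewrite expr0 mulr1 ger0_norm//.
    by rewrite (le_trans b)// lerDl mulr_ge0// exprn_ge0// invr_ge0 ltW.
  - move=> q q0; have /andP[a b] := Vb q k.+2 q0; rewrite expr0 mulr1 normrN ger0_norm; last exact: mulr_ge0 (ler0n _ _) a.
    apply: le_trans (ler_wpM2l _ b) _ => //.
    by rewrite lerDr exprn_ge0// invr_ge0 ltW.
have l1 : \int[m]_x (Q x * (Q x + e)^-1 ^+ k.+1) <= V k.
  apply: le_Rintegral => //; [by apply/pi/polygM => //; exact: polyg_cquad_inv|exact/pi/polyg_cquad_inv|].
  move=> x _; rewrite exprS mulrA -[leRHS]mul1r ler_wpM2r ?exprn_ge0 ?invr_ge0 ?(ltW (Qe0 x))//.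
  by rewrite ler_pdivrMr// mul1r lerDl ltW.
have l2 : N%:R * V k.+1 <= \int[m]_x (wt x * (Q x + e)^-1 ^+ k.+1).
  rewrite -RintegralZl//; apply: le_Rintegral => //.
  - by apply/pi/polygZ/polyg_cquad_inv.
  - by apply/pi/polygM => //; exact: polyg_cquad_inv.
  - by move=> x _; rewrite ler_wpM2r// exprn_ge0// invr_ge0 ltW.
have l3 : \int[m]_x (gr x * (Q x + e)^-1 ^+ k.+2) <= V k.+1.
  apply: le_Rintegral; [by []|exact: i2|exact: i1|move=> x _].
  rewrite exprS mulrA -[leRHS]mul1r ler_wpM2r ?exprn_ge0 ?invr_ge0 ?(ltW (Qe0 x))//.
  rewrite ler_pdivrMr// mul1r; apply: le_trans (grQ x) _; by rewrite lerDl ltW.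
have N0 : (0 < N)%N by apply: leq_trans kN; rewrite mulnS.
have kN' : k.+1%:R <= N%:R / 2 :> R.
  by rewrite ler_pdivlMr// mulrC -natrM ler_nat.
have V0 : 0 <= V k.+1.
  by apply: Rintegral_ge0 => x _; rewrite exprn_ge0// invr_ge0 ltW.
have key : v u * (N%:R / 2) * V k.+1 <= V k.
  apply: le_trans _ l1; rewrite st -mulrA ler_wpM2l//.
  have : (k.+1%:R : R) * \int[m]_x (gr x * (Q x + e)^-1 ^+ k.+2) <= N%:R / 2 * V k.+1.
    by apply: ler_pM => //; apply: Rintegral_ge0 => x _; rewrite mulr_ge0 ?exprn_ge0 ?invr_ge0 ?(ltW (Qe0 x))//; apply: sumr_ge0 => i _; exact: sqmod_ge0.
  by move: l2; lra.
have vN0 : 0 < v u * (N%:R / 2) by rewrite mulr_gt0 ?divr_gt0 ?ltr0n.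
rewrite -/(V k.+1) exprS -ler_pdivrMl.
  apply: le_trans _ (IH _); last by apply: leq_trans kN; rewrite leq_mul.
  apply: le_trans key; rewrite ler_wpM2r//.
  by rewrite invfM invrK mulrC -mulrA.
by rewrite divr_gt0// mulr_gt0 ?ltr0n.
Qed.

End inverse_moments.
End grad_bound.
End moments.

Section inverse_moment_limit.
Context d (T : measurableType d) {R : realType} (m : probability T R).
Variables (Q : T -> R) (C : R) (k : nat).
Hypotheses (mQ : measurable_fun setT Q) (Q0 : forall x, 0 <= Q x)
  (QC : forall e : R, 0 < e ->
    m.-integrable setT (EFin \o (fun x => (Q x + e)^-1 ^+ k)) /\
    \int[m]_x (Q x + e)^-1 ^+ k <= C).

Let mQe e : measurable_fun setT (fun x => (Q x + e)^-1 ^+ k).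
Proof. by apply: measurable_funX; apply: measurable_funV; exact: measurable_funD. Qed.

Let Qe_ge0 (e : R) x : 0 < e -> 0 <= (Q x + e)^-1 ^+ k.
Proof. by move=> e0; rewrite exprn_ge0// invr_ge0 addr_ge0// ltW. Qed.

(** Monotone convergence along shifts e = 1/(j+1), under which the integrands increase. *)
Lemma inv_moment_limit : (0 < k)%N ->
  m.-integrable setT (EFin \o (fun x => (Q x)^-1 ^+ k)) /\
  \int[m]_x (Q x)^-1 ^+ k <= C.
Proof.
move=> k0; pose f j x := ((Q x + j.+1%:R^-1)^-1 ^+ k)%:E.
have e0 j : 0 < j.+1%:R^-1 :> R by rewrite invr_gt0 ltr0n.
have fle i j x : (i <= j)%N -> (f i x <= f j x)%E.
  move=> ij; rewrite lee_fin; apply: lerXn2r; rewrite ?nnegrE ?invr_ge0 ?addr_ge0 ?invr_ge0//.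
  rewrite lef_pV2 ?posrE ?ltr_wpDl// lerD2l lef_pV2 ?posrE ?ltr0n//.
  by rewrite ler_nat.
have mf j : measurable_fun setT (f j) by apply/measurable_EFinP; exact: mQe.
have mc := @monotone_convergence _ T R m setT measurableT f
  mf (fun j x _ => Qe_ge0 x (e0 j))
  (fun x _ i j ij => fle i j x ij).
have cf x : cvgn (f ^~ x).
  by apply: ereal_nondecreasing_is_cvgn => i j ij; exact: fle.
have mQk : measurable_fun setT (fun x => (Q x)^-1 ^+ k).
  by apply: measurable_funX; exact: measurable_funV.
have Qk0 x : 0 <= (Q x)^-1 ^+ k by rewrite exprn_ge0// invr_ge0.
have le1 : (\int[m]_x ((Q x)^-1 ^+ k)%:E <= C%:E)%E.
  apply: (@le_trans _ _ (\int[m]_x limn (f ^~ x))%E).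
    apply: ge0_le_integral => //.
    - by move=> x _; rewrite lee_fin.
    - exact/measurable_EFinP.
    - by apply: (emeasurable_fun_cvg f) => [j|x _]; [exact: mf|exact: cf].
    (* Where Q vanishes the convention that 0 has inverse 0 makes the left side 0, since [k] is
       positive; the bound there is trivial. *)
    - move=> x _; have [Qx0|Qx] := eqVneq (Q x) 0.
        rewrite Qx0 invr0 expr0n gtn_eqF//=.
        by apply: lime_ge => //; apply: nearW => j; exact: Qe_ge0.
      suff cfx : f ^~ x @ \oo --> ((Q x)^-1 ^+ k)%:E by rewrite (cvg_lim _ cfx).
      apply/fine_cvgP; split; first exact: nearW.
      apply: (@cvg_comp _ _ _ (fun j => (Q x + j.+1%:R^-1)^-1) (fun y => y ^+ k) _ (nbhs (Q x)^-1)).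
        apply: cvgV => //; rewrite -[X in _ --> X]addr0.
        by apply: cvgD; [exact: cvg_cst|exact: cvg_harmonic].
      exact: exprn_continuous.
  rewrite mc; apply: lime_le.
    apply: ereal_nondecreasing_is_cvgn => i j ij; apply: ge0_le_integral => //.
    - by move=> x _; exact: Qe_ge0.
    - by move=> x _; exact: fle.
  apply: nearW => j; have [ij jC] := QC (e0 j).
  by rewrite -[X in (X <= _)%E]fineK ?lee_fin//; exact: integrable_fin_num.
have iQ : m.-integrable setT (EFin \o (fun x => (Q x)^-1 ^+ k)).
  apply/integrableP; split; first exact/measurable_EFinP.
  apply: le_lt_trans (ltry C); apply: le_trans le1.
  by rewrite le_eqVlt; apply/orP; left; apply/eqP; apply: eq_integral => x _ /=;
    rewrite ger0_norm.
split => //; rewrite -lee_fin fineK//; exact: integrable_fin_num.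
Qed.

End inverse_moment_limit.

(** On the zero set of Q the integrand equals 1/e, so that set has measure at most e C for every
    e. *)
Lemma ae_gt0_of_inv_moment d (T : measurableType d) {R : realType}
    (m : probability T R) (Q : T -> R) (C : R) :
  measurable_fun setT Q -> (forall x, 0 <= Q x) ->
  (forall e : R, 0 < e ->
    m.-integrable setT (EFin \o (fun x => (Q x + e)^-1)) /\
    \int[m]_x (Q x + e)^-1 <= C) ->
  {ae m, forall x, 0 < Q x}.
Proof.
pose Z := Q @^-1` [set 0].
move=> mQ Q0 QC; exists Z; split => //.
- by rewrite -[X in measurable X]setTI; exact: mQ.
- have mA : measurable Z.
    by rewrite -[X in measurable X]setTI; exact: mQ.
  have mle (e : R) : 0 < e -> (m Z <= (e * C)%:E)%E.
    move=> e0; have [ie eC] := QC e e0.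
    rewrite -[X in m X]setIT -integral_indic//.
    apply: (@le_trans _ _ (\int[m]_x (e * (Q x + e)^-1)%:E)%E).
      apply: ge0_le_integral => //.
      + exact/measurable_EFinP.
      + apply/measurable_EFinP; apply: measurable_funM => //.
        by apply: measurable_funV; exact: measurable_funD.
      + move=> x _; rewrite lee_fin indicE; have [|_] := boolP (x \in _).
          by rewrite inE/= => ->; rewrite add0r divff// gt_eqF.
        by rewrite mulr_ge0 ?invr_ge0 ?addr_ge0// ?ltW.
    under eq_integral do rewrite EFinM.
    rewrite integralZl// -[X in (_ * X)%E]fineK ?integrable_fin_num//.
    by rewrite -EFinM lee_fin ler_wpM2l// ltW.
  apply/eqP; rewrite eq_le measure_ge0 andbT.
  apply/lee_addgt0Pr => e e0; rewrite add0e.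
  apply: le_trans (mle (e / (1 + `|C|)) _) _.
    by rewrite divr_gt0// ltr_pwDl.
  rewrite lee_fin mulrAC ler_pdivrMr ?ltr_pwDl// ler_wpM2l ?ltW//.
  by rewrite (le_lt_trans (ler_norm _))// ltrDr.
- by move=> x /= nx; have := Q0 x; rewrite le_eqVlt => /predU1P[/esym|/nx].
Qed.

(** * Orthogonal projections built from Gram matrices *)

Section projections.
Context {R : realType} {n K : nat}.
Variable g : 'I_K -> 'cV[R[i]]_n.
Implicit Types (J : {set 'I_K}) (l k : 'I_K).
Local Notation C := R[i].

Definition maskmx J : 'M[C]_(n, K) := \matrix_(i, l) (if l \in J then g l i 0 else 0).
(** Ones on the diagonal outside [J]: added to the masked Gram matrix, they keep the size K for
    every [J] and make the sum invertible exactly when the vectors indexed by [J] are linearly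
    independent. *)
Definition offmx J : 'M[C]_K := diag_mx (\row_l (l \notin J)%:R).
Definition gram J : 'M[C]_K := (maskmx J)^H *m maskmx J + offmx J.
(** The adjugate formula makes the inverse a measurable function of the vectors, equal to 0 when the
    Gram matrix is singular. *)
Definition gram_inv J : 'M[C]_K := (\det (gram J))^-1 *: \adj (gram J).
(** The orthogonal projection onto the complement of the span of the [g l], [l] in [J], if these are
    independent, and the identity otherwise. *)
Definition proj J : 'M[C]_n := 1%:M - maskmx J *m gram_inv J *m (maskmx J)^H.

Lemma trC_D p q (A B : 'M[C]_(p, q)) : (A + B)^H = A^H + B^H.
Proof. by rewrite linearD map_mxD. Qed.

Lemma trC_B p q (A B : 'M[C]_(p, q)) : (A - B)^H = A^H - B^H.
Proof. by rewrite linearB map_mxB. Qed.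

Lemma trC_Z p q (a : C) (A : 'M[C]_(p, q)) : (a *: A)^H = Num.conj a *: A^H.
Proof. by rewrite linearZ/= map_mxZ. Qed.

Lemma trC_1 p : (1%:M : 'M[C]_p)^H = 1%:M.
Proof. by rewrite trmx1 map_mx1. Qed.

Lemma offmxH J : (offmx J)^H = offmx J.
Proof.
rewrite tr_diag_mx map_diag_mx; congr diag_mx.
by apply/matrixP => i l; rewrite !mxE rmorph_nat.
Qed.

Lemma gramH J : (gram J)^H = gram J.
Proof. by rewrite trC_D mulmxH conj_is_trmxCK offmxH. Qed.

Lemma gram_invH J : (gram_inv J)^H = gram_inv J.
Proof.
rewrite trC_Z; congr (_ *: _).
  rewrite fmorphV; congr (_^-1).
  by rewrite -[in RHS](gramH J) det_map_mx det_tr.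
by rewrite trmx_adj map_mx_adj gramH.
Qed.

Lemma projH J : (proj J)^H = proj J.
Proof. by rewrite trC_B trC_1 !mulmxH conj_is_trmxCK gram_invH mulmxA. Qed.

Lemma maskmx_off J : maskmx J *m offmx J = 0.
Proof.
rewrite mul_mx_diag; apply/matrixP => i l; rewrite !mxE.
by case: (l \in J); rewrite ?mulr0 ?mul0r.
Qed.

Lemma offmx_maskH J : offmx J *m (maskmx J)^H = 0.
Proof. by rewrite -offmxH -mulmxH maskmx_off trmx0 map_mx0. Qed.

Lemma offmx_off J : offmx J *m offmx J = offmx J.
Proof.
rewrite mul_mx_diag; apply/matrixP => i l; rewrite !mxE.
by case: eqP => [->|_]; case: (l \in J); rewrite /= ?mulr1n ?mulr0n ?mulr0 ?mul0r ?mulr1.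
Qed.

Lemma maskmx_col J l : l \in J -> maskmx J *m delta_mx l 0 = g l.
Proof.
move=> lJ; rewrite -colE; apply/matrixP => i j; rewrite !mxE lJ.
by rewrite (ord1 j).
Qed.

Lemma maskmxE J : maskmx J = \sum_(l in J) g l *m delta_mx 0 l.
Proof.
apply/matrixP => i k; rewrite summxE mxE.
under eq_bigr do rewrite mxE big_ord1 mxE/=.
case: ifPn => kJ.
  rewrite (bigD1 k)//= eqxx mulr1 big1 ?addr0// => l /andP[_ /negbTE lk].
  by rewrite eq_sym lk mulr0.
rewrite big1// => l lJ; case: eqP => [kl|]; last by rewrite mulr0.
by rewrite kl lJ in kJ.
Qed.

Lemma maskmx_mul J (y : 'cV[C]_K) : maskmx J *m y = \sum_(l in J) y l 0 *: g l.
Proof.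
apply/matrixP => i j; rewrite summxE mxE [RHS]big_mkcond/=.
apply: eq_bigr => l _; rewrite !mxE (ord1 j).
by case: (l \in J); rewrite ?mul0r// mulrC.
Qed.

Section invertible.
Variable J : {set 'I_K}.
Hypothesis dJ : \det (gram J) != 0.
Local Notation M := (maskmx J).
Local Notation X := (gram_inv J).
Local Notation D := (offmx J).

Lemma mul_gram_inv : gram J *m X = 1%:M.
Proof. by rewrite -scalemxAr mul_mx_adj scale_scalar_mx mulVf. Qed.

Lemma mul_inv_gram : X *m gram J = 1%:M.
Proof. by rewrite -scalemxAl mul_adj_mx scale_scalar_mx mulVf. Qed.

Lemma gram_off : gram J *m D = D.
Proof. by rewrite mulmxDl -mulmxA maskmx_off mulmx0 add0r offmx_off. Qed.

Lemma inv_off : X *m D = D.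
Proof. by rewrite -{1}gram_off mulmxA mul_inv_gram mul1mx. Qed.

Lemma inv_maskHmask : X *m M^H *m M = 1%:M - D.
Proof.
have -> : X *m M^H *m M = X *m (gram J - D) by rewrite addrK mulmxA.
by rewrite mulmxBr mul_inv_gram inv_off.
Qed.

Lemma proj_mask : proj J *m M = 0.
Proof.
rewrite mulmxBl mul1mx.
have -> : M *m X *m M^H *m M = M *m (X *m M^H *m M) by rewrite !mulmxA.
rewrite inv_maskHmask mulmxBr mulmx1.
by rewrite maskmx_off subr0 subrr.
Qed.

Lemma proj_vec l : l \in J -> proj J *m g l = 0.
Proof. by move=> lJ; rewrite -(maskmx_col lJ) mulmxA proj_mask mul0mx. Qed.

Lemma proj_trace : \tr (proj J) = n%:R - #|J|%:R.
Proof.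
rewrite linearB/= mxtrace1 -mulmxA mxtrace_mulC inv_maskHmask linearB/= mxtrace1.
congr (_ - _); rewrite mxtrace_diag.
have -> : K%:R = (#|J| + #|~: J|)%N%:R :> C by rewrite cardsC card_ord.
have -> : \sum_j (\row_l (l \notin J)%:R) 0 j = #|~: J|%:R :> C.
  rewrite -sum1_card natr_sum [RHS]big_mkcond/=; apply: eq_bigr => l _.
  by rewrite mxE inE; case: (l \in J).
by rewrite natrD addrK.
Qed.

End invertible.

(** Thanks to this default [proj J] is a Hermitian idempotent with [nrm2] between n - |J| and n
    without exception, so the moment bounds need no exceptional set. *)
Lemma proj_junk J : \det (gram J) = 0 -> proj J = 1%:M.
Proof. by move=> dJ; rewrite /proj /gram_inv dJ invr0 scale0r mulmx0 mul0mx subr0. Qed.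

Lemma proj_idem J : proj J *m proj J = proj J.
Proof.
have [/proj_junk ->|dJ] := eqVneq (\det (gram J)) 0; first by rewrite mulmx1.
by rewrite {2}/proj mulmxBr mulmx1 !mulmxA proj_mask// !mul0mx subr0.
Qed.

Lemma nrm2_proj_tr J : (nrm2 (proj J))%:C = \tr (proj J).
Proof. by rewrite nrm2_trace projH proj_idem. Qed.

(** For a Hermitian idempotent [nrm2] is the trace, that is, the rank. *)
Lemma nrm2_proj J : \det (gram J) != 0 -> nrm2 (proj J) = n%:R - #|J|%:R.
Proof.
move=> dJ; apply: (@complexI R); rewrite nrm2_proj_tr proj_trace//.
by rewrite rmorphB !rmorph_nat.
Qed.

Lemma nrm2_proj_ge J : n%:R - #|J|%:R <= nrm2 (proj J).
Proof.
have [dJ|dJ] := eqVneq (\det (gram J)) 0; last by rewrite nrm2_proj.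
have -> : nrm2 (proj J) = n%:R.
  by apply: (@complexI R); rewrite nrm2_proj_tr proj_junk// mxtrace1 rmorph_nat.
by rewrite gerBl.
Qed.

Lemma nrm2_proj_le J : nrm2 (proj J) <= n%:R.
Proof.
have [dJ|dJ] := eqVneq (\det (gram J)) 0.
  have -> // : nrm2 (proj J) = n%:R.
  by apply: (@complexI R); rewrite nrm2_proj_tr proj_junk// mxtrace1 rmorph_nat.
by rewrite nrm2_proj// gerBl.
Qed.

Lemma proj_range J : 1%:M - proj J = maskmx J *m (gram_inv J *m (maskmx J)^H).
Proof. by rewrite /proj opprB addrC subrK mulmxA. Qed.

Lemma nrm2_proj_vec J (x : 'cV[C]_n) : (nrm2 (proj J *m x))%:C = (x^H *m proj J *m x) 0 0.
Proof. by rewrite nrm2_colE mulmxH projH !mulmxA -(mulmxA x^H) proj_idem. Qed.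

(** The Hermitian form of [gram J] at [v] is the squared norm of [maskmx J *m v] plus the squared
    entries of [v] outside [J]; both terms are nonnegative. *)
Lemma gram_kernel J (v : 'cV[C]_K) :
  gram J *m v = 0 <-> maskmx J *m v = 0 /\ (forall l, l \notin J -> v l 0 = 0).
Proof.
have off_v l : (offmx J *m v) l 0 = (l \notin J)%:R * v l 0.
  by rewrite mul_diag_mx mxE mxE.
split=> [Gv|[Mv v0]].
  have : (v^H *m gram J *m v) 0 0 = 0 by rewrite -mulmxA Gv mulmx0 mxE.
  rewrite mulmxDr mulmxDl mxE mulmxA -mulmxH -mulmxA -nrm2_colE.
  have -> : (v^H *m offmx J *m v) 0 0 = (\sum_(l | l \notin J) sqmod (v l 0))%:C.
    rewrite -mulmxA mxE rmorph_sum/= [RHS]big_mkcond/=; apply: eq_bigr => l _.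
    rewrite off_v !mxE.
    by case: (l \in J); rewrite /= ?mul0r ?mulr0// mul1r sqmodC mulrC.
  rewrite -rmorphD => /complexI/eqP; rewrite paddr_eq0 ?nrm2_ge0//; last first.
    by apply: sumr_ge0 => l _; exact: sqmod_ge0.
  move=> /andP[/eqP Mv /eqP sv]; split; first exact: nrm2_eq0.
  move=> l lJ; apply/eqP; rewrite -sqmod_eq0.
  by have -> := psumr_eq0P (fun l _ => sqmod_ge0 (v l 0)) sv.
rewrite mulmxDl -mulmxA Mv mulmx0 add0r; apply/matrixP => l j.
by rewrite (ord1 j) off_v mxE; case: (boolP (l \in J)) => /= lJ; rewrite ?mul0r// mul1r v0.
Qed.

Lemma det_gramP J : \det (gram J) != 0 <->
  forall v : 'cV[C]_K, maskmx J *m v = 0 -> (forall l, l \notin J -> v l 0 = 0) -> v = 0.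
Proof.
split=> [dJ v Mv v0|h].
  have Gv : gram J *m v = 0 by apply/gram_kernel.
  by rewrite -[v]mul1mx -(mul_inv_gram dJ) -mulmxA Gv mulmx0.
apply/negP => /det0P[r r0 rG]; move/eqP: r0; apply.
have Gv : gram J *m r^H = 0 by rewrite -gramH -mulmxH rG trmx0 map_mx0.
have [Mv v0] := (gram_kernel J _).1 Gv.
by rewrite -[r]conj_is_trmxCK (h _ Mv v0) trmx0 map_mx0.
Qed.

Lemma det_gram0 : \det (gram finset.set0) != 0.
Proof. by apply/det_gramP => v _ v0; apply/matrixP => l j; rewrite (ord1 j) mxE v0 ?inE. Qed.

Lemma det_gram_sub J J' : J' \subset J -> \det (gram J) != 0 -> \det (gram J') != 0.
Proof.
move=> JJ /det_gramP h; apply/det_gramP => v Mv v0; apply: h.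
  rewrite maskmx_mul (big_setID J')/= (finset.setIidPr JJ) [X in _ + X]big1 ?addr0; last first.
    by move=> l /finset.setDP[_ lJ]; rewrite v0// scale0r.
  by rewrite -maskmx_mul.
by move=> l lJ; rewrite v0//; apply: contra lJ; exact: (fintype.subsetP JJ).
Qed.

(** Applying [proj J] to a linear relation leaves only its [g l] term, so that coefficient vanishes
    and independence over [J] finishes. *)
Lemma det_gram_add J l : l \notin J -> \det (gram J) != 0 ->
  nrm2 (proj J *m g l) != 0 -> \det (gram (l |: J)) != 0.
Proof.
move=> lJ dJ pl; apply/det_gramP => v Mv v0.
move: Mv; rewrite maskmx_mul big_setU1//= => Mv.
have vl : v l 0 = 0.
  have := congr1 (mulmx (proj J)) Mv; rewrite mulmx0 mulmxDr mulmx_sumr big1.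
    rewrite addr0 -scalemxAr => /eqP; rewrite scaler_eq0 => /orP[/eqP//|/eqP pl0].
    by move: pl; rewrite pl0 nrm20 eqxx.
  by move=> k kJ; rewrite -scalemxAr proj_vec// scaler0.
move/det_gramP: dJ; apply; first by rewrite maskmx_mul; move: Mv; rewrite vl scale0r add0r.
move=> k kJ; have [->//|kl] := eqVneq k l.
by apply: v0; rewrite !inE negb_or kl.
Qed.

Lemma proj_mul_sub J J' : J' \subset J -> \det (gram J) != 0 -> proj J *m proj J' = proj J.
Proof.
move=> JJ dJ.
have PM : proj J *m maskmx J' = 0.
  rewrite maskmxE mulmx_sumr big1// => l lJ'.
  by rewrite mulmxA proj_vec ?mul0mx//; exact: (fintype.subsetP JJ).
have -> : proj J' = 1%:M - (1%:M - proj J') by rewrite opprB addrC subrK.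
by rewrite mulmxBr mulmx1 proj_range [_ *m (maskmx _ *m _)]mulmxA PM mul0mx subr0.
Qed.

Lemma proj_mul_subl J J' : J' \subset J -> \det (gram J) != 0 -> proj J' *m proj J = proj J.
Proof. by move=> JJ dJ; rewrite -[LHS]conj_is_trmxCK mulmxH !projH proj_mul_sub// projH. Qed.

End projections.

Section projection_transport.
Context {R : realType} {n K : nat}.
Implicit Types (J : {set 'I_K}).

Lemma maskmx_ext (g g' : 'I_K -> 'cV[R[i]]_n) J :
  (forall l, l \in J -> g l = g' l) -> maskmx g J = maskmx g' J.
Proof. by move=> gg; apply/matrixP => i l; rewrite !mxE; case: ifP => // /gg ->. Qed.

Lemma proj_ext (g g' : 'I_K -> 'cV[R[i]]_n) J :
  (forall l, l \in J -> g l = g' l) -> proj g J = proj g' J.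
Proof. by move=> gg; rewrite /proj /gram_inv /gram (maskmx_ext gg). Qed.

Context d (T : measurableType d) (g : T -> 'I_K -> 'cV[R[i]]_n).
Hypothesis mg : forall l, mxmeas (fun x => g x l).

Lemma mxmeas_maskmx J : mxmeas (fun x => maskmx (g x) J).
Proof.
move=> i l; under [X in cmeas X]eq_fun do rewrite mxE.
by case: (l \in J); [exact: mg|exact: cmeas_cst].
Qed.

Lemma mxmeas_gram J : mxmeas (fun x => gram (g x) J).
Proof.
apply: mxmeasD; last exact: mxmeas_cst.
by apply: mxmeasM; [apply/mxmeasJ/mxmeasT|]; exact: mxmeas_maskmx.
Qed.

Lemma cmeas_det_gram J : cmeas (fun x => \det (gram (g x) J)).
Proof. exact/cmeas_det/mxmeas_gram. Qed.

Lemma mxmeas_proj J : mxmeas (fun x => proj (g x) J).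
Proof.
apply: mxmeasD; first exact: mxmeas_cst.
apply: mxmeasN; apply: mxmeasM; last exact/mxmeasJ/mxmeasT/mxmeas_maskmx.
apply: mxmeasM; first exact: mxmeas_maskmx.
apply: mxmeasZ; first exact/cmeasV/cmeas_det_gram.
exact/mxmeas_adj/mxmeas_gram.
Qed.

End projection_transport.

(** * The Hermitian product and the geometry of zero-forcing beams *)

Section hermitian_product.
Context {R : realType} {n : nat}.
Local Notation C := R[i].
Implicit Types (u w : 'cV[C]_n) (a : C).

Definition dot u w : C := (u^H *m w) 0 0.

Lemma dotDr u w1 w2 : dot u (w1 + w2) = dot u w1 + dot u w2.
Proof. by rewrite /dot mulmxDr mxE. Qed.

Lemma dotNr u w : dot u (- w) = - dot u w.
Proof. by rewrite /dot mulmxN mxE. Qed.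

Lemma dotBr u w1 w2 : dot u (w1 - w2) = dot u w1 - dot u w2.
Proof. by rewrite dotDr dotNr. Qed.

Lemma dotZr u a w : dot u (a *: w) = a * dot u w.
Proof. by rewrite /dot -scalemxAr mxE. Qed.

Lemma dot_sumr u (J : Type) (s : seq J) (Q : pred J) (F : J -> 'cV[C]_n) :
  dot u (\sum_(j <- s | Q j) F j) = \sum_(j <- s | Q j) dot u (F j).
Proof. by rewrite /dot mulmx_sumr summxE. Qed.

Lemma dotC u w : dot w u = Num.conj (dot u w).
Proof.
rewrite /dot !mxE rmorph_sum; apply: eq_bigr => i _.
by rewrite !mxE [RHS]rmorphM /= conjCK mulrC.
Qed.

Lemma dot0_sym u w : dot u w = 0 -> dot w u = 0.
Proof. by move=> uw; rewrite dotC uw rmorph0. Qed.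

Lemma dotBl u1 u2 w : dot (u1 - u2) w = dot u1 w - dot u2 w.
Proof. by rewrite dotC dotBr rmorphB /= -!dotC. Qed.

Lemma dotDl u1 u2 w : dot (u1 + u2) w = dot u1 w + dot u2 w.
Proof. by rewrite dotC dotDr rmorphD /= -!dotC. Qed.

Lemma dotZl a u w : dot (a *: u) w = Num.conj a * dot u w.
Proof. by rewrite dotC dotZr rmorphM /= -dotC. Qed.

Lemma dot0r u : dot u 0 = 0. Proof. by rewrite /dot mulmx0 mxE. Qed.

Lemma dot0l u : dot 0 u = 0. Proof. by rewrite dotC dot0r rmorph0. Qed.

Lemma dot_nrm2 u : dot u u = (nrm2 u)%:C.
Proof. by rewrite nrm2_colE. Qed.

Lemma dot_mull (A : 'M[C]_n) u w : dot (A *m u) w = dot u (A^H *m w).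
Proof. by rewrite /dot mulmxH mulmxA. Qed.

Lemma sqmod_dotC u w : sqmod (dot u w) = sqmod (dot w u).
Proof. by rewrite dotC sqmodJ. Qed.

Lemma nrm2_orth_comb (b : R) (y : C) u w : dot u w = 0 -> nrm2 u = 1 ->
  nrm2 (b%:C *: u + y *: w) = b ^+ 2 + sqmod y * nrm2 w.
Proof.
move=> uw u1; apply: (@complexI R); rewrite -dot_nrm2.
rewrite !(dotDr, dotDl, dotZr, dotZl) uw (dot0_sym uw) !dot_nrm2 u1.
by rewrite rmorphD (rmorphM _ (sqmod y)) rmorphXn /= sqmodC conjCR; ring.
Qed.

Lemma bessel2 u w1 w2 : nrm2 w1 = 1 -> 0 < nrm2 w2 -> dot w1 w2 = 0 ->
  sqmod (dot w1 u) + sqmod (dot w2 u) / nrm2 w2 <= nrm2 u.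
Proof.
move=> w1u w20 w12; set a := dot w1 u; pose b := dot w2 u / (nrm2 w2)%:C.
have w2C : (nrm2 w2)%:C != 0 :> C by rewrite (inj_eq (@complexI R) _ 0) gt_eqF.
pose D := u - a *: w1 - b *: w2.
have D1 : dot D w1 = 0.
  by apply: dot0_sym; rewrite !dotBr !dotZr dot_nrm2 w1u mulr1 subrr w12 mulr0 subr0.
have D2 : dot D w2 = 0.
  apply: dot0_sym; rewrite !dotBr !dotZr (dot0_sym w12) mulr0 subr0 dot_nrm2.
  by rewrite divfK// subrr.
have : (nrm2 D)%:C = (nrm2 u - (sqmod a + sqmod (dot w2 u) / nrm2 w2))%:C.
  rewrite -dot_nrm2 {2}/D !dotBr !dotZr D1 D2 !mulr0 !subr0 /D !dotBl !dotZl.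
  rewrite dot_nrm2 -/a !rmorphB rmorphD rmorphM fmorphV /= !sqmodC opprD addrA.
  rewrite [Num.conj a * a]mulrC; congr (_ - _).
  by rewrite /b rmorphM fmorphV /= conjCR sqmodC; ring.
move=> /complexI nD; rewrite -subr_ge0 -nD; exact: nrm2_ge0.
Qed.

End hermitian_product.

(** The algebra closing [beam_correlation]: [s] is the squared correlation, the equation expresses
    orthogonality, and the last hypothesis is Bessel's inequality. *)
Lemma correlation_arith {R : realFieldType} (s x y b2 N : R) :
  0 <= y -> 0 < N -> b2 * s = y * x -> s + x / N <= 1 ->
  s * ((b2 + y * N) * N) <= y * N ^+ 2.
Proof.
move=> y0 N0 rel; rewrite -lerBrDl ler_pdivrMr// => xle.
have -> : s * ((b2 + y * N) * N) = (b2 * s + s * y * N) * N by ring.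
rewrite rel expr2 mulrA ler_wpM2r ?(ltW N0)//.
have -> : y * x + s * y * N = y * (x + s * N) by ring.
by rewrite ler_wpM2l//; lra.
Qed.

Lemma sqmod_balance {R : realType} (b : R) (y s x : R[i]) :
  b%:C * s + y * x = 0 -> b ^+ 2 * sqmod s = sqmod y * sqmod x.
Proof.
move=> /eqP; rewrite addr_eq0 => /eqP e.
by rewrite -sqmodR -sqmodM e sqmodN sqmodM.
Qed.

Lemma hermitian_sub {R : realType} {n : nat} (A B : 'M[R[i]]_n) :
  A^H = A -> B^H = B -> (A - B)^H = A - B.
Proof. by move=> AA BB; rewrite trC_B AA BB. Qed.

Lemma idem_sub {C : pzRingType} {n : nat} (A B : 'M[C]_n) :
  A *m A = A -> B *m B = B -> A *m B = B -> B *m A = B ->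
  (A - B) *m (A - B) = A - B.
Proof. by move=> AA BB AB BA; rewrite mulmxBr !mulmxBl AA BB AB BA subrr subr0. Qed.

Opaque proj dot.

Section beamformers.
Context {R : realType} {n K : nat}.
Local Notation C := R[i].
Variable g : 'I_K -> 'cV[C]_n.
Implicit Types (J : {set 'I_K}) (j k l : 'I_K).
Local Notation "~: A" := (finset.setC A).
Local Notation setT := (finset.setTfor 'I_K).
Local Notation proj := (proj g).

Definition beamdir l : 'cV[C]_n := proj (~: [set l]%SET) *m g l.
Definition beam l : 'cV[C]_n := ((Num.sqrt (nrm2 (beamdir l)))^-1)%:C *: beamdir l.

(** The event carrying all almost sure statements about the beams: on it every subfamily is linearly
    independent ([generic_det]). *)
Definition generic := forall J l, l \notin J -> 0 < nrm2 (proj J *m g l).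

Lemma nrm2_beam_le1 l : nrm2 (beam l) <= 1.
Proof.
rewrite nrm2Z sqmodR exprVn sqr_sqrtr ?nrm2_ge0//.
by have [->|b0] := eqVneq (nrm2 (beamdir l)) 0; rewrite ?mulr0// mulVf.
Qed.

(** For independent vectors, the projection onto the part of their span orthogonal to [g k], of
    dimension K - 1; the beams of the other users span this space. *)
Definition leakproj k : 'M[C]_n := proj [set k]%SET - proj setT.

Lemma leakprojH k : (leakproj k)^H = leakproj k.
Proof. by apply: hermitian_sub; exact: projH. Qed.

Lemma leakproj_idem k : \det (gram g setT) != 0 ->
  leakproj k *m leakproj k = leakproj k.
Proof.
move=> dT; have k_T : [set k]%SET \subset setT by exact: finset.subsetT.
apply: idem_sub; [exact: proj_idem|exact: proj_idem| |].
  exact: proj_mul_subl.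
exact: proj_mul_sub.
Qed.

Lemma nrm2_leakproj k : \det (gram g setT) != 0 -> nrm2 (leakproj k) = K%:R - 1.
Proof.
move=> dT; have dk := det_gram_sub (finset.subsetT [set k]%SET) dT.
apply: (@complexI R); rewrite nrm2_trace leakprojH leakproj_idem// linearB/=.
rewrite !proj_trace// finset.cards1 finset.cardsT card_ord !rmorphB !rmorph_nat.
ring.
Qed.

Hypothesis gen : generic.

Lemma generic_det J : \det (gram g J) != 0.
Proof.
move: {2}#|J| (erefl #|J|) => c; elim: c J => [|c IH] J Jc.
  by have /finset.cards0_eq -> : #|J| = 0 by []; exact: det_gram0.
have [l lJ] : exists l, l \in J by apply/card_gt0P; rewrite Jc.
rewrite -(finset.setD1K lJ); apply: det_gram_add.
- by rewrite finset.setD11.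
- by apply: IH; move: Jc; rewrite (finset.cardsD1 l) lJ => -[].
- by rewrite gt_eqF// gen// finset.setD11.
Qed.

Let dets J := generic_det J.

Lemma beamdir_gt0 l : 0 < nrm2 (beamdir l).
Proof. by apply: gen; rewrite !inE eqxx. Qed.

Lemma nrm2_beam l : nrm2 (beam l) = 1.
Proof.
by rewrite nrm2Z sqmodR exprVn sqr_sqrtr ?nrm2_ge0// mulVf// gt_eqF ?beamdir_gt0.
Qed.

Lemma beamdirE l : beamdir l = (Num.sqrt (nrm2 (beamdir l)))%:C *: beam l.
Proof.
rewrite scalerA -rmorphM mulfV ?scale1r// gt_eqF// sqrtr_gt0.
exact: beamdir_gt0.
Qed.

Lemma dot_projl J (u w : 'cV[C]_n) : dot (proj J *m u) w = dot u (proj J *m w).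
Proof. by rewrite dot_mull projH. Qed.

Lemma dot_beam_neq j l : j != l -> dot (g j) (beam l) = 0.
Proof.
move=> jl; have p0 : proj (~: [set l]%SET) *m g j = 0.
  by apply: proj_vec => //; rewrite !inE.
by rewrite dotZr /beamdir -dot_projl p0 dot0l mulr0.
Qed.

Lemma dot_beam l : dot (g l) (beam l) = (Num.sqrt (nrm2 (beamdir l)))%:C.
Proof.
have b0 := beamdir_gt0 l.
rewrite dotZr {2}/beamdir -[proj _]proj_idem -mulmxA -dot_projl -/(beamdir l).
rewrite dot_nrm2 -rmorphM; congr (_%:C).
rewrite -[X in _ * X](sqr_sqrtr (ltW b0)) expr2 mulrA mulVf ?mul1r//.
by rewrite gt_eqF// sqrtr_gt0.
Qed.

(** Up to scaling the beams are the dual basis of [g]. The difference of the two sides lies in the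
    span of the [g l] and is orthogonal to all of them, hence is 0. *)
Lemma leakproj_decomposition k (u : 'cV[C]_n) :
  leakproj k *m u = \sum_(l | l != k)
    (dot (g l) (leakproj k *m u) / (Num.sqrt (nrm2 (beamdir l)))%:C) *: beam l.
Proof.
set V := leakproj k *m u; set S := \sum_(l | _) _; pose D := V - S.
have bC l : (Num.sqrt (nrm2 (beamdir l)))%:C != 0 :> C.
  by rewrite (inj_eq (@complexI R) _ 0) gt_eqF// sqrtr_gt0 beamdir_gt0.
have gD j : dot (g j) D = 0.
  rewrite dotBr dot_sumr; have [->|jk] := eqVneq j k.
    rewrite big1 ?subr0; last by move=> l lk; rewrite dotZr dot_beam_neq ?mulr0// eq_sym.
    by rewrite /V -[leakproj k]leakprojH -dot_mull mulmxBl !proj_vec ?inE// subrr dot0l.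
  rewrite (bigD1 j)//= big1 ?addr0.
    by rewrite dotZr dot_beam divfK// subrr.
  by move=> l /andP[_ lj]; rewrite dotZr dot_beam_neq ?mulr0// eq_sym.
have pD : proj setT *m D = 0.
  rewrite mulmxBr /V mulmxA mulmxBr proj_idem proj_mul_sub ?finset.subsetT// subrr mul0mx.
  rewrite mulmx_sumr big1 ?subr0// => l _; rewrite -!scalemxAr mulmxA.
  by rewrite proj_mul_sub ?finset.subsetT// proj_vec ?inE// !scaler0.
have DE : D = maskmx g setT *m (gram_inv g setT *m (maskmx g setT)^H *m D).
  by rewrite mulmxA -proj_range mulmxBl mul1mx pD subr0.
apply/eqP; rewrite -subr_eq0; apply/eqP/nrm2_eq0; apply: (@complexI R).
rewrite -/D -dot_nrm2 {2}DE maskmx_mul dot_sumr big1// => l _.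
by rewrite dotZr (dot0_sym (gD l)) mulr0.
Qed.

(* Cauchy-Schwarz along the decomposition of the projection of [u] on the span of
   the beams [l != k]: it bounds the leakage from below by quantities whose
   inverse moments are accessible. *)
Lemma leakage_lower_bound k (u : 'cV[C]_n) :
  nrm2 (leakproj k *m u) ^+ 2 <=
  (\sum_(l | l != k) sqmod (dot u (beam l))) *
  \sum_(l | l != k) sqmod (dot u (leakproj k *m g l)) / nrm2 (beamdir l).
Proof.
set V := leakproj k *m u.
have VV : (nrm2 V)%:C = dot u V.
  by rewrite -dot_nrm2 /V dot_mull leakprojH mulmxA (leakproj_idem k (dets _)).
have := leakproj_decomposition k u; rewrite -/V => Vd.
rewrite -sqmodR VV [in X in X <= _]Vd dot_sumr.
under eq_bigr do rewrite dotZr.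
rewrite big_mkcond /= (_ : \sum_l _ = \sum_l
  (if l != k then dot u (beam l) else 0) *
  (if l != k then dot (g l) V / (Num.sqrt (nrm2 (beamdir l)))%:C else 0)); last first.
  by apply: eq_bigr => l _; case: ifP => _; rewrite ?mul0r// mulrC.
apply: le_trans (sqmod_sum_cauchy_schwarz _ _) _.
rewrite [X in X * _](_ : _ = \sum_(l | l != k) sqmod (dot u (beam l))); last first.
  by rewrite [RHS]big_mkcond; apply: eq_bigr => l _; case: ifP; rewrite ?sqmod0.
rewrite ler_wpM2l//; first by apply: sumr_ge0 => l _; exact: sqmod_ge0.
rewrite [leRHS]big_mkcond; apply: ler_sum => l _; case: ifP => _; rewrite ?sqmod0//.
rewrite sqmodM -fmorphV /= sqmodR exprVn sqr_sqrtr ?nrm2_ge0//.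
by rewrite /V -[leakproj k]leakprojH -dot_mull leakprojH sqmod_dotC.
Qed.

Definition pairproj l k : 'M[C]_n := proj (~: [set l; k]%SET).

(** Once all users other than [l] and [k] are projected out, everything happens in a plane: each
    beam is orthogonal to the projected vector of the other user, so the beams form the same angle,
    up to its supplement, as the projected vectors. *)
Lemma beam_correlation l k : l != k ->
  sqmod (dot (beam l) (beam k)) *
    (nrm2 (pairproj l k *m g l) * nrm2 (pairproj l k *m g k)) <=
  sqmod (dot (g l) (pairproj l k *m g k)).
Proof.
rewrite /pairproj; set J := ~: _ => lk; set pl := proj J *m g l; set pk := proj J *m g k.
have kJ : k \notin J by rewrite !inE eqxx orbT.
have lJ : l \notin J by rewrite !inE eqxx.
have pk0 : 0 < nrm2 pk by exact: gen.
have JE : ~: [set l]%SET = (k |: J)%SET.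
  apply/finset.setP => j; rewrite !inE negb_or; have [->|jk] := eqVneq j k.
    by rewrite eq_sym lk.
  by rewrite andbT.
have JJl : J \subset ~: [set l]%SET by rewrite JE finset.subsetUr.
have JJk : J \subset ~: [set k]%SET.
  by apply/fintype.subsetP => j; rewrite !inE negb_or => /andP[].
(* [g l] minus [beamdir l] is a combination of the other vectors, and [proj J] retains only the one
   along [g k]. *)
have [y plE] : exists y, pl = beamdir l + y *: pk.
  exists ((gram_inv g (~: [set l]%SET) *m (maskmx g (~: [set l]%SET))^H *m g l) k 0).
  have : pl - beamdir l = proj J *m ((1%:M - proj (~: [set l]%SET)) *m g l).
    by rewrite mulmxA mulmxBr mulmx1 proj_mul_subl// mulmxBl.
  rewrite proj_range -!mulmxA maskmx_mul {1}JE big_setU1//= mulmxDr mulmx_sumr big1.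
    by rewrite addr0 -scalemxAr => /eqP; rewrite subr_eq addrC => /eqP.
  by move=> j jJ; rewrite -scalemxAr proj_vec// scaler0.
pose b := Num.sqrt (nrm2 (beamdir l)).
rewrite beamdirE -/b in plE.
have projbeam j : J \subset ~: [set j]%SET -> proj J *m beam j = beam j.
  by move=> JJ; rewrite -scalemxAr mulmxA proj_mul_subl.
have dot_pl : dot (beam k) pl = 0.
  by rewrite -dot_projl projbeam// (dot0_sym (dot_beam_neq lk)).
have dot_pk : dot (beam l) pk = 0.
  by rewrite -dot_projl projbeam// dot0_sym// dot_beam_neq// eq_sym.
have npl : nrm2 pl = b ^+ 2 + sqmod y * nrm2 pk.
  by rewrite plE nrm2_orth_comb ?nrm2_beam.
have gpk : sqmod (dot (g l) pk) = sqmod y * nrm2 pk ^+ 2.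
  have -> : dot (g l) pk = dot pl pk by rewrite /pl dot_projl /pk mulmxA proj_idem.
  rewrite plE dotDl (dotZl b%:C) (dotZl y).
  by rewrite dot_pk mulr0 add0r dot_nrm2 sqmodM sqmodJ sqmodR.
(* Bessel's inequality for the unit vector [beam k] against the orthogonal pair [beam l], [pk]. *)
have bes := bessel2 (beam k) (nrm2_beam l) pk0 dot_pk.
rewrite nrm2_beam in bes.
have rel : b ^+ 2 * sqmod (dot (beam l) (beam k)) = sqmod y * sqmod (dot pk (beam k)).
  have h : b ^+ 2 * sqmod (dot (beam k) (beam l)) = sqmod y * sqmod (dot (beam k) pk).
    apply: sqmod_balance.
    by rewrite -dot_pl plE dotDr (dotZr _ b%:C) (dotZr _ y).
  exact: (etrans (congr1 ( *%R (b ^+ 2)) (sqmod_dotC (beam l) (beam k)))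
    (etrans h (congr1 ( *%R (sqmod y)) (sqmod_dotC (beam k) pk)))).
rewrite gpk npl; exact: correlation_arith (sqmod_ge0 y) pk0 rel bes.
Qed.

End beamformers.

Transparent proj dot.

Local Notation conjmx := (map_mx Num.conj).

(** * Moments of projected Gaussian vectors and of linear forms *)

Section gaussian_projections.
Context {U : finType} {n : nat} {R : realType}.
Local Notation I := (U * ('I_n * 'I_1 * bool))%type.
Variables (v : U -> R) (m : probability (prodR I R) R).
Hypotheses (v0 : forall u, 0 <= v u) (mv : gauss_product (fun c => v c.1 / 2) m).
Variable u : U.
Implicit Types x : I -> R.

Section projection.
Variables (P : (I -> R) -> 'M[R[i]]_n) (B : R).
Hypotheses (mP : mxmeas (P : prodR I R -> _)) (PH : forall x, (P x)^H = P x)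
  (PP : forall x, P x *m P x = P x) (PB : forall x, nrm2 (P x) <= B)
  (iP : forall x j t, P (upd x (u, j) t) = P x).

Let w r x : 'cV[R[i]]_n := col r (P x).

Let mw r : mxmeas (w r : prodR I R -> _).
Proof. by move=> i j; under [X in cmeas X]eq_fun do rewrite mxE; exact: mP. Qed.

Let cweightE x : cweight w x = nrm2 (P x).
Proof.
rewrite /cweight /nrm2 exchange_big/=; apply: eq_bigr => r _.
by apply: eq_bigr => i _; rewrite big_ord1 mxE.
Qed.

Let wB r x : nrm2 (w r x) <= B.
Proof.
apply: le_trans (PB x); rewrite -cweightE /cweight (bigD1 r)//= lerDl.
by apply: sumr_ge0 => s _; exact: nrm2_ge0.
Qed.

Let iw r x j t : w r (upd x (u, j) t) = w r x. Proof. by rewrite /w iP. Qed.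

Let cformE r x : cform u w r x = ((cvec x u)^T *m P x) 0 r.
Proof. by rewrite /cform !mxE; apply: eq_bigr => i _; rewrite [col _ _ _ _]mxE. Qed.

Let projnormE x : nrm2 (P x *m conjmx (cvec x u)) = cquad u w x.
Proof.
rewrite -nrm2H mulmxH PH; have -> : (conjmx (cvec x u))^H = (cvec x u)^T.
  by apply/matrixP => i j; rewrite !mxE conjCK.
by rewrite nrm2_row; apply: eq_bigr => r _; rewrite cformE.
Qed.

(** For a projection, half the gradient of the squared norm is the projected vector itself up to
    conjugation. This closes the recursions for moments and inverse moments. *)
Let cgradE x : cgrad u w x = cquad u w x.
Proof.
apply: eq_bigr => i _; rewrite cformE -[in RHS]PP mulmxA [in RHS]mxE; congr sqmod.
apply: eq_bigr => r _; rewrite cformE mulrC; congr (_ * _).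
by rewrite -[in RHS]PH !mxE.
Qed.

Lemma polyg_projnorm : polyg (fun x => nrm2 (P x *m conjmx (cvec x u))).
Proof.
have -> : (fun x => nrm2 (P x *m conjmx (cvec x u))) = cquad u w by apply/funext.
exact: polyg_cquad mw wB.
Qed.

Lemma projnorm_mean :
  \int[m]_x nrm2 (P x *m conjmx (cvec x u)) = v u * \int[m]_x nrm2 (P x).
Proof.
under eq_Rintegral do rewrite projnormE.
rewrite (cquad_mean v0 mv mw wB iw); congr (_ * _).
by apply: eq_Rintegral => x _; rewrite cweightE.
Qed.

Lemma projnorm_moment_le k : 0 <= B ->
  \int[m]_x nrm2 (P x *m conjmx (cvec x u)) ^+ k <= (v u * (B + k%:R)) ^+ k.
Proof.
move=> B0; under eq_Rintegral do rewrite projnormE.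
apply: (cquad_moment_le v0 mv mw wB iw) => // x; first by rewrite cgradE.
by rewrite cweightE.
Qed.

Lemma projnorm_sqr :
  \int[m]_x nrm2 (P x *m conjmx (cvec x u)) ^+ 2 =
  v u * (\int[m]_x (nrm2 (P x) * nrm2 (P x *m conjmx (cvec x u))) +
         \int[m]_x nrm2 (P x *m conjmx (cvec x u))).
Proof.
under eq_Rintegral do rewrite projnormE.
rewrite (cquad_stein_pow v0 mv mw wB iw 1) mul1r; congr (_ * (_ + _)).
  by apply: eq_Rintegral => x _; rewrite cweightE projnormE expr1.
by apply: eq_Rintegral => x _; rewrite expr0 mulr1 cgradE projnormE.
Qed.

Section inverse.
Variable N : nat.
Hypotheses (vu0 : 0 < v u) (PN : forall x, N%:R <= nrm2 (P x)).

Let inv_eps k (e : R) : (2 * k <= N)%N -> 0 < e ->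
  m.-integrable setT (EFin \o (fun x => (nrm2 (P x *m conjmx (cvec x u)) + e)^-1 ^+ k)) /\
  \int[m]_x (nrm2 (P x *m conjmx (cvec x u)) + e)^-1 ^+ k <= (2 / (v u * N%:R)) ^+ k.
Proof.
move=> kN e0.
have -> : (fun x : prodR I R => (nrm2 (P x *m conjmx (cvec x u)) + e)^-1 ^+ k) =
          (fun x => (cquad u w x + e)^-1 ^+ k).
  by apply/funext => x; rewrite projnormE.
split.
  apply: (polyg_integrable_gauss v0 mv); exact: (polyg_cquad_inv u mw wB k e0).
apply: (inv_moment_eps_le v0 mv mw wB iw) => // x; first by rewrite cgradE.
by rewrite cweightE.
Qed.

Lemma projnorm_inv_moment k : (0 < k)%N -> (2 * k <= N)%N ->
  m.-integrable setT (EFin \o (fun x => (nrm2 (P x *m conjmx (cvec x u)))^-1 ^+ k)) /\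
  \int[m]_x (nrm2 (P x *m conjmx (cvec x u)))^-1 ^+ k <= (2 / (v u * N%:R)) ^+ k.
Proof.
move=> k0 kN; apply: inv_moment_limit => //.
- exact: polyg_projnorm.1.
- by move=> x; exact: nrm2_ge0.
- by move=> e e0; exact: inv_eps.
Qed.

Lemma projnorm_gt0_ae : (2 <= N)%N -> {ae m, forall x, 0 < nrm2 (P x *m conjmx (cvec x u))}.
Proof.
move=> N2; apply: (@ae_gt0_of_inv_moment _ _ _ _ _ (2 / (v u * N%:R))).
- exact: polyg_projnorm.1.
- by move=> x; exact: nrm2_ge0.
- by move=> e e0; have := @inv_eps 1 e N2 e0; rewrite expr1.
Qed.

End inverse.
End projection.

Section linear_form.
Variables (w : (I -> R) -> 'cV[R[i]]_n).
Hypotheses (mw : mxmeas (w : prodR I R -> _)) (w1 : forall x, nrm2 (w x) <= 1)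
  (iw : forall x j t, w (upd x (u, j) t) = w x).

Let w' (_ : 'I_1) x := w x.

Let cquadE x : cquad u w' x = sqmod (((cvec x u)^T *m w x) 0 0).
Proof. by rewrite /cquad big_ord1. Qed.

Let cweightE x : cweight w' x = nrm2 (w x).
Proof. by rewrite /cweight big_ord1. Qed.

Let cgradE x : cgrad u w' x = nrm2 (w x) * cquad u w' x.
Proof.
rewrite cquadE nrm2_col mulr_suml; apply: eq_bigr => i _.
by rewrite big_ord1 sqmodM sqmodJ.
Qed.

Let mw' a : mxmeas (w' a : prodR I R -> _). Proof. exact: mw. Qed.

Lemma polyg_sqform : polyg (fun x => sqmod (((cvec x u)^T *m w x) 0 0)).
Proof.
have -> : (fun x => sqmod (((cvec x u)^T *m w x) 0 0)) = cquad u w'.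
  by apply/funext => x; rewrite cquadE.
by apply: (polyg_cquad u mw' (B := 1)) => a x.
Qed.

Lemma sqform_mean :
  \int[m]_x sqmod (((cvec x u)^T *m w x) 0 0) = v u * \int[m]_x nrm2 (w x).
Proof.
under eq_Rintegral do rewrite -cquadE.
rewrite (cquad_mean v0 mv mw' (B := 1))//; congr (_ * _).
by apply: eq_Rintegral => x _; rewrite cweightE.
Qed.

Lemma sqform_moment_le k :
  \int[m]_x sqmod (((cvec x u)^T *m w x) 0 0) ^+ k <= (v u * (1 + k%:R)) ^+ k.
Proof.
under eq_Rintegral do rewrite -cquadE.
apply: (cquad_moment_le v0 mv mw' (B := 1)) => // x; last by rewrite cweightE.
by rewrite cgradE ler_piMl// cquadE sqmod_ge0.
Qed.

End linear_form.
End gaussian_projections.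

(** * Almost everywhere comparison of expectations *)

Section almost_everywhere.
Context d (T : measurableType d) {R : realType} (m : probability T R).
Implicit Types f g : T -> R.

Lemma ae_imp (A B : T -> Prop) : (forall x, A x -> B x) ->
  {ae m, forall x, A x} -> {ae m, forall x, B x}.
Proof. by move=> AB; apply: filterS. Qed.

Lemma ae_imp2 (A B C : T -> Prop) : (forall x, A x -> B x -> C x) ->
  {ae m, forall x, A x} -> {ae m, forall x, B x} -> {ae m, forall x, C x}.
Proof. by move=> ABC; apply: filterS2. Qed.

Lemma ae_forall_fin (J : finType) (A : J -> T -> Prop) :
  (forall j, {ae m, forall x, A j x}) -> {ae m, forall x j, A j x}.
Proof. by move=> mA; apply: filter_forall. Qed.

Lemma eq_Rintegral_ae f g : measurable_fun setT f -> measurable_fun setT g ->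
  {ae m, forall x, f x = g x} -> \int[m]_x f x = \int[m]_x g x.
Proof.
move=> mf mg fg; congr fine; apply: ae_eq_integral => //.
- exact/measurable_EFinP.
- exact/measurable_EFinP.
- by apply: filterS fg => x -> _.
Qed.

Lemma le_Rintegral_ae f g : m.-integrable setT (EFin \o f) ->
  m.-integrable setT (EFin \o g) ->
  {ae m, forall x, f x <= g x} -> \int[m]_x f x <= \int[m]_x g x.
Proof.
move=> fi gi fg; rewrite -subr_ge0 -RintegralB//.
have mf : measurable_fun setT f by apply/measurable_EFinP; exact: measurable_int fi.
have mg : measurable_fun setT g by apply/measurable_EFinP; exact: measurable_int gi.
rewrite (@eq_Rintegral_ae _ (fun x => `|g x - f x|)).
- by apply: Rintegral_ge0 => x _.
- exact: measurable_funB.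
- by apply: measurableT_comp => //; exact: measurable_funB.
- by apply: filterS fg => x fgx; rewrite ger0_norm// subr_ge0.
Qed.

Lemma integrable_ae_le f g : measurable_fun setT f -> m.-integrable setT (EFin \o g) ->
  {ae m, forall x, `|f x| <= g x} -> m.-integrable setT (EFin \o f).
Proof.
move=> mf gi fg; apply/integrableP; split; first exact/measurable_EFinP.
have /integrableP[mg] := gi; apply: le_lt_trans.
apply: ae_ge0_le_integral => //.
- by apply: measurableT_comp => //; exact/measurable_EFinP.
- exact: measurableT_comp.
- apply: filterS fg => x fgx _ /=; rewrite lee_fin; apply: le_trans fgx _.
  exact: ler_norm.
Qed.

End almost_everywhere.

Lemma measurable_sqrt_comp {R : realType} d (T : measurableType d) (f : T -> R) :
  measurable_fun setT f -> measurable_fun setT (fun x => Num.sqrt (f x)).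
Proof.
move=> mf; apply: (measurableT_comp _ mf); apply: continuous_measurable_fun.
exact: sqrt_continuous.
Qed.

Lemma nrm2_proj_contract {R : realType} {n : nat} (P : 'M[R[i]]_n) (x : 'cV[R[i]]_n) :
  P^H = P -> P *m P = P -> nrm2 (P *m x) <= nrm2 x.
Proof.
move=> PH PP; rewrite -subr_ge0.
have -> : nrm2 x - nrm2 (P *m x) = nrm2 (x - P *m x).
  have Pxx : dot x (P *m x) = (nrm2 (P *m x))%:C.
    by rewrite -dot_nrm2 (dot_mull P x (P *m x)) PH mulmxA PP.
  have xPx : dot (P *m x) x = (nrm2 (P *m x))%:C by rewrite (dot_mull P x x) PH.
  apply: (@complexI R); rewrite rmorphB/= -[in RHS]dot_nrm2 dotBr !dotBl.
  rewrite Pxx xPx !dot_nrm2; ring.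
exact: nrm2_ge0.
Qed.

(** * Mean and variance of the interference *)

Section zero_forcing_law.
Context {K n : nat} {R : realType}.
Local Notation U := ('I_K + 'I_K)%type.
Local Notation I := (U * ('I_n * 'I_1 * bool))%type.
Implicit Types (x : I -> R) (l k : 'I_K) (J : {set 'I_K}).

Definition est x l : 'cV[R[i]]_n := cvec x (inl l).
Definition err x k : 'cV[R[i]]_n := cvec x (inr k).
Definition gv x l : 'cV[R[i]]_n := conjmx (est x l).

Lemma mxmeas_gv l : mxmeas (fun x : prodR I R => gv x l).
Proof. exact/mxmeasJ/mxmeas_cvec. Qed.

Lemma gv_upd_inl x l k j t : k != l -> gv (upd x (inl l, j) t) k = gv x k.
Proof. by move=> kl; rewrite /gv /est cvec_upd. Qed.

Lemma gv_upd_inr x k j t : gv (upd x (inr k, j) t) = gv x.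
Proof. by apply/funext => l; rewrite /gv /est cvec_upd. Qed.

Lemma proj_upd_inl x l J j t : l \notin J -> proj (gv (upd x (inl l, j) t)) J = proj (gv x) J.
Proof.
move=> lJ; apply: proj_ext => k kJ; apply: gv_upd_inl.
by apply: contraNneq lJ => <-.
Qed.

Lemma mxmeas_pr J : mxmeas (fun x : prodR I R => proj (gv x) J).
Proof. by apply: mxmeas_proj => l; exact: mxmeas_gv. Qed.

Lemma mxmeas_beamdir l : mxmeas (fun x : prodR I R => beamdir (gv x) l).
Proof. by apply: mxmeasM; [exact: mxmeas_pr|exact: mxmeas_gv]. Qed.

Lemma mxmeas_beam l : mxmeas (fun x : prodR I R => beam (gv x) l).
Proof.
apply: mxmeasZ; last exact: mxmeas_beamdir.
apply/cmeasR/measurable_funV/measurable_sqrt_comp/measurable_nrm2.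
exact: mxmeas_beamdir.
Qed.

Definition user_var (s2 : R) (u : U) : R := match u with inl _ => 1 - s2 | inr _ => s2 end.

Variables (s2 : R) (m : probability (prodR I R) R).
Hypotheses (s20 : 0 <= s2) (s21 : s2 < 1) (Kn : (K <= n)%N)
  (mv : gauss_product (fun c => user_var s2 c.1 / 2) m).
Local Notation v := (1 - s2).
Local Notation N := (n - K + 1)%N.

Lemma user_var_ge0 u : 0 <= user_var s2 u.
Proof. by case: u => k; rewrite /user_var// subr_ge0 ltW. Qed.

Let pi (f : (I -> R) -> R) : polyg f -> m.-integrable setT (EFin \o f).
Proof. exact: (polyg_integrable_gauss user_var_ge0 mv). Qed.

Lemma nrm2_pr_le x J : nrm2 (proj (gv x) J) <= n%:R.
Proof. exact: nrm2_proj_le. Qed.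

Lemma nrm2_pr_ge x J l : l \notin J -> N%:R <= nrm2 (proj (gv x) J).
Proof.
move=> lJ; apply: le_trans (nrm2_proj_ge _ J).
have JK : (#|J| < K)%N.
  rewrite -[X in (_ < X)%N](card_ord K) -(cardsC J) -[X in (X < _)%N]addn0 ltn_add2l.
  by apply/card_gt0P; exists l; rewrite inE.
rewrite lerBrDr -natrD ler_nat -[X in (_ <= X)%N](subnK Kn) -addnA leq_add2l.
by rewrite add1n.
Qed.

(** Each projected estimate has a finite first inverse moment, hence is almost surely nonzero; the
    bound on [N] is what an inverse moment of order 1 requires. *)
Lemma generic_ae : (2 <= N)%N -> {ae m, forall x, generic (gv x)}.
Proof.
move=> N2; apply: ae_forall_fin => J; apply: ae_forall_fin => l.
have [lJ|lJ] := boolP (l \notin J); last exact: aeW.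
have vu : 0 < user_var s2 (inl l) by rewrite subr_gt0.
have h := @projnorm_gt0_ae U n R _ m user_var_ge0 mv (inl l) (fun x => proj (gv x) J) n%:R
  (mxmeas_pr J) (fun x => projH _ _) (fun x => proj_idem _ _) (fun x => nrm2_pr_le x J)
  (fun x j t => proj_upd_inl x j t lJ) N vu (fun x => nrm2_pr_ge x lJ) N2.
by apply: ae_imp h => x h _.
Qed.

Section leakage_sum.
Variable k : 'I_K.

Definition leak x l : R[i] := ((err x k)^T *m beam (gv x) l) 0 0.
Definition leaksum x : R := \sum_(l | l != k) sqmod (leak x l).

(** The squared Frobenius norm of the Gram matrix of the interfering beams, diagonal included. *)
Definition beam_corr x : R :=
  \sum_(l | l != k) \sum_(l' | l' != k) sqmod (dot (beam (gv x) l) (beam (gv x) l')).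

Let w l x : 'cV[R[i]]_n := if l == k then 0 else beam (gv x) l.

Let mw l : mxmeas (w l : prodR I R -> _).
Proof. by rewrite /w; case: (l == k); [exact: mxmeas_cst|exact: mxmeas_beam]. Qed.

Let wB l x : nrm2 (w l x) <= 1.
Proof. by rewrite /w; case: ifP => _; rewrite ?nrm20// nrm2_beam_le1. Qed.

Let iw l x j t : w l (upd x (inr k, j) t) = w l x.
Proof. by rewrite /w gv_upd_inr. Qed.

Let cquadE x : cquad (inr k) w x = leaksum x.
Proof.
rewrite /cquad /leaksum [RHS]big_mkcond/=; apply: eq_bigr => l _.
by rewrite /cform /w; case: ifP => //= _; rewrite mulmx0 mxE sqmod0.
Qed.

Let Wm x : 'M[R[i]]_(n, K) := \matrix_(i, l) w l x i 0.

Let y (r : 'I_n) x : 'cV[R[i]]_n := col r (Wm x *m (Wm x)^H).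

(** The squared gradient of the interference is again a quadratic form in the error vector, given by
    the columns of the product of [Wm x] and its adjoint, so [cquad_mean] yields its mean. *)
Let cgradE x : cgrad (inr k) w x = cquad (inr k) y x.
Proof.
have tE (a b : 'cV[R[i]]_n) : (a^T *m b) 0 0 = \sum_i a i 0 * b i 0.
  by rewrite mxE; apply: eq_bigr => i _; rewrite mxE.
apply: eq_bigr => r _; congr sqmod; rewrite /cform tE.
under eq_bigr do rewrite tE mulr_sumr.
rewrite exchange_big/=; apply: eq_bigr => i _.
have -> : y r x i 0 = \sum_l w l x i 0 * Num.conj (w l x r 0).
  by rewrite mxE mxE; apply: eq_bigr => l _; rewrite !mxE.
by rewrite mulr_sumr; apply: eq_bigr => l _; ring.
Qed.

Let my r : mxmeas (y r : prodR I R -> _).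
Proof.
have mW : mxmeas (Wm : prodR I R -> _).
  by move=> i l; under [X in cmeas X]eq_fun do rewrite mxE; exact: mw.
move=> i j; under [X in cmeas X]eq_fun do rewrite mxE.
by apply: mxmeasM => //; exact/mxmeasJ/mxmeasT.
Qed.

Let iy r x j t : y r (upd x (inr k, j) t) = y r x.
Proof. by rewrite /y /Wm; congr (col _ (_ *m _^H)); apply/matrixP => i l; rewrite !mxE iw. Qed.

Let corr x : R := \sum_l \sum_l' sqmod (dot (w l x) (w l' x)).

Let cweightE x : cweight y x = corr x.
Proof.
transitivity (nrm2 (Wm x *m (Wm x)^H)).
  rewrite /cweight /nrm2 [RHS]exchange_big/=; apply: eq_bigr => r _.
  by apply: eq_bigr => i _; rewrite big_ord1 mxE.
transitivity (nrm2 ((Wm x)^H *m Wm x)).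
  apply: (@complexI R); rewrite !nrm2_trace !mulmxH !conj_is_trmxCK.
  by rewrite -mulmxA mxtrace_mulC -!mulmxA.
apply: eq_bigr => l _; apply: eq_bigr => l' _; congr sqmod.
by rewrite /dot !mxE; apply: eq_bigr => i _; rewrite !mxE.
Qed.

Let corrE x : corr x = beam_corr x.
Proof.
rewrite /beam_corr [RHS]big_mkcond/=; apply: eq_bigr => l _; rewrite /w.
case: ifP => _ /=; first by rewrite big1// => l' _; rewrite dot0l sqmod0.
rewrite [RHS]big_mkcond/=; apply: eq_bigr => l' _.
by case: ifP => _ //=; rewrite dot0r sqmod0.
Qed.

Let corrB x : corr x <= K%:R * K%:R.
Proof.
have sq1 l l' : sqmod (dot (w l x) (w l' x)) <= 1.
  apply: le_trans (sqmod_mulmx_le _ _) _; rewrite nrm2H -[leRHS]mulr1.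
  by rewrite ler_pM// ?nrm2_ge0.
apply: (@le_trans _ _ (\sum_(l < K) \sum_(l' < K) 1)).
  by apply: ler_sum => l _; apply: ler_sum.
under eq_bigr do rewrite sumr_const card_ord.
by rewrite sumr_const card_ord mulr_natr.
Qed.

Let yB r x : nrm2 (y r x) <= K%:R * K%:R.
Proof.
apply: le_trans (corrB x); rewrite -cweightE /cweight (bigD1 r)//= lerDl.
by apply: sumr_ge0 => s _; exact: nrm2_ge0.
Qed.

Lemma polyg_leaksum : polyg leaksum.
Proof.
have -> : leaksum = cquad (inr k) w by apply/funext => x; rewrite cquadE.
exact: polyg_cquad mw wB.
Qed.

Lemma polyg_beam_corr : polyg beam_corr.
Proof.
have -> : beam_corr = cweight y by apply/funext => x; rewrite cweightE corrE.
exact: polyg_cweight my yB.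
Qed.

Hypothesis N2 : (2 <= N)%N.

Let cweight_ae : {ae m, forall x, cweight w x = K%:R - 1}.
Proof.
apply: ae_imp (generic_ae N2) => x gx.
rewrite /cweight (bigD1 k)//= {1}/w eqxx nrm20 add0r.
rewrite (eq_bigr (fun=> 1)); last by move=> l /negbTE lk; rewrite /w lk nrm2_beam.
rewrite sumr_const (_ : #|_| = K.-1); last first.
  by rewrite -[in RHS](card_ord K) -(cardC1 k); apply: eq_card => l; rewrite !inE.
by rewrite -subn1 natrB// (leq_ltn_trans _ (ltn_ord k)).
Qed.

Lemma leaksum_mean : \int[m]_x leaksum x = s2 * (K%:R - 1).
Proof.
under eq_Rintegral do rewrite -cquadE.
rewrite (cquad_mean user_var_ge0 mv mw wB iw)/=; congr (_ * _).
rewrite -[RHS](Rintegral_prob_cst m); apply: eq_Rintegral_ae => //.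
exact: (polyg_cweight mw wB).1.
Qed.

(** Stein's identity gives E S^2 = s2 ((K - 1) E S + E cgrad). The first term is the squared mean,
    the second is s2^2 times the mean of [beam_corr]. *)
Lemma leaksum_variance :
  \int[m]_x (leaksum x - s2 * (K%:R - 1)) ^+ 2 = s2 ^+ 2 * \int[m]_x beam_corr x.
Proof.
set S0 := s2 * _.
have pS := polyg_leaksum.
have ES2 : \int[m]_x leaksum x ^+ 2 = S0 ^+ 2 + s2 ^+ 2 * \int[m]_x beam_corr x.
  under eq_Rintegral do rewrite -cquadE.
  rewrite (cquad_stein_pow user_var_ge0 mv mw wB iw 1)/= mul1r.
  rewrite (@eq_Rintegral_ae _ (prodR I R) _ m
    (fun x : prodR I R => cweight w x * cquad (inr k) w x ^+ 1)
    (fun x : prodR I R => (K%:R - 1) * leaksum x)); last 3 first.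
  - apply: (polygM (polyg_cweight mw wB) _).1; apply: polygX.
    exact: polyg_cquad mw wB.
  - exact: (polygZ _ pS).1.
  - by apply: ae_imp cweight_ae => x ->; rewrite expr1 cquadE.
  rewrite RintegralZl//; last exact: pi.
  rewrite leaksum_mean.
  under [X in _ * (_ + X)]eq_Rintegral do rewrite expr0 mulr1 cgradE.
  rewrite (cquad_mean user_var_ge0 mv my yB iy)/=.
  under [X in _ * (_ + _ * X)]eq_Rintegral do rewrite cweightE corrE.
  rewrite /S0; ring.
transitivity (\int[m]_x (leaksum x ^+ 2 + ((- (2 * S0)) * leaksum x + S0 ^+ 2))).
  by apply: eq_Rintegral => x _; ring.
have iS := pi (polygZ (- (2 * S0)) pS).
rewrite RintegralD//; [|exact/pi/polygX|apply: pi; apply: polygD; [exact: polygZ|exact: polyg_cst]].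
rewrite RintegralD//; last exact/pi/polyg_cst.
rewrite RintegralZl//; last exact: pi.
rewrite Rintegral_prob_cst ES2 leaksum_mean -/S0; ring.
Qed.

End leakage_sum.
End zero_forcing_law.

(** * Mean squared correlation between beams *)

Section normalized_vector.
Context {R : realType} {n : nat}.
Implicit Types u w : 'cV[R[i]]_n.

(** The divisor is the norm of [u], not of [w]: taking [w] to be [u] or a projection of it gives
    norm at most 1 at every point. *)
Definition normalize (u w : 'cV[R[i]]_n) : 'cV[R[i]]_n :=
  ((Num.sqrt (nrm2 u))^-1)%:C *: w.

Lemma nrm2_normalize_le1 u w : nrm2 w <= nrm2 u -> nrm2 (normalize u w) <= 1.
Proof.
move=> wu; rewrite nrm2Z sqmodR exprVn sqr_sqrtr ?nrm2_ge0//.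
have [u0|u0] := eqVneq (nrm2 u) 0; first by rewrite u0 invr0 mul0r.
by rewrite ler_pdivrMl ?mulr1// lt_neqAle eq_sym u0 nrm2_ge0.
Qed.

Lemma normalizeE u w z : 0 < nrm2 u ->
  sqmod (dot z w) = nrm2 u * sqmod (dot z (normalize u w)).
Proof.
move=> u0; rewrite dotZr sqmodM sqmodR exprVn sqr_sqrtr ?(ltW u0)//.
by rewrite mulrA divff ?mul1r// gt_eqF.
Qed.

Lemma mxmeas_normalize d (T : measurableType d) (u w : T -> 'cV[R[i]]_n) :
  mxmeas u -> mxmeas w -> mxmeas (fun x => normalize (u x) (w x)).
Proof.
move=> mu mw; apply: mxmeasZ => //.
exact/cmeasR/measurable_funV/measurable_sqrt_comp/measurable_nrm2.
Qed.

Lemma dot_conj u w : dot (conjmx u) w = (u^T *m w) 0 0.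
Proof.
rewrite /dot; congr ((_ *m _) 0 0).
by apply/matrixP => i j; rewrite !mxE conjCK.
Qed.

End normalized_vector.

Lemma cancel_product {R : realFieldType} (s a b d f : R) :
  0 < a -> 0 < b -> d = b * f -> s * (a * b) <= d -> s <= f / a.
Proof.
by move=> a0 b0 -> ; rewrite mulrA [leRHS]mulrC ler_pM2r// ler_pdivlMr.
Qed.

Section beam_correlation_mean.
Context {K n : nat} {R : realType}.
Local Notation U := ('I_K + 'I_K)%type.
Local Notation I := (U * ('I_n * 'I_1 * bool))%type.
Variables (s2 : R) (m : probability (prodR I R) R).
Hypotheses (s20 : 0 <= s2) (s21 : s2 < 1) (Kn : (K <= n)%N)
  (mv : gauss_product (fun c => user_var s2 c.1 / 2) m).
Local Notation v := (1 - s2).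
Local Notation N := (n - K + 1)%N.
Hypothesis N4 : (4 <= N)%N.

Let v0 : 0 < v. Proof. by rewrite subr_gt0. Qed.
Let uv0 (u : U) : 0 <= user_var s2 u := user_var_ge0 s20 s21 u.
Let pi (f : (I -> R) -> R) : polyg f -> m.-integrable setT (EFin \o f).
Proof. exact: (polyg_integrable_gauss uv0 mv). Qed.
Let N2 : (2 <= N)%N. Proof. exact: leq_trans N4. Qed.

Let polyg_pair (l k : 'I_K) :
  polyg (fun x : I -> R => sqmod (dot (beam (gv x) l) (beam (gv x) k))).
Proof.
apply: (@polyg_bounded _ _ _ 1).
  apply: measurable_sqmod; apply: mxmeasM; last exact: mxmeas_beam.
  exact/mxmeasJ/mxmeasT/mxmeas_beam.
move=> x; rewrite ger0_norm ?sqmod_ge0//.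
apply: le_trans (sqmod_mulmx_le _ _) _; rewrite nrm2H -[leRHS]mulr1.
by rewrite ler_pM ?nrm2_ge0 ?nrm2_beam_le1.
Qed.

(* [lambda] balances the second moment of the numerator, of order [v^2], against
   the second inverse moment of the denominator, of order [1 / (v N)^2]. *)
Lemma beam_corr_pair (l k : 'I_K) : l != k ->
  \int[m]_x sqmod (dot (beam (gv x) l) (beam (gv x) k)) <= 13 / 2 / N%:R.
Proof.
move=> lk; set J := finset.setC [set l; k]%SET.
have lJ : l \notin J by rewrite !inE eqxx.
pose P (x : I -> R) := proj (gv x) J.
pose w (x : I -> R) := normalize (P x *m gv x k) (P x *m gv x k).
have mP : mxmeas (P : prodR I R -> _) := mxmeas_pr J.
have mw : mxmeas (w : prodR I R -> _).
  by apply: mxmeas_normalize; apply: mxmeasM => //; exact: mxmeas_gv.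
have w1 x : nrm2 (w x) <= 1 by exact: nrm2_normalize_le1.
have iP x j t : P (upd x (inl l, j) t) = P x by exact: proj_upd_inl.
have iw x j t : w (upd x (inl l, j) t) = w x.
  by rewrite /w iP gv_upd_inl// eq_sym.
(* With the other estimates frozen, [f] is the squared modulus of a linear form in the estimate of
   [l], with coefficients of norm at most 1; the squared correlation is then at most f / A. *)
pose f (x : I -> R) := sqmod (((cvec x (inl l))^T *m w x) 0 0).
pose A (x : I -> R) := nrm2 (P x *m conjmx (cvec x (inl l))).
have pf : polyg f := polyg_sqform (inl l) mw w1.
have fm : \int[m]_x f x ^+ 2 <= (v * (1 + 2)) ^+ 2 :=
  sqform_moment_le uv0 mv mw w1 iw 2.
have PN x : N%:R <= nrm2 (P x) by apply: nrm2_pr_ge lJ.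
have [iA Am] := @projnorm_inv_moment U n R _ m uv0 mv (inl l) P n%:R mP
  (fun x => projH _ _) (fun x => proj_idem _ _) (fun x => nrm2_proj_le _ _)
  iP N v0 PN 2 isT N4.
pose lam : R := (v ^+ 2 * N%:R)^-1.
have Npos : 0 < N%:R :> R by rewrite ltr0n (leq_trans _ N4).
have lam0 : 0 < lam by rewrite invr_gt0 mulr_gt0 ?exprn_gt0.
have if2 : m.-integrable setT (EFin \o (fun x => f x ^+ 2)) by exact/pi/polygX.
have i1 : m.-integrable setT (EFin \o (fun x => lam / 2 * f x ^+ 2)).
  exact/pi/polygZ/polygX.
have i2 : m.-integrable setT (EFin \o (fun x => lam^-1 / 2 * (A x)^-1 ^+ 2)).
  by apply: (integrableZl measurableT (lam^-1 / 2) iA).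
apply: (@le_trans _ _ (\int[m]_x (lam / 2 * f x ^+ 2 + lam^-1 / 2 * (A x)^-1 ^+ 2))).
  apply: le_Rintegral_ae; [exact: (pi (polyg_pair l k))|exact: (integrableD measurableT i1 i2)|].
  apply: ae_imp (generic_ae s20 s21 Kn mv N2) => x gx.
  have A0 : 0 < A x by exact: gx.
  have B0 : 0 < nrm2 (P x *m gv x k) by apply: gx; rewrite !inE eqxx orbT.
  have dE : sqmod (dot (gv x l) (P x *m gv x k)) = nrm2 (P x *m gv x k) * f x.
    apply: etrans (normalizeE (P x *m gv x k) (gv x l) B0) _.
    exact: (congr1 (fun z => _ * sqmod z) (dot_conj (cvec x (inl l)) (w x))).
  have h := beam_correlation gx lk.
  rewrite -/(A x) in h.
  apply: le_trans (cancel_product A0 B0 dE h) _.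
  have := sqr_ge0 (lam * f x - (A x)^-1).
  have l0 : 0 < lam^-1 / 2 by rewrite divr_gt0// invr_gt0.
  rewrite -(pmulr_rge0 _ l0).
  have -> : lam^-1 / 2 * (lam * f x - (A x)^-1) ^+ 2 =
    lam / 2 * f x ^+ 2 + lam^-1 / 2 * (A x)^-1 ^+ 2 - f x / A x.
    by field; rewrite ?gt_eqF.
  by rewrite subr_ge0.
rewrite RintegralD// !RintegralZl//.
have -> : 13 / 2 / N%:R = lam / 2 * (v * (1 + 2)) ^+ 2 +
    lam^-1 / 2 * (2 / (v * N%:R)) ^+ 2.
  by rewrite /lam; field; rewrite !gt_eqF.
have c1 : 0 <= lam / 2 by apply: divr_ge0 => //; exact: ltW.
have c2 : 0 <= lam^-1 / 2 by apply: divr_ge0 => //; rewrite invr_ge0; exact: ltW.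
apply: lerD; [exact: (ler_wpM2l c1 fm)|exact: (ler_wpM2l c2 Am)].
Qed.

Lemma beam_corr_mean (k : 'I_K) :
  \int[m]_x beam_corr k x <= K%:R + K%:R ^+ 2 * (13 / 2 / N%:R).
Proof.
rewrite /beam_corr Rintegral_sum; last first.
  by move=> l _; apply: pi; apply: polyg_sum => k' _; exact: polyg_pair.
set c := 13 / 2 / _; have c0 : 0 <= c by rewrite !divr_ge0.
have pair_le l k' : \int[m]_x sqmod (dot (beam (gv x) l) (beam (gv x) k')) <= (l == k')%:R + c.
  have [->|lk] := eqVneq l k'; last by rewrite add0r; exact: beam_corr_pair.
  apply: (@le_trans _ _ 1); last by rewrite lerDl.
  rewrite -[leRHS](Rintegral_prob_cst m); apply: le_Rintegral => //.
  - exact: pi.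
  - exact/pi/polyg_cst.
  - move=> x _; apply: le_trans (sqmod_mulmx_le _ _) _; rewrite nrm2H -[leRHS]mulr1.
    by rewrite ler_pM ?nrm2_ge0 ?nrm2_beam_le1.
apply: (@le_trans _ _ (\sum_(l < K) \sum_(k' < K) ((l == k')%:R + c))).
  rewrite [leLHS]big_mkcond/=; apply: ler_sum => l _; case: ifP => _; last first.
    by apply: sumr_ge0 => k' _; rewrite addr_ge0.
  rewrite Rintegral_sum; last by move=> k' _; exact/pi/polyg_pair.
  rewrite [leLHS]big_mkcond/=; apply: ler_sum => k' _; case: ifP => _ //.
  by rewrite addr_ge0.
have row l : \sum_(k' < K) ((l == k')%:R + c) = 1 + c *+ K.
  rewrite big_split/= sumr_const card_ord (bigD1 l)//= eqxx big1 ?addr0// => k' k'l.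
  by rewrite eq_sym (negbTE k'l).
under eq_bigr do rewrite row.
by rewrite sumr_const card_ord mulrnDl -(mulr_natl (c *+ K)) -(mulr_natl c) mulrA expr2.
Qed.

End beam_correlation_mean.

(** * Inverse moments of the interference *)

Lemma sum_exp4_le {R : realType} (J : finType) (t : J -> R) :
  (\sum_j t j) ^+ 4 <= #|J|%:R ^+ 3 * \sum_j t j ^+ 4.
Proof.
have cs (r : J -> R) : (\sum_j r j) ^+ 2 <= #|J|%:R * \sum_j r j ^+ 2.
  have := sum_cauchy_schwarz (fun=> 1) r.
  under eq_bigr do rewrite mul1r.
  by under [in X in _ <= X -> _]eq_bigr do rewrite expr1n; rewrite sumr_const.
have -> : (\sum_j t j) ^+ 4 = ((\sum_j t j) ^+ 2) ^+ 2 by rewrite -exprM.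
apply: (@le_trans _ _ ((#|J|%:R * \sum_j t j ^+ 2) ^+ 2)).
  apply: lerXn2r (cs t); rewrite nnegrE ?sqr_ge0// mulr_ge0//.
  by apply: sumr_ge0 => j _; exact: sqr_ge0.
have h : (\sum_j t j ^+ 2) ^+ 2 <= #|J|%:R * \sum_j t j ^+ 4.
  apply: le_trans (cs (fun j => t j ^+ 2)) _.
  by under eq_bigr do rewrite -exprM.
by rewrite exprMn (exprSr _ 2) -mulrA ler_wpM2l// sqr_ge0.
Qed.

Lemma prod4_le {R : realFieldType} (a b c d : R) :
  a * b * c * d <= a ^+ 4 + b ^+ 4 + c ^+ 4 + d ^+ 4.
Proof.
have sq (x y : R) : x * y <= (x ^+ 2 + y ^+ 2) / 2.
  by have := sqr_ge0 (x - y); rewrite sqrrB; lra.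
have h1 := sq (a * b) (c * d).
have h2 := sq (a ^+ 2) (b ^+ 2); have h3 := sq (c ^+ 2) (d ^+ 2).
have a0 := sqr_ge0 (a ^+ 2); have b0 := sqr_ge0 (b ^+ 2).
have c0 := sqr_ge0 (c ^+ 2); have d0 := sqr_ge0 (d ^+ 2).
rewrite !exprMn in h1; rewrite -!exprM in h2 h3 a0 b0 c0 d0.
by rewrite -mulrA; apply: le_trans h1 _; lra.
Qed.

Section leakage_inverse_moment.
Context {K n : nat} {R : realType}.
Local Notation U := ('I_K + 'I_K)%type.
Local Notation I := (U * ('I_n * 'I_1 * bool))%type.
Variables (s2 : R) (m : probability (prodR I R) R).
Hypotheses (s20 : 0 < s2) (s21 : s2 < 1) (Kn : (K <= n)%N)
  (mv : gauss_product (fun c => user_var s2 c.1 / 2) m).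
Local Notation v := (1 - s2).
Local Notation N := (n - K + 1)%N.
Hypotheses (N32 : (32 <= N)%N) (K65 : (65 <= K)%N).
Variable k : 'I_K.

Let v0 : 0 < v. Proof. by rewrite subr_gt0. Qed.
Let uv0 (u : U) : 0 <= user_var s2 u := user_var_ge0 (ltW s20) s21 u.
Let pi (f : (I -> R) -> R) : polyg f -> m.-integrable setT (EFin \o f).
Proof. exact: (polyg_integrable_gauss uv0 mv). Qed.
Let n0 : 0 < n%:R :> R.
Proof. by rewrite ltr0n (leq_trans _ Kn)// (leq_trans _ K65). Qed.
Let N0 : 0 < N%:R :> R. Proof. by rewrite ltr0n (leq_trans _ N32). Qed.
Let K1 : 0 < K%:R - 1 :> R. Proof. by rewrite subr_gt0 ltr1n (leq_trans _ K65). Qed.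

(* [leakproj] is only a projection of rank [K - 1] when the estimates are linearly
   independent; elsewhere it is replaced by the identity, so that the moment bounds
   apply without exception. *)
Let indep_flag (x : I -> R) : R[i] :=
  \det (gram (gv x) (finset.setTfor 'I_K)) / \det (gram (gv x) (finset.setTfor 'I_K)).

Let Pi (x : I -> R) : 'M[R[i]]_n :=
  indep_flag x *: leakproj (gv x) k + (1 - indep_flag x) *: 1%:M.

Let PiE (x : I -> R) : \det (gram (gv x) (finset.setTfor 'I_K)) != 0 ->
  Pi x = leakproj (gv x) k.
Proof. by move=> dT; rewrite /Pi /indep_flag divff// scale1r subrr scale0r addr0. Qed.

Let Pi_junk (x : I -> R) : \det (gram (gv x) (finset.setTfor 'I_K)) = 0 -> Pi x = 1%:M.
Proof. by move=> dT; rewrite /Pi /indep_flag dT mul0r scale0r subr0 scale1r add0r. Qed.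

Let mPi : mxmeas (Pi : prodR I R -> _).
Proof.
have mflag : cmeas (indep_flag : prodR I R -> _).
  have md : cmeas (fun x : prodR I R => \det (gram (gv x) (finset.setTfor 'I_K))).
    by apply: cmeas_det_gram => l; exact: mxmeas_gv.
  by apply: cmeasM => //; exact: cmeasV.
apply: mxmeasD.
  apply: mxmeasZ => //; apply: mxmeasD; first exact: mxmeas_pr.
  by apply: mxmeasN; exact: mxmeas_pr.
apply: mxmeasZ; last exact: mxmeas_cst.
apply: cmeasD; first exact: cmeas_cst.
have -> : (fun x : prodR I R => - indep_flag x) = (fun x => (-1) * indep_flag x).
  by apply/funext => x; rewrite mulN1r.
by apply: cmeasM => //; exact: cmeas_cst.
Qed.

Let PiH x : (Pi x)^H = Pi x.
Proof.
have [/Pi_junk ->|/PiE ->] := eqVneq (\det (gram (gv x) (finset.setTfor 'I_K))) 0.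
  exact: trC_1.
exact: leakprojH.
Qed.

Let PiPi x : Pi x *m Pi x = Pi x.
Proof.
have [/Pi_junk ->|dT] := eqVneq (\det (gram (gv x) (finset.setTfor 'I_K))) 0.
  exact: mulmx1.
by rewrite PiE// leakproj_idem.
Qed.

Let nrm2_1 : nrm2 (1%:M : 'M[R[i]]_n) = n%:R.
Proof. by apply: (@complexI R); rewrite nrm2_trace trC_1 mulmx1 mxtrace1 rmorph_nat. Qed.

Let Pi_ge x : K.-1%:R <= nrm2 (Pi x).
Proof.
have K0 : (0 < K)%N by exact: leq_trans K65.
have [/Pi_junk ->|dT] := eqVneq (\det (gram (gv x) (finset.setTfor 'I_K))) 0.
  by rewrite nrm2_1 ler_nat (leq_trans (leq_pred K)).
by rewrite PiE// nrm2_leakproj// -subn1 natrB.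
Qed.

Let Pi_le x : nrm2 (Pi x) <= n%:R.
Proof.
have [/Pi_junk ->|dT] := eqVneq (\det (gram (gv x) (finset.setTfor 'I_K))) 0.
  by rewrite nrm2_1.
rewrite PiE// nrm2_leakproj//; apply: (@le_trans _ _ K%:R); first by rewrite gerBl.
by rewrite ler_nat.
Qed.

Let iPi x j t : Pi (upd x (inr k, j) t) = Pi x.
Proof. by rewrite /Pi /indep_flag gv_upd_inr. Qed.

Let w l (x : I -> R) := normalize (gv x l) (Pi x *m gv x l).

Let mw l : mxmeas (w l : prodR I R -> _).
Proof.
apply: mxmeas_normalize; first exact: mxmeas_gv.
by apply: mxmeasM => //; exact: mxmeas_gv.
Qed.

Let w1 l x : nrm2 (w l x) <= 1.
Proof. by apply: nrm2_normalize_le1; exact: nrm2_proj_contract. Qed.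

Let iw l x j t : w l (upd x (inr k, j) t) = w l x.
Proof. by rewrite /w iPi gv_upd_inr. Qed.

(** The bound on S0 / S is split into four dimensionless factors, whose moments are bounded by
    constants depending at most on the ratio n / N. *)
Let alpha l (x : I -> R) : R := s2^-1 * sqmod (((err x k)^T *m w l x) 0 0).
Let beta l (x : I -> R) : R := (n%:R * v)^-1 * nrm2 (1%:M *m gv x l).
Let gamma l (x : I -> R) : R := n%:R * v * (nrm2 (beamdir (gv x) l))^-1.
Let phi (x : I -> R) : R := s2 * (K%:R - 1) * (nrm2 (Pi x *m conjmx (err x k)))^-1.

Let alpha_moment l r : m.-integrable setT (EFin \o (fun x => alpha l x ^+ r)) /\
  \int[m]_x alpha l x ^+ r <= (1 + r%:R) ^+ r.
Proof.
have pf := polyg_sqform (inr k) (mw l) (w1 l).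
have E x : alpha l x ^+ r = s2^-1 ^+ r * sqmod (((err x k)^T *m w l x) 0 0) ^+ r.
  by rewrite exprMn.
split; first by apply: pi; apply: polygX; exact: polygZ.
under eq_Rintegral do rewrite E.
rewrite RintegralZl//; last exact/pi/polygX.
apply: (@le_trans _ _ (s2^-1 ^+ r * (s2 * (1 + r%:R)) ^+ r)).
  rewrite ler_wpM2l ?exprn_ge0 ?invr_ge0 ?(ltW s20)//.
  exact: (sqform_moment_le uv0 mv (mw l) (w1 l) (iw l) r).
by rewrite -exprMn mulrA mulVf ?mul1r// gt_eqF.
Qed.

Let beta_moment l r : m.-integrable setT (EFin \o (fun x => beta l x ^+ r)) /\
  \int[m]_x beta l x ^+ r <= (1 + r%:R) ^+ r.
Proof.
have m1 : mxmeas ((fun=> 1%:M) : prodR I R -> 'M[R[i]]_n) by exact: mxmeas_cst.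
have n1 (x : I -> R) : nrm2 (1%:M : 'M[R[i]]_n) <= n%:R by rewrite nrm2_1.
have H1 (x : I -> R) : (1%:M : 'M[R[i]]_n)^H = 1%:M := trC_1 n.
have I1 (x : I -> R) : (1%:M : 'M[R[i]]_n) *m 1%:M = 1%:M by exact: mulmx1.
have pf := polyg_projnorm (inl l) m1 H1 n1.
have E x : beta l x ^+ r = (n%:R * v)^-1 ^+ r * nrm2 (1%:M *m gv x l) ^+ r.
  by rewrite exprMn.
have nv0 : 0 < n%:R * v by rewrite mulr_gt0.
split; first by apply: pi; apply: polygX; exact: polygZ.
under eq_Rintegral do rewrite E.
rewrite RintegralZl//; last exact/pi/polygX.
apply: (@le_trans _ _ ((n%:R * v)^-1 ^+ r * (v * (n%:R + r%:R)) ^+ r)).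
  rewrite ler_wpM2l ?exprn_ge0 ?invr_ge0 ?(ltW nv0)//.
  by apply: (projnorm_moment_le uv0 mv (u := inl l) m1 H1 I1 n1) => //; rewrite ltW.
have nr0 : 0 <= n%:R + r%:R :> R by rewrite -natrD.
have q0 : 0 <= (n%:R * v)^-1 * (v * (n%:R + r%:R)).
  apply: mulr_ge0; first by rewrite invr_ge0 (ltW nv0).
  exact: mulr_ge0 (ltW v0) nr0.
rewrite -exprMn; apply: lerXn2r; rewrite ?nnegrE ?addr_ge0//.
have -> : (n%:R * v)^-1 * (v * (n%:R + r%:R)) = 1 + r%:R / n%:R.
  by field; rewrite !gt_eqF.
rewrite lerD2l ler_pdivrMr// ler_peMr// ler1n.
by rewrite -(ltr0n R).
Qed.

Let gamma_moment l r : (0 < r)%N -> (2 * r <= N)%N ->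
  m.-integrable setT (EFin \o (fun x => gamma l x ^+ r)) /\
  \int[m]_x gamma l x ^+ r <= (2 * n%:R / N%:R) ^+ r.
Proof.
move=> r0 rN; set J := finset.setC [set l]%SET.
have lJ : l \notin J by rewrite !inE eqxx.
have [ib bm] := @projnorm_inv_moment U n R _ m uv0 mv (inl l) (fun x => proj (gv x) J) n%:R
  (mxmeas_pr J) (fun x => projH _ _) (fun x => proj_idem _ _) (fun x => nrm2_pr_le x J)
  (fun x j t => proj_upd_inl x j t lJ) N v0 (fun x => nrm2_pr_ge Kn x lJ) r r0 rN.
have E x : gamma l x ^+ r = (n%:R * v) ^+ r * (nrm2 (beamdir (gv x) l))^-1 ^+ r.
  by rewrite exprMn.
split.
  have -> : (fun x => gamma l x ^+ r) =
     (fun x => (n%:R * v) ^+ r * (nrm2 (beamdir (gv x) l))^-1 ^+ r) by apply/funext.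
  exact: (integrableZl measurableT ((n%:R * v) ^+ r) ib).
under eq_Rintegral do rewrite E.
rewrite RintegralZl//; apply: (@le_trans _ _ ((n%:R * v) ^+ r * (2 / (v * N%:R)) ^+ r)).
  by rewrite ler_wpM2l// exprn_ge0// mulr_ge0// ltW.
rewrite -exprMn le_eqVlt; apply/orP; left; apply/eqP; congr (_ ^+ _).
by field; rewrite !gt_eqF.
Qed.

Let phi_moment r : (0 < r)%N -> (2 * r <= K.-1)%N ->
  m.-integrable setT (EFin \o (fun x => phi x ^+ r)) /\
  \int[m]_x phi x ^+ r <= 2 ^+ r.
Proof.
move=> r0 rK.
have [ib bm] := @projnorm_inv_moment U n R _ m uv0 mv (inr k) Pi n%:R
  mPi PiH PiPi Pi_le iPi K.-1 s20 Pi_ge r r0 rK.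
have E x : phi x ^+ r =
    (s2 * (K%:R - 1)) ^+ r * (nrm2 (Pi x *m conjmx (err x k)))^-1 ^+ r.
  by rewrite exprMn.
have K1E : K.-1%:R = K%:R - 1 :> R by rewrite -subn1 natrB// (leq_trans _ K65).
split.
  have -> : (fun x => phi x ^+ r) = (fun x => (s2 * (K%:R - 1)) ^+ r *
      (nrm2 (Pi x *m conjmx (err x k)))^-1 ^+ r) by apply/funext.
  exact: (integrableZl measurableT _ ib).
under eq_Rintegral do rewrite E.
rewrite RintegralZl//.
apply: (@le_trans _ _ ((s2 * (K%:R - 1)) ^+ r * (2 / (s2 * (K%:R - 1))) ^+ r)).
  by rewrite ler_wpM2l ?exprn_ge0 ?mulr_ge0 ?(ltW s20) ?(ltW K1)// -K1E.
rewrite -exprMn le_eqVlt; apply/orP; left; apply/eqP; congr (_ ^+ _).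
by field; rewrite !gt_eqF.
Qed.

(** The 8 bounds (K / (K - 1))^3. The four terms bound the moments of orders 16, 16, 16 and 32 of
    [alpha], [beta], [gamma] and [phi]. *)
Definition inverse_moment_cst : R :=
  8 * ((1 + 16) ^+ 16 + (1 + 16) ^+ 16 + (2 * n%:R / N%:R) ^+ 16 + 2 ^+ 32).

(** By [leakage_lower_bound], S0 / S is at most 1/(K - 1) times the sum over [l] of alpha beta gamma
    phi^2. Convexity bounds the fourth power of the sum and [prod4_le] separates the factors. The
    inverse moments of orders 16 and 32 account for the thresholds 32 on N and 65 on K. A dominating
    [Y] spares the integrability of S^-4. *)
Lemma leaksum_inverse_moment : exists Y : (I -> R) -> R,
  [/\ m.-integrable setT (EFin \o Y), \int[m]_x Y x <= inverse_moment_cst &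
   {ae m, forall x, 0 < leaksum k x /\
                    (s2 * (K%:R - 1) / leaksum k x) ^+ 4 <= Y x}].
Proof.
have gamma_m l := @gamma_moment l 16 isT N32.
have phi_m := @phi_moment 32 isT (_ : (2 * 32 <= K.-1)%N).
have [ip Ep] : m.-integrable setT (EFin \o (fun x => phi x ^+ 32)) /\
    \int[m]_x phi x ^+ 32 <= 2 ^+ 32.
  by apply: phi_m; rewrite -ltnS prednK// (leq_trans _ K65).
pose z l (x : I -> R) := alpha l x ^+ 16 + beta l x ^+ 16 + gamma l x ^+ 16 + phi x ^+ 32.
have iz2 l : m.-integrable setT (EFin \o (fun x => alpha l x ^+ 16 + beta l x ^+ 16)).
  exact: (integrableD measurableT (alpha_moment l 16).1 (beta_moment l 16).1).
have iz3 l : m.-integrable setT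
    (EFin \o (fun x => alpha l x ^+ 16 + beta l x ^+ 16 + gamma l x ^+ 16)).
  exact: (integrableD measurableT (iz2 l) (gamma_m l).1).
have iz l : m.-integrable setT (EFin \o z l).
  exact: (integrableD measurableT (iz3 l) ip).
pose c0 := (1 + 16) ^+ 16 + (1 + 16) ^+ 16 + (2 * n%:R / N%:R) ^+ 16 + 2 ^+ 32 : R.
have c00 : 0 <= c0.
  by rewrite /c0; rewrite !addr_ge0// exprn_ge0// !mulr_ge0// invr_ge0.
have Ez l : \int[m]_x z l x <= c0.
  rewrite /z RintegralD// RintegralD//; last exact: (gamma_m l).1.
  rewrite RintegralD//; [|exact: (alpha_moment l 16).1|exact: (beta_moment l 16).1].
  apply: lerD Ep; apply: lerD (gamma_m l).2.
  by apply: lerD; [exact: (alpha_moment l 16).2|exact: (beta_moment l 16).2].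
(* K^3 is the constant of [sum_exp4_le], taken over all K indices with a zero term at [k]; (K - 1)^4
   comes from the prefactor 1/(K - 1). *)
pose cK : R := K%:R ^+ 3 / (K%:R - 1) ^+ 4.
have cK0 : 0 <= cK by rewrite divr_ge0 ?exprn_ge0// ltW.
pose Z (x : I -> R) := \sum_(l | l != k) z l x.
have iZ : m.-integrable setT (EFin \o Z) by exact: integrable_Rsum.
exists (fun x => cK * Z x); split; first exact: (integrableZl measurableT cK iZ).
  rewrite RintegralZl// Rintegral_sum//.
  apply: (@le_trans _ _ (cK * ((K%:R - 1) * c0))).
    rewrite ler_wpM2l//; apply: le_trans (ler_sum _ (fun l _ => Ez l)) _.
    rewrite sumr_const (_ : #|_| = K.-1).
      by rewrite -[leLHS]mulr_natl -subn1 natrB// (leq_trans _ K65).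
    by rewrite -[in RHS](card_ord K) -(cardC1 k); apply: eq_card => l; rewrite !inE.
  rewrite /inverse_moment_cst -/c0 mulrA ler_wpM2r//.
  have -> : cK * (K%:R - 1) = (K%:R / (K%:R - 1)) ^+ 3.
    by rewrite /cK; field; rewrite gt_eqF.
  have -> : 8 = 2 ^+ 3 :> R by ring.
  apply: lerXn2r; rewrite ?nnegrE ?divr_ge0 ?(ltW K1)//.
  rewrite ler_pdivrMr//; have : 2 <= K%:R :> R by rewrite ler_nat (leq_trans _ K65).
  by move: K%:R => r; lra.
have N2 : (2 <= N)%N by rewrite (leq_trans _ N32).
have gae : {ae m, forall x, generic (gv x)} := generic_ae (ltW s20) s21 Kn mv N2.
have F0ae : {ae m, forall x, 0 < nrm2 (Pi x *m conjmx (err x k))}.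
  apply: (@projnorm_gt0_ae U n R _ m uv0 mv (inr k) Pi n%:R
    mPi PiH PiPi Pi_le iPi K.-1 s20 Pi_ge).
  by rewrite -ltnS prednK// (leq_trans _ K65).
apply: ae_imp2 gae F0ae => x gx F0.
set F := nrm2 _ in F0.
have dT : \det (gram (gv x) (finset.setTfor 'I_K)) != 0 by exact: generic_det.
have b0 l : 0 < nrm2 (beamdir (gv x) l) by exact: beamdir_gt0.
have g0 l : 0 < nrm2 (gv x l).
  by apply: lt_le_trans (b0 l) _; apply: nrm2_proj_contract; [exact: projH|exact: proj_idem].
pose T := \sum_(l | l != k) nrm2 (gv x l) * sqmod (((err x k)^T *m w l x) 0 0) /
  nrm2 (beamdir (gv x) l).
have T0 : 0 <= T.
  apply: sumr_ge0 => l _; apply: divr_ge0; last exact: nrm2_ge0.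
  by apply: mulr_ge0; [exact: nrm2_ge0|exact: sqmod_ge0].
have S0 : 0 <= leaksum k x by apply: sumr_ge0 => l _; exact: sqmod_ge0.
have FST : F ^+ 2 <= leaksum k x * T.
  have := leakage_lower_bound gx k (conjmx (err x k)).
  rewrite -PiE// -/F => h; apply: le_trans h _; rewrite le_eqVlt; apply/orP; left.
  apply/eqP; apply: (congr2 ( *%R )).
    by apply: eq_bigr => l _; rewrite dot_conj.
  apply: eq_bigr => l _; apply: (congr2 ( *%R )) => //.
  apply: etrans (normalizeE (Pi x *m gv x l) (conjmx (err x k)) (g0 l)) _.
  exact: (congr1 (fun z => _ * sqmod z) (dot_conj (err x k) (w l x))).
have Spos : 0 < leaksum k x.
  rewrite lt_neqAle S0 andbT eq_sym; apply: contraTneq FST => ->.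
  by rewrite mul0r -ltNge exprn_gt0.
split => //.
pose t l := if l != k then alpha l x * beta l x * gamma l x * phi x ^+ 2 else 0.
have le1 : s2 * (K%:R - 1) / leaksum k x <= (K%:R - 1)^-1 * \sum_l t l.
  have -> : (K%:R - 1)^-1 * \sum_l t l = s2 * (K%:R - 1) * (T / F ^+ 2).
    rewrite mulr_sumr /T mulr_suml mulr_sumr [RHS]big_mkcond/=.
    apply: eq_bigr => l _; rewrite /t; case: ifP => _; last by rewrite mulr0.
    rewrite /alpha /beta /gamma /phi -/F mul1mx; field.
    rewrite (gt_eqF F0) (gt_eqF (b0 l)) (gt_eqF s20) (gt_eqF n0) (gt_eqF K1).
    by rewrite (gt_eqF v0).
  rewrite ler_wpM2l ?mulr_ge0 ?(ltW s20) ?(ltW K1)//.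
  by rewrite ler_pdivlMr ?exprn_gt0// ler_pdivrMl// mulrC.
have s0 : 0 <= s2 * (K%:R - 1) / leaksum k x.
  by rewrite divr_ge0 ?mulr_ge0 ?(ltW s20) ?(ltW K1).
apply: (@le_trans _ _ (((K%:R - 1)^-1 * \sum_l t l) ^+ 4)).
  by apply: lerXn2r => //; rewrite nnegrE// (le_trans s0).
rewrite exprMn exprVn.
apply: (@le_trans _ _ (((K%:R - 1) ^+ 4)^-1 * (K%:R ^+ 3 * \sum_l t l ^+ 4))).
  rewrite ler_wpM2l ?invr_ge0 ?exprn_ge0 ?(ltW K1)//.
  by have := sum_exp4_le t; rewrite card_ord.
rewrite mulrA [_^-1 * _]mulrC ler_wpM2l// /Z [leRHS]big_mkcond/=.
apply: ler_sum => l _; rewrite /t; case: ifP => _; last by rewrite expr0n.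
rewrite /z; move: (alpha l x) (beta l x) (gamma l x) (phi x) => a b c f.
have -> : (a * b * c * f ^+ 2) ^+ 4 = a ^+ 4 * b ^+ 4 * c ^+ 4 * f ^+ 8 by ring.
by have := prod4_le (a ^+ 4) (b ^+ 4) (c ^+ 4) (f ^+ 8); rewrite -!exprM.
Qed.

End leakage_inverse_moment.

(** * The beamforming gain *)

Section centred_products.
Context {I : finType} {R : realType}.
Variables (v : I -> R) (m : probability (prodR I R) R).
Hypotheses (v0 : forall i, 0 <= v i) (mv : gauss_product v m).

(** Stein's identity with derivative 0. *)
Lemma coord_mul_mean0 c f : polyg f -> (forall x t, f (upd x c t) = f x) ->
  \int[m]_x (x c * f x) = 0.
Proof.
move=> pf fc.
have der (x : I -> R) : is_derive (x c) (1 : R) (fun t : R => f (upd x c t)) (0 : R).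
  have -> : (fun t => f (upd x c t)) = cst (f x) by apply/funext => t /=.
  exact: is_derive_cst.
rewrite (stein v0 mv pf (polyg_cst (0 : R)) der); last by move=> x; exact: cst_continuous.
by rewrite Rintegral_prob_cst mulr0.
Qed.

End centred_products.

Section centred_linear_form.
Context {U : finType} {n : nat} {R : realType}.
Local Notation I := (U * ('I_n * 'I_1 * bool))%type.
Local Notation Re := complex.Re.
Local Notation Im := complex.Im.
Variables (v : U -> R) (m : probability (prodR I R) R).
Hypotheses (v0 : forall u, 0 <= v u) (mv : gauss_product (fun c => v c.1 / 2) m).
Variables (u : U) (s : (I -> R) -> R) (w : (I -> R) -> 'cV[R[i]]_n).
Hypotheses (ps : polyg s) (si : forall x j t, s (upd x (u, j) t) = s x)
  (mw : mxmeas (w : prodR I R -> _)) (w1 : forall x, nrm2 (w x) <= 1)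
  (iw : forall x j t, w (upd x (u, j) t) = w x).

Let v20 (c : I) : 0 <= v c.1 / 2. Proof. by rewrite divr_ge0. Qed.

Let sqw1 i x : sqmod (w x i 0) <= 1.
Proof.
apply: le_trans (w1 x); rewrite nrm2_col (bigD1 i)//= lerDl.
by apply: sumr_ge0 => j _; exact: sqmod_ge0.
Qed.

Let polyg_Re i : polyg (fun x => s x * Re (w x i 0)).
Proof.
apply: polygM => //; apply: (@polyg_bounded _ _ _ 1); first exact: (mw i 0).1.
move=> x; rewrite -(@expr_le1 _ 2)// real_normK ?num_real//.
by apply: le_trans (sqw1 i x); rewrite sqmodE lerDl sqr_ge0.
Qed.

Let polyg_Im i : polyg (fun x => s x * Im (w x i 0)).
Proof.
apply: polygM => //; apply: (@polyg_bounded _ _ _ 1); first exact: (mw i 0).2.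
move=> x; rewrite -(@expr_le1 _ 2)// real_normK ?num_real//.
by apply: le_trans (sqw1 i x); rewrite sqmodE lerDr sqr_ge0.
Qed.

Let expand x : s x * Re (((cvec x u)^T *m w x) 0 0) =
  \sum_i (x (u, (i, 0, false)) * (s x * Re (w x i 0)) -
          x (u, (i, 0, true)) * (s x * Im (w x i 0))).
Proof.
rewrite mxE Re_sum mulr_sumr; apply: eq_bigr => i _.
rewrite ReM !mxE /=; ring.
Qed.

Let term1 i := polygM (polyg_coord (u, (i, 0, false))) (polyg_Re i).
Let term2 i := polygM (polyg_coord (u, (i, 0, true))) (polyg_Im i).

Lemma polyg_linear_form : polyg (fun x => s x * Re (((cvec x u)^T *m w x) 0 0)).
Proof.
have -> : (fun x => s x * Re (((cvec x u)^T *m w x) 0 0)) = (fun x =>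
    \sum_i (x (u, (i, 0, false)) * (s x * Re (w x i 0)) -
            x (u, (i, 0, true)) * (s x * Im (w x i 0)))) by apply/funext.
by apply: polyg_sum => i _; apply: polygB; [exact: term1|exact: term2].
Qed.

Lemma linear_form_mean0 : \int[m]_x (s x * Re (((cvec x u)^T *m w x) 0 0)) = 0.
Proof.
under eq_Rintegral do rewrite expand.
have pi f (pf : polyg f) := polyg_integrable_gauss v0 mv pf.
rewrite Rintegral_sum; last first.
  by move=> i _; apply: pi; apply: polygB; [exact: term1|exact: term2].
rewrite big1// => i _; rewrite RintegralB//; last 2 first.
- exact: pi (term1 i).
- exact: pi (term2 i).
rewrite (coord_mul_mean0 v20 mv (polyg_Re i)); last by move=> x t; rewrite si iw.
rewrite (coord_mul_mean0 v20 mv (polyg_Im i)); last by move=> x t; rewrite si iw.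
exact: subrr.
Qed.

End centred_linear_form.

Section beamforming_gain.
Context {K n : nat} {R : realType}.
Local Notation U := ('I_K + 'I_K)%type.
Local Notation I := (U * ('I_n * 'I_1 * bool))%type.
Local Notation Re := complex.Re.
Local Notation Im := complex.Im.
Variables (s2 : R) (m : probability (prodR I R) R).
Hypotheses (s20 : 0 <= s2) (s21 : s2 < 1) (Kn : (K <= n)%N)
  (mv : gauss_product (fun c => user_var s2 c.1 / 2) m).
Local Notation v := (1 - s2).
Local Notation N := (n - K + 1)%N.
Variable k : 'I_K.

Let v0 : 0 <= v. Proof. by rewrite subr_ge0 ltW. Qed.
Let uv0 (u : U) : 0 <= user_var s2 u := user_var_ge0 s20 s21 u.
Let pi (f : (I -> R) -> R) : polyg f -> m.-integrable setT (EFin \o f).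
Proof. exact: (polyg_integrable_gauss uv0 mv). Qed.

Definition sig (x : I -> R) : R := nrm2 (beamdir (gv x) k).
Definition selfint (x : I -> R) : R := sqmod (leak k x k).
Definition cross (x : I -> R) : R := Num.sqrt (sig x) * Re (leak k x k).
(** The expansion of |sqrt(sig) + leak|^2 ([cgainE]): useful signal, centred cross term, and the
    contribution of the user's own channel error. *)
Definition cgain (x : I -> R) : R := sig x + 2 * cross x + selfint x.

Lemma sig_ge0 x : 0 <= sig x. Proof. exact: nrm2_ge0. Qed.
Lemma selfint_ge0 x : 0 <= selfint x. Proof. exact: sqmod_ge0. Qed.

Let J := finset.setC [set k]%SET.
Let P (x : I -> R) := proj (gv x) J.
Let kJ : k \notin J. Proof. by rewrite !inE eqxx. Qed.
Let mP : mxmeas (P : prodR I R -> _) := mxmeas_pr J.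
Let PH x : (P x)^H = P x. Proof. exact: projH. Qed.
Let PP x : P x *m P x = P x. Proof. exact: proj_idem. Qed.
Let PB x : nrm2 (P x) <= n%:R. Proof. exact: nrm2_proj_le. Qed.
Let iP x j t : P (upd x (inl k, j) t) = P x. Proof. exact: proj_upd_inl. Qed.

Lemma polyg_sig : polyg sig.
Proof. exact: (polyg_projnorm (inl k) mP PH PB). Qed.

Let mw : mxmeas (fun x : prodR I R => beam (gv x) k) := mxmeas_beam k.
Let w1 (x : I -> R) : nrm2 (beam (gv x) k) <= 1 := nrm2_beam_le1 (gv x) k.
Let iw (x : I -> R) j t : beam (gv (upd x (inr k, j) t)) k = beam (gv x) k.
Proof. by rewrite gv_upd_inr. Qed.

Lemma polyg_selfint : polyg selfint.
Proof. exact: (polyg_sqform (inr k) mw w1). Qed.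

Let psqrt : polyg (fun x => Num.sqrt (sig x)).
Proof.
apply: (polyg_le (g := fun x => 1 + sig x)).
- exact: measurable_sqrt_comp polyg_sig.1.
- by apply: polygD; [exact: polyg_cst|exact: polyg_sig].
move=> x; rewrite ger0_norm ?sqrtr_ge0//.
have := sqr_ge0 (Num.sqrt (sig x) - 1).
rewrite sqrrB sqr_sqrtr ?sig_ge0//; have := sqrtr_ge0 (sig x); lra.
Qed.

Let sqrt_upd x j t : Num.sqrt (sig (upd x (inr k, j) t)) = Num.sqrt (sig x).
Proof. by rewrite /sig gv_upd_inr. Qed.

Lemma polyg_cross : polyg cross.
Proof. exact: (polyg_linear_form (inr k) psqrt mw w1). Qed.

Lemma cross_mean : \int[m]_x cross x = 0.
Proof. exact: (linear_form_mean0 uv0 mv psqrt sqrt_upd mw w1 iw). Qed.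

Lemma polyg_cgain : polyg cgain.
Proof.
apply: polygD; last exact: polyg_selfint.
by apply: polygD; [exact: polyg_sig|apply: polygZ; exact: polyg_cross].
Qed.

Lemma sqr_cross_le (x : I -> R) : cross x ^+ 2 <= sig x * selfint x.
Proof.
rewrite exprMn sqr_sqrtr ?sig_ge0// ler_wpM2l ?sig_ge0//.
by rewrite /selfint sqmodE lerDl sqr_ge0.
Qed.

Lemma cgainE x : cgain x = sqmod ((Num.sqrt (sig x))%:C + leak k x k).
Proof.
rewrite sqmodE ReD ImD /= add0r sqrrD sqr_sqrtr ?sig_ge0// /cgain /selfint sqmodE /cross.
ring.
Qed.

Lemma cgain_ge0 x : 0 <= cgain x. Proof. by rewrite cgainE sqmod_ge0. Qed.

Lemma cgain_le x : cgain x <= 2 * (sig x + selfint x).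
Proof.
by rewrite cgainE; apply: le_trans (sqmodD_le _ _) _; rewrite sqmodR sqr_sqrtr ?sig_ge0.
Qed.

Lemma sig_moment_le r : \int[m]_x sig x ^+ r <= (v * (n%:R + r%:R)) ^+ r.
Proof. by apply: (projnorm_moment_le uv0 mv mP PH PP PB iP). Qed.

Lemma selfint_moment_le r : \int[m]_x selfint x ^+ r <= (s2 * (1 + r%:R)) ^+ r.
Proof. exact: (sqform_moment_le uv0 mv mw w1 iw r). Qed.

Hypothesis N2 : (2 <= N)%N.

Let rank_ae : {ae m, forall x, nrm2 (P x) = N%:R}.
Proof.
apply: ae_imp (generic_ae s20 s21 Kn mv N2) => x gx.
rewrite nrm2_proj; last exact: generic_det.
have JK : #|J| = K.-1 by rewrite -[in RHS](card_ord K) -(cardC1 k); apply: eq_card => l; rewrite !inE.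
have K0 : (0 < K)%N by exact: leq_ltn_trans (ltn_ord k).
by rewrite JK -subn1 natrB// natrD natrB//; ring.
Qed.

Let meas_P : measurable_fun setT (fun x : prodR I R => nrm2 (P x)).
Proof. exact: measurable_nrm2. Qed.

Lemma sig_mean : \int[m]_x sig x = N%:R * v.
Proof.
rewrite [LHS](projnorm_mean uv0 mv mP PH PB iP)/= mulrC; congr (_ * _).
by rewrite -[RHS](Rintegral_prob_cst m); apply: eq_Rintegral_ae.
Qed.

(** The second moment of the Gamma law of shape N and scale v; the rank of the projection is N
    almost surely. *)
Lemma sig_sqr : \int[m]_x sig x ^+ 2 = v * (N%:R + 1) * (N%:R * v).
Proof.
rewrite [LHS](projnorm_sqr uv0 mv mP PH PP PB iP)/= -/J -mulrA; congr (_ * _).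
rewrite mulrDl mul1r -sig_mean; congr (_ + _).
rewrite -RintegralZl//; last exact/pi/polyg_sig.
apply: eq_Rintegral_ae.
- by apply: measurable_funM => //; exact: polyg_sig.1.
- exact: (polygZ _ polyg_sig).1.
- by apply: ae_imp rank_ae => x ->.
Qed.

Lemma selfint_mean : \int[m]_x selfint x = s2.
Proof.
rewrite [LHS](sqform_mean uv0 mv mw w1 iw)/= -[RHS]mulr1; congr (_ * _).
rewrite -[RHS](Rintegral_prob_cst m); apply: eq_Rintegral_ae => //.
  exact: measurable_nrm2.
by apply: ae_imp (generic_ae s20 s21 Kn mv N2) => x gx; rewrite nrm2_beam.
Qed.

Lemma cgain_mean : \int[m]_x cgain x = N%:R * v + s2.
Proof.
have i2 : m.-integrable setT (EFin \o (fun x => 2 * cross x)).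
  by apply: pi; apply: polygZ; exact: polyg_cross.
rewrite RintegralD//; last 2 first.
- by apply: pi; apply: polygD; [exact: polyg_sig|apply: polygZ; exact: polyg_cross].
- exact/pi/polyg_selfint.
rewrite RintegralD//; last exact/pi/polyg_sig.
rewrite RintegralZl//; last exact/pi/polyg_cross.
by rewrite cross_mean mulr0 addr0 sig_mean selfint_mean.
Qed.

End beamforming_gain.

(** * Inequalities for the logarithm *)

Section logarithm_bounds.
Context {R : realType}.
Implicit Types (x r : R).

Lemma ln_tangent (u A : R) : 0 < u -> 0 < A -> ln u <= ln A + (u / A - 1).
Proof.
move=> u0 A0; have uA : 0 < u / A by exact: divr_gt0.
rewrite -lerBlDl -ln_div ?posrE//; apply: le_trans (le_ln1Dx _).
  by rewrite addrCA subrr addr0.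
by rewrite ltrBrDl subrr.
Qed.

Lemma ln1D_ge x : 0 <= x -> x - x ^+ 2 <= ln (1 + x).
Proof.
move=> x0; have x1 : 0 < 1 + x by rewrite ltr_wpDr.
have := @ln_tangent 1 _ ltr01 x1; rewrite ln1 => h.
have : x - x ^+ 2 <= 1 - 1 / (1 + x).
  have -> : 1 - 1 / (1 + x) = x / (1 + x) by field; rewrite gt_eqF.
  rewrite ler_pdivlMr// -subr_ge0.
  have -> : x - (x - x ^+ 2) * (1 + x) = x ^+ 3 by ring.
  exact: exprn_ge0.
by move: h; set q := 1 / _; lra.
Qed.

(** Concavity: the tangent at 1 + r x, evaluated at 1 + r and at 1, averaged with weights x and 1 -
    x. *)
Lemma ln1D_scale x r : 0 <= x <= 1 -> 0 <= r -> x * ln (1 + r) <= ln (1 + r * x).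
Proof.
move=> /andP[x0 x1] r0.
have A0 : 0 < 1 + r * x by rewrite ltr_wpDr// mulr_ge0.
have h1 := @ln_tangent (1 + r) _ (ltr_wpDr r0 ltr01) A0.
have h2 := @ln_tangent 1 _ ltr01 A0; rewrite ln1 in h2.
move: h1 h2; set L := ln (1 + r); set M := ln _ => h1 h2.
have {}h1 := ler_wpM2l x0 h1.
have x1' : 0 <= 1 - x by rewrite subr_ge0.
have {}h2 := ler_wpM2l x1' h2.
have E : x * ((1 + r) / (1 + r * x)) + (1 - x) * (1 / (1 + r * x)) = 1.
  by field; rewrite gt_eqF.
move: h1 h2 E; set p := (1 + r) / _; set q := 1 / _ => h1 h2 E; lra.
Qed.

(** For x <= 1 this is [ln1D_scale]; for x > 1 apply it to 1/x and r x. The error stays proportional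
    to ln(1 + r) whether r is small or large. *)
Lemma ln1D_scale_dist x r : 0 <= x -> 0 <= r ->
  `|ln (1 + r * x) - ln (1 + r)| <= `|x - 1| * ln (1 + r).
Proof.
move=> x0 r0; have [x1|x1] := leP x 1.
  have h := @ln1D_scale x r; rewrite x0 x1 in h; have {}h := h isT r0.
  have le : ln (1 + r * x) <= ln (1 + r).
    rewrite ler_ln ?posrE ?lerD2l ?ler_piMr//; first by rewrite ltr_wpDr// mulr_ge0.
    by rewrite ltr_wpDr.
  rewrite !ler0_norm ?subr_le0//; lra.
have x'0 : 0 < x by exact: lt_trans x1.
have r'0 : 0 <= r * x by rewrite mulr_ge0.
have xi : 0 <= x^-1 <= 1 by rewrite invr_ge0 x0 invf_le1 ?(ltW x1).
have := ln1D_scale xi r'0; rewrite mulfK ?gt_eqF// ler_pdivrMl// => h.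
have le : ln (1 + r) <= ln (1 + r * x).
  rewrite ler_ln ?posrE ?lerD2l ?ler_peMr ?(ltW x1)//; first by rewrite ltr_wpDr.
  by rewrite ltr_wpDr.
rewrite !ger0_norm ?subr_ge0 ?(ltW x1)//; lra.
Qed.

Lemma exp4D_le (a b : R) : (a + b) ^+ 4 <= 8 * (a ^+ 4 + b ^+ 4).
Proof.
have h (c d : R) : (c + d) ^+ 2 <= 2 * (c ^+ 2 + d ^+ 2).
  by have := sqr_ge0 (c - d); rewrite sqrrB sqrrD; lra.
have h1 := h a b; have h2 := h (a ^+ 2) (b ^+ 2).
have h3 : ((a + b) ^+ 2) ^+ 2 <= (2 * (a ^+ 2 + b ^+ 2)) ^+ 2.
  by apply: lerXn2r h1; rewrite nnegrE ?sqr_ge0// mulr_ge0// addr_ge0 ?sqr_ge0.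
have e : ((a + b) ^+ 2) ^+ 2 = (a + b) ^+ 4 by rewrite -exprM.
have e1 : (a ^+ 2) ^+ 2 = a ^+ 4 by rewrite -exprM.
have e2 : (b ^+ 2) ^+ 2 = b ^+ 4 by rewrite -exprM.
have e3 : (2 * (a ^+ 2 + b ^+ 2)) ^+ 2 = 4 * (a ^+ 2 + b ^+ 2) ^+ 2 by ring.
rewrite e e3 in h3; rewrite e1 e2 in h2; lra.
Qed.

End logarithm_bounds.

Lemma polyg_norm {I : finType} {R : realType} (f : (I -> R) -> R) :
  polyg f -> polyg (fun x => `|f x|).
Proof.
move=> [mf [C [k fC]]]; split; first exact: measurableT_comp.
by exists C, k => x; rewrite normr_id.
Qed.

(** * Two-sided estimates of the mean rate *)

Section log_sinr.
Context {K n : nat} {R : realType}.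
Local Notation I := (('I_K + 'I_K)%type * ('I_n * 'I_1 * bool))%type.
Variables (k : 'I_K) (p : R).

Definition csinr (x : I -> R) : R := cgain k x / (p^-1 + leaksum k x).

Lemma leaksum_ge0 (x : I -> R) : 0 <= leaksum k x.
Proof. by apply: sumr_ge0 => l _; exact: sqmod_ge0. Qed.

Hypothesis p0 : 0 < p.

Let den_gt0 (x : I -> R) : 0 < p^-1 + leaksum k x.
Proof. by rewrite ltr_wpDr ?leaksum_ge0// invr_gt0. Qed.

Lemma csinr_ge0 x : 0 <= csinr x.
Proof. by rewrite divr_ge0 ?cgain_ge0 ?(ltW (den_gt0 x)). Qed.

Lemma polyg_csinr : polyg csinr.
Proof.
apply: polygM; first exact: polyg_cgain.
apply: (@polyg_bounded _ _ _ p).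
  apply: measurable_funV; apply: measurable_funD => //.
  exact: (polyg_leaksum k).1.
move=> x; rewrite ger0_norm ?invr_ge0 ?(ltW (den_gt0 x))// -[leRHS]invrK.
by rewrite lef_pV2 ?posrE ?invr_gt0// lerDl leaksum_ge0.
Qed.

Lemma ln1D_csinr_le x : ln (1 + csinr x) <= csinr x.
Proof. by apply: le_ln1Dx; rewrite (lt_le_trans _ (csinr_ge0 x))// ltrN10. Qed.

Lemma polyg_log_csinr : polyg (fun x => ln (1 + csinr x)).
Proof.
apply: (polyg_le (g := csinr)); last 2 first.
- exact: polyg_csinr.
- by move=> x; rewrite ger0_norm ?ln1D_csinr_le// ln_ge0// lerDl csinr_ge0.
apply: measurableT_comp; first exact: measurable_ln.
by apply: measurable_funD => //; exact: polyg_csinr.1.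
Qed.

Definition mean_rate (m : probability (prodR I R) R) : R := \int[m]_x ln (1 + csinr x).

End log_sinr.

Section mean_rate_bounds.
Context {K n : nat} {R : realType}.
Local Notation U := ('I_K + 'I_K)%type.
Local Notation I := (U * ('I_n * 'I_1 * bool))%type.
Variables (s2 : R) (m : probability (prodR I R) R).
Hypotheses (s20 : 0 <= s2) (s21 : s2 < 1) (Kn : (K <= n)%N)
  (mv : gauss_product (fun c => user_var s2 c.1 / 2) m).
Local Notation v := (1 - s2).
Local Notation N := (n - K + 1)%N.
Hypotheses (N32 : (32 <= N)%N) (K65 : (65 <= K)%N).
Variables (k : 'I_K) (p rho : R).
Hypotheses (p0 : 0 < p) (nrho : n%:R <= rho * N%:R).

Let v0 : 0 < v. Proof. by rewrite subr_gt0. Qed.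
Let uv0 (u : U) : 0 <= user_var s2 u := user_var_ge0 s20 s21 u.
Let pi (f : (I -> R) -> R) : polyg f -> m.-integrable setT (EFin \o f).
Proof. exact: (polyg_integrable_gauss uv0 mv). Qed.
Let N2 : (2 <= N)%N. Proof. exact: leq_trans N32. Qed.
Let N4 : (4 <= N)%N. Proof. exact: leq_trans N32. Qed.
Let N0 : 0 < N%:R :> R. Proof. by rewrite ltr0n (leq_trans _ N32). Qed.
Let n0 : 0 < n%:R :> R.
Proof. by rewrite ltr0n (leq_trans _ Kn)// (leq_trans _ K65). Qed.
Let K1 : 0 < K%:R - 1 :> R. Proof. by rewrite subr_gt0 ltr1n (leq_trans _ K65). Qed.
Let rho0 : 0 <= rho. Proof. by rewrite -(pmulr_lge0 _ N0) (le_trans _ nrho). Qed.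
Let pV : 0 < p^-1. Proof. by rewrite invr_gt0. Qed.

Let a : R := N%:R * v.
Let a0 : 0 < a. Proof. exact: mulr_gt0. Qed.
Let S0 : R := s2 * (K%:R - 1).
Let S00 : 0 <= S0. Proof. by rewrite mulr_ge0// ltW. Qed.
Let D : R := p^-1 + S0.
Let D0 : 0 < D. Proof. exact: ltr_wpDr. Qed.
Local Notation S := (leaksum k).
Let S_ge0 (x : I -> R) : 0 <= S x. Proof. by apply: sumr_ge0 => l _; exact: sqmod_ge0. Qed.
Let DS0 (x : I -> R) : 0 < p^-1 + S x. Proof. exact: ltr_wpDr. Qed.

Local Notation csinr := (csinr k p).
Local Notation mean_rate := (mean_rate k p m).

(** The SINR is (1 + a)/D times u y ([csinrE]). Normalizing the gain by 1 + a rather than a keeps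
    the moments of [u] bounded even for small a. *)
Let y (x : I -> R) : R := D / (p^-1 + S x).
Let dev (x : I -> R) : R := (S0 - S x) / D.
Let u (x : I -> R) : R := cgain k x / (1 + a).

Let y_ge0 x : 0 <= y x. Proof. by rewrite divr_ge0 ?(ltW D0) ?(ltW (DS0 x)). Qed.

Let y1 x : y x - 1 = dev x * y x.
Proof.
rewrite /y /dev; have -> : S0 - S x = D - (p^-1 + S x) by rewrite /D; ring.
move: (gt_eqF (DS0 x)) (gt_eqF D0); move: (p^-1 + S x) => A; move: D => B A0 B0.
by field; rewrite A0 B0.
Qed.

Let polyg_y : polyg y.
Proof.
apply: (@polyg_bounded _ _ _ (D * p)).
  apply: measurable_funM => //; apply: measurable_funV.
  by apply: measurable_funD => //; exact: (polyg_leaksum k).1.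
move=> x; rewrite ger0_norm// ler_wpM2l ?(ltW D0)// -[leRHS]invrK.
by rewrite lef_pV2 ?posrE// lerDl.
Qed.

Let polyg_dev : polyg dev.
Proof.
have -> : dev = (fun x => D^-1 * (S0 - S x)) by apply/funext => x; rewrite mulrC.
apply: polygZ; apply: polygB; first exact: polyg_cst.
exact: (polyg_leaksum k).
Qed.

Let polyg_u : polyg u.
Proof.
have -> : u = (fun x => (1 + a)^-1 * cgain k x) by apply/funext => x; rewrite mulrC.
by apply: polygZ; exact: polyg_cgain.
Qed.

Let a1 : 0 < 1 + a. Proof. exact: addr_gt0. Qed.

Let u_ge0 x : 0 <= u x. Proof. by rewrite divr_ge0 ?cgain_ge0 ?(ltW a1). Qed.

(** The weight sqrt(q) in the inequality between arithmetic and geometric means is chosen so that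
    the bound is of order sqrt(q), as in Cauchy-Schwarz. *)
Let amgm f h q C : polyg f -> polyg h -> 0 < q ->
  \int[m]_x f x ^+ 2 <= q -> \int[m]_x h x ^+ 2 <= C ->
  \int[m]_x `|f x * h x| <= Num.sqrt q * ((1 + C) / 2).
Proof.
move=> pf ph q0 fq hC; set s := Num.sqrt q.
have s0 : 0 < s by rewrite sqrtr_gt0.
have c1 : 0 <= s^-1 / 2 by rewrite divr_ge0// invr_ge0 (ltW s0).
have c2 : 0 <= s / 2 by rewrite divr_ge0// (ltW s0).
have p1 : polyg (fun x => s^-1 / 2 * f x ^+ 2) by apply: polygZ; exact: polygX.
have p2 : polyg (fun x => s / 2 * h x ^+ 2) by apply: polygZ; exact: polygX.
apply: (@le_trans _ _ (\int[m]_x (s^-1 / 2 * f x ^+ 2 + s / 2 * h x ^+ 2))).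
  apply: le_Rintegral => //.
  - by apply: pi; apply: polyg_norm; exact: polygM.
  - by apply: pi; exact: polygD.
  move=> x _; rewrite normrM.
  have -> : s^-1 / 2 * f x ^+ 2 + s / 2 * h x ^+ 2 =
      s^-1 / 2 * (`|f x| - s * `|h x|) ^+ 2 + `|f x| * `|h x|.
    rewrite -(real_normK (num_real (f x))) -(real_normK (num_real (h x))).
    by field; rewrite gt_eqF.
  by rewrite lerDr mulr_ge0// sqr_ge0.
rewrite RintegralD//; [|exact: pi|exact: pi].
rewrite !RintegralZl//; [|exact/pi/polygX|exact/pi/polygX].
have -> : s * ((1 + C) / 2) = s^-1 / 2 * q + s / 2 * C.
  have -> : q = s ^+ 2 by rewrite sqr_sqrtr// ltW.
  by field; rewrite gt_eqF.
by apply: lerD; [exact: (ler_wpM2l c1 fq)|exact: (ler_wpM2l c2 hC)].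
Qed.

(** The bound of [beam_corr_mean] divided by (K - 1)^2; it is O(1/K) as soon as N is at least of
    order K. *)
Definition dev_cst : R := (K%:R + K%:R ^+ 2 * (13 / 2 / N%:R)) / (K%:R - 1) ^+ 2.

Let dev_cst_gt0 : 0 < dev_cst.
Proof.
have K0 : 0 < K%:R :> R by rewrite ltr0n (leq_trans _ K65).
apply: divr_gt0; last by rewrite exprn_gt0.
by rewrite addr_gt0// !mulr_gt0 ?exprn_gt0// invr_gt0.
Qed.

Let dev_sqr : \int[m]_x dev x ^+ 2 <= dev_cst.
Proof.
have E x : dev x ^+ 2 = D^-1 ^+ 2 * (S x - S0) ^+ 2 by rewrite /dev; ring.
under eq_Rintegral do rewrite E.
rewrite RintegralZl//; last first.
  by apply/pi/polygX/polygB; [exact: (polyg_leaksum k)|exact: polyg_cst].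
rewrite (leaksum_variance s20 s21 Kn mv k N2) mulrA -exprMn.
apply: (@le_trans _ _ ((K%:R - 1)^-1 ^+ 2 * \int[m]_x beam_corr k x)).
  apply: ler_wpM2r.
    apply: Rintegral_ge0 => x _.
    by do 2!(apply: sumr_ge0 => ? _); exact: sqmod_ge0.
  apply: lerXn2r; rewrite ?nnegrE ?mulr_ge0 ?invr_ge0 ?(ltW D0) ?(ltW K1)//.
  by rewrite ler_pdivrMl// ler_pdivlMr// lerDr (ltW pV).
rewrite exprVn mulrC ler_pM2r ?invr_gt0 ?exprn_gt0//.
exact: (beam_corr_mean s20 s21 Kn mv N4 k).
Qed.

Definition ratio_cst : R :=
  8 * (1 + 8 * ((1 + 16) ^+ 16 + (1 + 16) ^+ 16 + (2 * rho) ^+ 16 + 2 ^+ 32)).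

Let y4 : \int[m]_x y x ^+ 4 <= ratio_cst.
Proof.
have c0 : 0 <= 8 * ((1 + 16) ^+ 16 + (1 + 16) ^+ 16 + (2 * rho) ^+ 16 + 2 ^+ 32) :> R.
  by rewrite mulr_ge0// !addr_ge0// exprn_ge0// ?mulr_ge0// ?addr_ge0.
have yi := pi (polygX 4 polyg_y).
(* [leaksum_inverse_moment] needs a positive error variance; without error S0 = 0 and [y] is at most
   1. *)
have [s2z|s2p] := eqVneq s2 0.
  apply: (@le_trans _ _ 1).
    rewrite -[leRHS](Rintegral_prob_cst m); apply: le_Rintegral => //.
      exact/pi/polyg_cst.
    move=> x _; rewrite exprn_ile1// /y /D /S0 s2z mul0r addr0.
    by rewrite ler_pdivrMr// mul1r lerDl.
  by rewrite /ratio_cst; move: c0; set c := 8 * _; lra.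
have s2pos : 0 < s2 by rewrite lt_neqAle eq_sym s2p.
have [Y [iY EY aeY]] := leaksum_inverse_moment s2pos s21 Kn mv N32 K65 k.
have i1 : m.-integrable setT (EFin \o (fun x : prodR I R => 1 + Y x)).
  exact: (integrableD measurableT (pi (polyg_cst 1)) iY).
have i8 : m.-integrable setT (EFin \o (fun x : prodR I R => 8 * (1 + Y x))).
  exact: (integrableZl measurableT 8 i1).
apply: (@le_trans _ _ (\int[m]_x (8 * (1 + Y x)))).
  apply: le_Rintegral_ae => //.
  apply: ae_imp aeY => x [S0x Yx]; apply: (@le_trans _ _ ((1 + S0 / S x) ^+ 4)).
    apply: lerXn2r; rewrite ?nnegrE ?y_ge0//; first exact: addr_ge0 ler01 (divr_ge0 S00 (ltW S0x)).
    rewrite /y /D mulrDl; apply: lerD; first by rewrite ler_pdivrMr// mul1r lerDl.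
    by rewrite ler_wpM2l// lef_pV2 ?posrE// lerDr (ltW pV).
  by apply: le_trans (exp4D_le _ _) _; rewrite expr1n ler_pM2l// lerD2l.
rewrite RintegralZl// RintegralD//; last exact/pi/polyg_cst.
rewrite Rintegral_prob_cst /ratio_cst ler_pM2l// lerD2l.
apply: le_trans EY _; rewrite /inverse_moment_cst ler_pM2l// lerD2r lerD2l.
apply: lerXn2r; rewrite ?nnegrE ?divr_ge0 ?mulr_ge0//.
by rewrite -mulrA ler_pM2l// ler_pdivrMr.
Qed.

Let y2 : \int[m]_x y x ^+ 2 <= 1 + ratio_cst.
Proof.
apply: (@le_trans _ _ (\int[m]_x (1 + y x ^+ 4))).
  apply: le_Rintegral => //.
  - exact/pi/polygX.
  - by apply: pi; apply: polygD; [exact: polyg_cst|exact: polygX].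
  move=> x _; have := sqr_ge0 (y x ^+ 2 - 1); rewrite sqrrB -exprM.
  by have := sqr_ge0 (y x); lra.
rewrite RintegralD//; [|exact/pi/polyg_cst|exact/pi/polygX].
by rewrite Rintegral_prob_cst lerD2l.
Qed.

(** 128 is 2^4 from [cgain_le] times 8 from [exp4D_le]. The first 5 comes from v (n + 4) <= 5 v n,
    the second from 1 + 4. *)
Definition gain_cst : R := 128 * ((5 * rho) ^+ 4 + 5 ^+ 4).

Let u4 : \int[m]_x u x ^+ 4 <= gain_cst.
Proof.
have ps := polygX 4 (polyg_sig k); have pt := polygX 4 (polyg_selfint k).
have c0 : 0 <= (1 + a)^-1 ^+ 4 * 128 by rewrite mulr_ge0// exprn_ge0// invr_ge0 ltW.
apply: (@le_trans _ _ (\int[m]_x ((1 + a)^-1 ^+ 4 * 128 * (sig k x ^+ 4 + selfint k x ^+ 4)))).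
  apply: le_Rintegral => //.
  - exact/pi/polygX.
  - by apply: pi; apply: polygZ; exact: polygD.
  move=> x _; rewrite /u exprMn mulrC -mulrA ler_wpM2l ?exprn_ge0 ?invr_ge0 ?(ltW a1)//.
  apply: (@le_trans _ _ ((2 * (sig k x + selfint k x)) ^+ 4)).
    apply: lerXn2r (cgain_le _ _); rewrite nnegrE ?cgain_ge0// mulr_ge0// addr_ge0//.
      exact: sig_ge0.
    exact: selfint_ge0.
  rewrite exprMn; have := exp4D_le (sig k x) (selfint k x).
  by move: (_ + _ : R) => A; lra.
rewrite RintegralZl//; last by apply: pi; exact: polygD.
rewrite RintegralD//; [|exact: pi|exact: pi].
apply: (@le_trans _ _ ((1 + a)^-1 ^+ 4 * 128 * ((5 * rho * (1 + a)) ^+ 4 + (5 * (1 + a)) ^+ 4))).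
  apply: ler_wpM2l => //; apply: lerD.
    apply: le_trans (sig_moment_le s20 s21 mv k 4) _.
    apply: lerXn2r; rewrite ?nnegrE ?mulr_ge0 ?(ltW v0) ?(ltW a1)//.
    have h : v * n%:R <= rho * a.
      by rewrite mulrC /a mulrA ler_wpM2r ?(ltW v0).
    have h4 : v * 4%:R <= 4 * (v * n%:R).
      rewrite mulrCA ler_wpM2l ?(ltW v0)// ler_peMr// ler1n.
      by rewrite -(ltr0n R).
    rewrite mulrDr mulrDr mulr1; have := mulr_ge0 (ler0n R 5) rho0; lra.
  apply: le_trans (selfint_moment_le s20 s21 mv k 4) _.
  have h : s2 * (1 + 4%:R) <= 5 * (1 + a).
    have -> : 1 + 4%:R = 5 :> R by ring.
    rewrite mulrC ler_pM2l//; apply: le_trans (ltW s21) _; by rewrite lerDl (ltW a0).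
  by apply: lerXn2r h; rewrite nnegrE mulr_ge0 ?(ltW a1).
rewrite le_eqVlt; apply/orP; left; apply/eqP; rewrite /gain_cst; field.
by rewrite gt_eqF.
Qed.

(** Inserting the exact first two moments of [sig] cancels the terms in a^2, so the deviation is of
    order a only. *)
Let gain_sqr_dev : \int[m]_x (cgain k x - a) ^+ 2 <= 63 * a + 33.
Proof.
have pb : polyg (fun x : I -> R => sig k x) := polyg_sig k.
have pt : polyg (fun x : I -> R => selfint k x) := polyg_selfint k.
have p1 : polyg (fun x : I -> R => (3 + 6 / a) * sig k x ^+ 2) by apply: polygZ; exact: polygX.
have p2 : polyg (fun x : I -> R => (- (6 * a)) * sig k x) by exact: polygZ.
have p3 : polyg (fun x : I -> R => (6 * a + 3) * selfint k x ^+ 2) by apply: polygZ; exact: polygX.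
apply: (@le_trans _ _ (\int[m]_x ((3 + 6 / a) * sig k x ^+ 2 + (- (6 * a)) * sig k x +
    3 * a ^+ 2 + (6 * a + 3) * selfint k x ^+ 2))).
  apply: le_Rintegral => //.
  - by apply/pi/polygX/polygB; [exact: polyg_cgain|exact: polyg_cst].
  - apply/pi/polygD => //; apply: polygD; last exact: polyg_cst.
    exact: polygD.
  move=> x _; rewrite /cgain; have := sqr_cross_le k x.
  move: (sig k x) (cross k x) (selfint k x) => b c s cb.
  (* Young's inequality with weight a bounds 12 c^2 <= 12 b s by squares of b and s, so no joint
     moment of [sig] and [selfint] is needed. *)
  have h : 0 <= 6 / a * (b - a * s) ^+ 2 by rewrite mulr_ge0 ?sqr_ge0 ?divr_ge0 ?(ltW a0).
  have e : 6 / a * (b - a * s) ^+ 2 = 6 / a * b ^+ 2 - 12 * (b * s) + 6 * a * s ^+ 2.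
    by field; rewrite gt_eqF.
  rewrite e in h.
  have h1 := sqr_ge0 (b - a - 2 * c); have h2 := sqr_ge0 (b - a - s).
  have h3 := sqr_ge0 (2 * c - s).
  move: h; set t := 6 / a * b ^+ 2 => h.
  have -> : (3 + 6 / a) * b ^+ 2 = 3 * b ^+ 2 + t by rewrite mulrDl.
  have : (b + 2 * c + s - a) ^+ 2 <= 3 * ((b - a) ^+ 2 + 4 * c ^+ 2 + s ^+ 2).
    rewrite -subr_ge0.
    have -> : 3 * ((b - a) ^+ 2 + 4 * c ^+ 2 + s ^+ 2) - (b + 2 * c + s - a) ^+ 2 =
      (b - a - 2 * c) ^+ 2 + (b - a - s) ^+ 2 + (2 * c - s) ^+ 2 by ring.
    by rewrite !addr_ge0.
  move/le_trans; apply.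
  have -> : 3 * ((b - a) ^+ 2 + 4 * c ^+ 2 + s ^+ 2) =
    3 * b ^+ 2 - 6 * a * b + 3 * a ^+ 2 + 12 * c ^+ 2 + 3 * s ^+ 2 by ring.
  have -> : (6 * a + 3) * s ^+ 2 = 6 * a * s ^+ 2 + 3 * s ^+ 2 by ring.
  rewrite mulNr; lra.
rewrite RintegralD//; last 2 first.
- by apply/pi/polygD; [exact: polygD|exact: polyg_cst].
- exact: pi.
rewrite RintegralD//; [|exact/pi/polygD|exact/pi/polyg_cst].
rewrite RintegralD//; [|exact: pi|exact: pi].
have E1 : \int[m]_x ((3 + 6 / a) * sig k x ^+ 2) = (3 + 6 / a) * \int[m]_x sig k x ^+ 2.
  exact: (RintegralZl _ measurableT (pi (polygX 2 pb))).
have E2 : \int[m]_x (- (6 * a) * sig k x) = - (6 * a) * \int[m]_x sig k x.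
  exact: (RintegralZl _ measurableT (pi pb)).
have E3 : \int[m]_x ((6 * a + 3) * selfint k x ^+ 2) = (6 * a + 3) * \int[m]_x selfint k x ^+ 2.
  exact: (RintegralZl _ measurableT (pi (polygX 2 pt))).
rewrite E1 E2 E3 Rintegral_prob_cst (sig_mean s20 s21 Kn mv k N2) (sig_sqr s20 s21 Kn mv k N2) -/a.
have -> : v * (N%:R + 1) * a = (a + v) * a by rewrite /a; ring.
have t9 : \int[m]_x selfint k x ^+ 2 <= 9.
  apply: le_trans (selfint_moment_le s20 s21 mv k 2) _.
  have -> : 9 = (1 * (1 + 2%:R)) ^+ 2 :> R by ring.
  apply: lerXn2r; rewrite ?nnegrE ?mulr_ge0//.
  by rewrite ler_wpM2r// ltW.
have c0 : 0 <= 6 * a + 3 by rewrite addr_ge0// mulr_ge0// ltW.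
have := ler_wpM2l c0 t9; set s := (6 * a + 3) * _ => st.
have -> : (3 + 6 / a) * ((a + v) * a) = 3 * (a + v) * a + 6 * (a + v).
  by field; rewrite gt_eqF.
have va : v * a <= a by rewrite ler_piMl ?(ltW a0)// gerBl.
have -> : 3 * (a + v) * a = 3 * a ^+ 2 + 3 * (v * a) by ring.
have -> : - (6 * a) * a = - (6 * a ^+ 2) by ring.
move: st va; move: (v * a) => va; move: s => s st h.
have : v <= 1 by rewrite gerBl.
lra.
Qed.

Let W := (gain_cst + ratio_cst) / 2.

Let uy2 : \int[m]_x (u x * y x) ^+ 2 <= W.
Proof.
have pu := polygX 4 polyg_u; have py := polygX 4 polyg_y.
apply: (@le_trans _ _ (\int[m]_x (2^-1 * (u x ^+ 4 + y x ^+ 4)))).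
  apply: le_Rintegral => //.
  - exact/pi/polygX/polygM.
  - by apply/pi/polygZ/polygD.
  move=> x _; move: (u x) (y x) => r s.
  have -> : 2^-1 * (r ^+ 4 + s ^+ 4) = 2^-1 * (r ^+ 2 - s ^+ 2) ^+ 2 + (r * s) ^+ 2 by field.
  by rewrite lerDr mulr_ge0// sqr_ge0.
rewrite RintegralZl//; last exact/pi/polygD.
rewrite RintegralD//; [|exact: pi|exact: pi].
by rewrite /W mulrC ler_pM2r ?invr_gt0//; exact: lerD u4 y4.
Qed.

Let csinrE (x : I -> R) : csinr x = (1 + a) / D * (u x * y x).
Proof.
rewrite /csinr /u /y; move: (gt_eqF (DS0 x)) (gt_eqF D0) (gt_eqF a1).
move: (p^-1 + S x) => A; move: D => B A0 B0 C0.
by field; rewrite C0 A0 B0.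
Qed.

(** The exact identity u y - u = dev (u y) reduces the mean to that of [u], up to an error
    controlled by [amgm]. *)
Let uy_mean : `|\int[m]_x (u x * y x) - (a + s2) / (1 + a)| <=
  Num.sqrt dev_cst * ((1 + W) / 2).
Proof.
have puy := polygM polyg_u polyg_y.
have <- : \int[m]_x u x = (a + s2) / (1 + a).
  rewrite /u; under eq_Rintegral do rewrite mulrC.
  rewrite RintegralZl//; last exact/pi/polyg_cgain.
  by rewrite (cgain_mean s20 s21 Kn mv k N2) mulrC.
rewrite -RintegralB//; [|exact: pi|exact: pi].
have E x : u x * y x - u x = dev x * (u x * y x).
  have := y1 x; move: (u x) (y x) (dev x) => r s t h.
  by rewrite (mulrCA t) -h; ring.
under eq_Rintegral do rewrite E.
have pd := polygM polyg_dev puy.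
apply: le_trans (le_normr_Rintegral measurableT (pi pd)) _.
exact: amgm polyg_dev puy dev_cst_gt0 dev_sqr uy2.
Qed.

(** From x - x^2 <= ln(1 + x) <= x at the SINR. Sharp when (1 + a)/D is small. *)
Lemma mean_rate_weak :
  (1 + a) / D * ((a + s2) / (1 + a) - Num.sqrt dev_cst * ((1 + W) / 2) - (1 + a) / D * W)
    <= mean_rate <= (1 + a) / D * ((a + s2) / (1 + a) + Num.sqrt dev_cst * ((1 + W) / 2)).
Proof.
have puy := polygM polyg_u polyg_y.
have pX := polyg_csinr (n := n) k p0; have pl := polyg_log_csinr (n := n) k p0.
have r0 : 0 <= (1 + a) / D by rewrite divr_ge0 ?(ltW a1) ?(ltW D0).
have mX : \int[m]_x csinr x = (1 + a) / D * \int[m]_x (u x * y x).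
  under eq_Rintegral do rewrite csinrE.
  by rewrite RintegralZl//; exact: pi.
have mX2 : \int[m]_x csinr x ^+ 2 = ((1 + a) / D) ^+ 2 * \int[m]_x (u x * y x) ^+ 2.
  have E x : csinr x ^+ 2 = ((1 + a) / D) ^+ 2 * (u x * y x) ^+ 2 by rewrite csinrE exprMn.
  under eq_Rintegral do rewrite E.
  by rewrite RintegralZl//; exact/pi/polygX.
have := uy_mean; rewrite ler_norml; set e := Num.sqrt _ * _; set M := \int[m]_x (_ * _).
set c := (a + s2) / _ => /andP[h1 h2]; apply/andP; split.
  apply: (@le_trans _ _ (\int[m]_x (csinr x - csinr x ^+ 2))).
    rewrite RintegralB//; [|exact: pi|exact/pi/polygX].
    rewrite mX mX2 -/M; have := ler_wpM2l r0 uy2.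
    move: (\int[m]_x (u x * y x) ^+ 2) r0 => B; move: ((1 + a) / D) => r r0 BW.
    have -> : r * M - r ^+ 2 * B = r * (M - r * B) by ring.
    by rewrite ler_wpM2l//; lra.
  apply: le_Rintegral => //.
  - by apply/pi/polygB => //; exact: polygX.
  - exact: pi.
  - by move=> x _; apply: ln1D_ge; exact: csinr_ge0.
apply: (@le_trans _ _ (\int[m]_x csinr x)).
  apply: le_Rintegral => //; [exact: pi|exact: pi|].
  by move=> x _; exact: ln1D_csinr_le.
by rewrite mX -/M ler_wpM2l// -lerBlDl.
Qed.

(** The SINR is a/D times (1 + g) y, with g the relative deviation of the gain, and (1 + g) y - 1 =
    g y + dev y; [ln1D_scale_dist] and [amgm] do the rest. Sharp when a is large. *)
Lemma mean_rate_strong :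
  `|mean_rate - ln (1 + a / D)| <= ln (1 + a / D) *
    ((Num.sqrt ((63 * a + 33) / a ^+ 2) + Num.sqrt dev_cst) * ((1 + (1 + ratio_cst)) / 2)).
Proof.
set L := ln (1 + a / D).
have r0 : 0 <= a / D by rewrite divr_ge0 ?(ltW a0) ?(ltW D0).
have L0 : 0 <= L by rewrite ln_ge0// lerDl.
pose g (x : I -> R) := (cgain k x - a) / a.
have pg : polyg g.
  have -> : g = (fun x => a^-1 * (cgain k x - a)) by apply/funext => x; rewrite mulrC.
  by apply: polygZ; apply: polygB; [exact: polyg_cgain|exact: polyg_cst].
have g2 : \int[m]_x g x ^+ 2 <= (63 * a + 33) / a ^+ 2.
  have E x : g x ^+ 2 = a^-1 ^+ 2 * (cgain k x - a) ^+ 2 by rewrite mulrC exprMn.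
  under eq_Rintegral do rewrite E.
  rewrite RintegralZl//; last by apply/pi/polygX/polygB; [exact: polyg_cgain|exact: polyg_cst].
  by rewrite exprVn mulrC ler_pM2r ?gain_sqr_dev// invr_gt0 exprn_gt0.
have q0 : 0 < (63 * a + 33) / a ^+ 2.
  by rewrite divr_gt0 ?exprn_gt0// addr_gt0// mulr_gt0.
have pgy := polygM pg polyg_y; have pdy := polygM polyg_dev polyg_y.
have b1 := amgm pg polyg_y q0 g2 y2.
have b2 := amgm polyg_dev polyg_y dev_cst_gt0 dev_sqr y2.
have pn1 := polyg_norm pgy; have pn2 := polyg_norm pdy.
have pl := polyg_log_csinr (n := n) k p0.
have -> : mean_rate - L = \int[m]_x (ln (1 + csinr x) - L).
  by rewrite RintegralB// ?Rintegral_prob_cst//; [exact: pi|exact/pi/polyg_cst].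
have pr : polyg (fun x : I -> R => ln (1 + csinr x) - L) by apply: polygB => //; exact: polyg_cst.
apply: le_trans (le_normr_Rintegral measurableT (pi pr)) _.
apply: (@le_trans _ _ (\int[m]_x (L * (`|g x * y x| + `|dev x * y x|)))).
  apply: le_Rintegral => //.
  - exact/pi/polyg_norm.
  - exact/pi/polygZ/polygD.
  move=> x _.
  have XE : csinr x = a / D * ((1 + g x) * y x).
    rewrite /csinr /g /y; move: (gt_eqF (DS0 x)) (gt_eqF D0) (gt_eqF a0).
    move: (p^-1 + S x) => A; move: D => B; move: a => b A0 B0 C0.
    by field; rewrite C0 A0 B0.
  have z0 : 0 <= (1 + g x) * y x.
    have -> : 1 + g x = cgain k x / a by rewrite /g; field; rewrite gt_eqF.
    by rewrite mulr_ge0// divr_ge0 ?cgain_ge0 ?(ltW a0).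
  rewrite XE; apply: le_trans (ln1D_scale_dist z0 r0) _; rewrite mulrC ler_wpM2l//.
  have -> : (1 + g x) * y x - 1 = g x * y x + dev x * y x by rewrite -y1; ring.
  exact: ler_normD.
rewrite RintegralZl//; last exact/pi/polygD.
rewrite ler_wpM2l// RintegralD//; [|exact: pi|exact: pi].
by rewrite mulrDl; exact: lerD.
Qed.

End mean_rate_bounds.

(** * From the channel model to the Gaussian vector *)

Lemma span_closed (F : fieldType) (vT : vectType F) (X : seq vT) (Q : vT -> Prop) :
  Q 0 -> (forall a u v, Q u -> Q v -> Q (a *: u + v)) -> (forall x, x \in X -> Q x) ->
  forall u, u \in <<X>>%VS -> Q u.
Proof.
move=> Q0 QD QX u uX; rewrite (coord_span (X := in_tuple X) uX).
elim/big_ind : _ => //.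
  by move=> x y Qx Qy; have := QD 1 x y Qx Qy; rewrite scale1r.
move=> i _; have := QD (coord (in_tuple X) i u) (in_tuple X)`_i 0.
by rewrite addr0; apply => //; apply: QX; exact: mem_nth.
Qed.

Section orthonormal_basis_projection.
Context {R : realType} {n K q : nat}.
Variables (g : 'I_K -> 'cV[R[i]]_n) (k : 'I_K) (V : 'M[R[i]]_(n, q)).
Hypotheses (dJ : \det (gram g (finset.setC [set k]%SET)) != 0)
  (onb : onb_orthocomplement V <<[seq g l | l : 'I_K in predC1 k]>>%VS).
Local Notation J := (finset.setC [set k]%SET).

Let VV : V^H *m V = 1%:M. Proof. by case: onb. Qed.

Let mem_col (u : 'cV[R[i]]_n) : u \in <<[seq col j V | j : 'I_q]>>%VS ->
  exists c, u = V *m c.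
Proof.
apply: (@span_closed _ _ _ (fun u => exists c, u = V *m c)).
- by exists 0; rewrite mulmx0.
- by move=> a _ _ [c ->] [c' ->]; exists (a *: c + c'); rewrite mulmxDr scalemxAr.
- by move=> _ /mapP[j _ ->]; exists (delta_mx j 0); rewrite colE.
Qed.

Let col_mem j : col j V \in <<[seq col j V | j : 'I_q]>>%VS.
Proof. by apply: memv_span; apply/mapP; exists j => //; rewrite mem_enum. Qed.

Let gen_mem l : l != k -> g l \in <<[seq g l | l : 'I_K in predC1 k]>>%VS.
Proof. by move=> lk; apply: memv_span; apply/mapP; exists l => //; rewrite mem_enum. Qed.

Let orthP (u : 'cV[R[i]]_n) : (forall l, l != k -> dot (g l) u = 0) ->
  orthogonal_to <<[seq g l | l : 'I_K in predC1 k]>>%VS u.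
Proof.
move=> h; apply: (@span_closed _ _ _ (fun w => w^H *m u = 0)).
- by rewrite trmx0 map_mx0 mul0mx.
- move=> a w w' wu w'u; rewrite linearP/= map_mxD map_mxZ mulmxDl -scalemxAl wu w'u.
  by rewrite scaler0 addr0.
- move=> w /mapP[l lk ->]; rewrite mem_enum in lk; apply/matrixP => i j.
  by rewrite !ord1 [RHS]mxE; exact: h.
Qed.

(** Call A and B the two sides. A kills every [g l] with [l != k], so A B = A; the columns of B are
    orthogonal to these vectors, hence lie in the span of the columns of [V], which A fixes, so A B
    = B. *)
Lemma onb_proj : V *m V^H = proj g J.
Proof.
set A := V *m V^H; set B := proj g J.
have Ag l : l != k -> A *m g l = 0.
  move=> lk; rewrite -mulmxA (_ : V^H *m g l = 0) ?mulmx0//.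
  apply/matrixP => j i; rewrite (ord1 i) [RHS]mxE.
  have [_ /(_ (col j V))[h _]] := onb.
  have /matrixP/(_ 0 0) := h (col_mem j) _ (gen_mem lk).
  rewrite [RHS]mxE => e; have : dot (g l) (col j V) = 0 by [].
  move/dot0_sym; rewrite /dot => <-; rewrite !mxE; apply: eq_bigr => s _.
  by rewrite !mxE.
have AM : A *m maskmx g J = 0.
  apply/matrixP => i l; rewrite [RHS]mxE.
  have [lJ|lJ] := boolP (l \in J); last first.
    by rewrite mxE big1// => s _; rewrite [maskmx _ _ _ _]mxE (negbTE lJ) mulr0.
  have lk : l != k by move: lJ; rewrite !inE.
  have /matrixP/(_ i 0) := Ag l lk; rewrite [in X in _ = X -> _]mxE => <-.
  by rewrite !mxE; apply: eq_bigr => s _; rewrite [maskmx _ _ _ _]mxE lJ.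
have AB : A *m B = A.
  have -> : B = 1%:M - (1%:M - B) by rewrite opprB addrC subrK.
  by rewrite mulmxBr mulmx1 proj_range (mulmxA A) AM mul0mx subr0.
have AB' : A *m B = B.
  apply/matrixP => i j.
  have [c cE] : exists c, col j B = V *m c.
    apply: mem_col; have [_ /(_ (col j B))[_ h]] := onb; apply: h.
    apply: orthP => l lk; have lJ : l \in J by rewrite !inE.
    have := proj_vec dJ lJ; rewrite -/B => Bl.
    have -> : col j B = B *m delta_mx j 0 by rewrite colE.
    by rewrite -[B]projH -dot_mull Bl dot0l.
  have : A *m col j B = col j B by rewrite cE mulmxA -[A *m V]mulmxA VV mulmx1.
  rewrite colE (mulmxA A) -!colE => /matrixP/(_ i 0).
  by rewrite [LHS]mxE [RHS]mxE.
by rewrite -AB AB'.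
Qed.

End orthonormal_basis_projection.

Section model_law.
Context {d : measure_display} {T : measurableType d} {R : realType} {K n : nat}.
Variables (Hhat Htilde : 'I_K -> T -> 'cV[R[i]]_n).
Variable (V : 'I_K -> T -> 'M[R[i]]_(n, n - K + 1)).
Variables (P : probability T R) (s2 : R).
Hypothesis model : zf_model Hhat Htilde V P s2.
Local Notation U := ('I_K + 'I_K)%type.
Local Notation I := (U * ('I_n * 'I_1 * bool))%type.

Definition user_channel (u : U) : T -> 'cV[R[i]]_n :=
  match u with inl k => Hhat k | inr k => Htilde k end.

Definition model_point (w : T) : I -> R := fun c => real_comp (user_channel c.1) c.2 w.

Let CN_user u : CN0 P (user_var s2 u) (user_channel u).
Proof. by case: u => k; [exact: (zf_Hhat model)|exact: (zf_Htilde model)]. Qed.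

Lemma measurable_model_point : measurable_fun setT (model_point : T -> prodR I R).
Proof.
apply: measurable_prodR => -[u c]; rewrite /model_point /=.
by have [m _ _] := CN_user u; exact: m.
Qed.

Let event (B : I -> set R) u : set T :=
  \bigcap_(c in [set: 'I_n * 'I_1 * bool]) (real_comp (user_channel u) c @^-1` B (u, c)).

(** Two layers of independence multiply: between the vectors of the model ([zf_indep]), then between
    the real components of each vector ([CN0]). *)
Lemma model_law B : (forall c, measurable (B c)) ->
  P (model_point @^-1` rectangle B) =
  (\prod_c gauss_prob (user_var s2 c.1 / 2) (B c))%E.
Proof.
move=> mB.
have -> : model_point @^-1` rectangle B =
    \bigcap_(u in [set` finset.setTfor U]) event B u.
  apply/seteqP; split => w /= h.
    by move=> u _ c _; exact: h.
  by move=> [u c]; apply: (h u) => //=; rewrite inE.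
have indep u : (match u with
       | inl k => sigma_mx (Hhat k)
       | inr k => sigma_mx (Htilde k)
     end) (event B u).
  have -> : (match u with
       | inl k => sigma_mx (Hhat k)
       | inr k => sigma_mx (Htilde k)
     end) = sigma_mx (user_channel u) by case: u.
  rewrite /sigma_mx; set G := \bigcup_(c in _) _.
  apply: (@fin_bigcap_measurable _ (g_sigma_algebraType G)) => // c _.
  apply: sub_sigma_algebra; exists c => //; exists (B (u, c)) => //.
  by rewrite setTI.
rewrite (zf_indep model); last by move=> u _; exact: indep.
rewrite (eq_bigl predT); last by move=> u; rewrite inE.
transitivity (\prod_u \prod_c gauss_prob (user_var s2 u / 2) (B (u, c)))%E; last first.
  by rewrite pair_bigA; apply: eq_bigr => -[].
apply: eq_bigr => u _; have [mu iu lu] := CN_user u.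
have -> : event B u =
    \bigcap_(c in [set` finset.setTfor ('I_n * 'I_1 * bool)%type])
      (real_comp (user_channel u) c @^-1` B (u, c)).
  by apply/seteqP; split => w /= h c _; apply: h => //=; rewrite inE.
rewrite iu; last by move=> c _; exists (B (u, c)) => //; rewrite setTI.
rewrite (eq_bigl predT); last by move=> c; rewrite inE.
by apply: eq_bigr => c _; rewrite lu// gauss_probE.
Qed.

Let X : T -> prodR I R := model_point.

Let Xp : {mfun T >-> prodR I R} :=
  HB.pack X (isMeasurableFun.Build _ _ _ _ X measurable_model_point).

Lemma model_law_exists : exists m : probability (prodR I R) R,
  gauss_product (fun c => user_var s2 c.1 / 2) m.
Proof. by exists (distribution P Xp) => B mB; exact: model_law. Qed.

End model_law.

(** Unlike [dot_beam], this does not assume [generic]: both sides are 0 when [beamdir] vanishes. The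
    rate is thereby identified even for N = 1. *)
Lemma dot_beam_sqrt {R : realType} {n K : nat} (g : 'I_K -> 'cV[R[i]]_n) l :
  dot (g l) (beam g l) = (Num.sqrt (nrm2 (beamdir g l)))%:C.
Proof.
have e : dot (g l) (beamdir g l) = (nrm2 (beamdir g l))%:C.
  rewrite -dot_nrm2 {2}/beamdir dot_projl /beamdir mulmxA proj_idem.
  by [].
rewrite dotZr e -rmorphM; congr (_%:C).
have [->|b0] := eqVneq (nrm2 (beamdir g l)) 0; first by rewrite mulr0 sqrtr0.
rewrite -{2}(sqr_sqrtr (nrm2_ge0 (beamdir g l))) expr2 mulKf//.
by rewrite sqrtr_eq0 -ltNge lt_neqAle eq_sym b0 nrm2_ge0.
Qed.

Lemma ae_law (I : finType) (R : realType) d (T : measurableType d)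
    (P : probability T R) (X : T -> prodR I R) (m : probability (prodR I R) R)
    (Q : prodR I R -> Prop) : measurable_fun setT X ->
  (forall B : I -> set R, (forall i, measurable (B i)) ->
    P (X @^-1` rectangle B) = m (rectangle B)) ->
  {ae m, forall x, Q x} -> {ae P, forall w, Q (X w)}.
Proof.
move=> mX Xm [A [mA A0 QA]]; exists (X @^-1` A); split.
- by rewrite -[X in measurable X]setTI; exact: mX.
- by rewrite (law_measure mX Xm mA).
- by move=> w /= nQ; exact: QA.
Qed.

Section linear_independence_ae.
Context {K n : nat} {R : realType}.
Local Notation U := ('I_K + 'I_K)%type.
Local Notation I := (U * ('I_n * 'I_1 * bool))%type.
Variables (s2 : R) (m : probability (prodR I R) R).
Hypotheses (s20 : 0 <= s2) (s21 : s2 < 1) (Kn : (K <= n)%N)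
  (mv : gauss_product (fun c => user_var s2 c.1 / 2) m).
Local Notation N := (n - K + 1)%N.

(** Add the vectors one at a time: with at most K - 2 present the projection has rank at least N + 1
    >= 2, enough for a first inverse moment. Hence N = 1 is covered, unlike in [generic_ae]. *)
Lemma det_gram_ae (J : {set 'I_K}) : (#|J| < K)%N ->
  {ae m, forall x, \det (gram (gv x) J) != 0}.
Proof.
move: {2}#|J| (erefl #|J|) => c; elim: c J => [|c IH] J Jc cK.
  have /finset.cards0_eq -> : #|J| = 0 by [].
  by apply: aeW => x; exact: det_gram0.
have [l lJ] : exists l, l \in J by apply/card_gt0P; rewrite Jc.
set J' := (J :\ l)%SET.
have lJ' : l \notin J' by rewrite finset.setD11.
have J'c : #|J'| = c by move: Jc; rewrite (finset.cardsD1 l) lJ => -[].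
have vu : 0 < user_var s2 (inl l) by rewrite subr_gt0.
have PN (x : I -> R) : N.+1%:R <= nrm2 (proj (gv x) J').
  apply: le_trans (nrm2_proj_ge _ J').
  rewrite lerBrDr -natrD ler_nat J'c.
  have -> : (N.+1 + c = n - K + c.+2)%N by rewrite addn1 !addSn !addnS.
  by rewrite -[X in (_ <= X)%N](subnK Kn) leq_add2l -Jc.
have N2 : (1 < N.+1)%N by rewrite addn1.
have h := @projnorm_gt0_ae U n R _ m (user_var_ge0 s20 s21) mv (inl l)
  (fun x => proj (gv x) J') n%:R (mxmeas_pr J') (fun x => projH _ _)
  (fun x => proj_idem _ _) (fun x => nrm2_pr_le x J')
  (fun x j t => proj_upd_inl x j t lJ') N.+1 vu PN N2.
have h' : {ae m, forall x, \det (gram (gv x) J') != 0}.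
  by apply: IH => //; rewrite J'c (leq_trans _ cK)// Jc.
apply: ae_imp2 h h' => x x0 dx; rewrite -(finset.setD1K lJ).
by apply: det_gram_add => //; rewrite gt_eqF.
Qed.

End linear_independence_ae.

Section transport.
Context {d : measure_display} {T : measurableType d} {R : realType} {K n : nat}.
Variables (Hhat Htilde : 'I_K -> T -> 'cV[R[i]]_n).
Variable (V : 'I_K -> T -> 'M[R[i]]_(n, n - K + 1)).
Variables (P : probability T R) (s2 p : R).
Hypotheses (s20 : 0 <= s2) (s21 : s2 < 1) (Kn : (K <= n)%N) (p0 : 0 < p).
Hypothesis model : zf_model Hhat Htilde V P s2.
Local Notation U := ('I_K + 'I_K)%type.
Local Notation I := (U * ('I_n * 'I_1 * bool))%type.
Variable m : probability (prodR I R) R.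
Hypothesis mv : gauss_product (fun c => user_var s2 c.1 / 2) m.

Let X : T -> prodR I R := model_point Hhat Htilde.
Let mX : measurable_fun setT X := measurable_model_point model.
Let Xm B : (forall i, measurable (B i)) -> P (X @^-1` rectangle B) = m (rectangle B).
Proof. by move=> mB; rewrite [LHS](model_law model mB) mv. Qed.

Let cvecE w u : cvec (X w) u = user_channel Hhat Htilde u w.
Proof.
apply/matrixP => i j; rewrite (ord1 j) mxE /X /model_point /real_comp /=.
by case: (user_channel Hhat Htilde u w i 0).
Qed.

Let estE w k : est (X w) k = Hhat k w. Proof. by rewrite /est cvecE. Qed.
Let errE w k : err (X w) k = Htilde k w. Proof. by rewrite /err cvecE. Qed.
Let gvE w k : gv (X w) k = conjmx (Hhat k w). Proof. by rewrite /gv estE. Qed.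

(** The direction is given by [onb_proj]. The columns of [V k] are orthonormal, so the normalization
    [zf_alpha] is the inverse norm of [beamdir]. *)
Lemma precoder_ae : {ae P, forall w k, zf_precoder Hhat V k w = beam (gv (X w)) k}.
Proof.
apply: ae_forall_fin => k; set J := finset.setC [set k]%SET.
have JK : (#|J| < K)%N.
  rewrite -[X in (_ < X)%N](card_ord K) -(finset.cardsC J) -[X in (X < _)%N]addn0 ltn_add2l.
  by apply/card_gt0P; exists k; rewrite !inE eqxx.
have dJ := ae_law mX Xm (det_gram_ae s20 s21 Kn mv JK).
apply: ae_imp2 dJ (zf_U_onb model k) => w dw onb.
have onb' : onb_orthocomplement (V k w) <<[seq gv (X w) l | l : 'I_K in predC1 k]>>%VS.
  by rewrite (eq_image (frefl _) (gvE w)).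
have VV := onb_proj dw onb'.
have Vone : (V k w)^H *m V k w = 1%:M by case: onb.
have iso (u : 'cV[R[i]]_(n - K + 1)) : nrm2 (V k w *m u) = nrm2 u.
  apply: (@complexI R); rewrite !nrm2_colE mulmxH -mulmxA.
  by rewrite (mulmxA (V k w)^H (V k w) u) Vone mul1mx.
have bE : V k w *m (V k w)^H *m conjmx (Hhat k w) = beamdir (gv (X w)) k.
  by rewrite -gvE VV.
have nE : nrm2 ((Hhat k w)^T *m V k w) = nrm2 (beamdir (gv (X w)) k).
  rewrite -bE -nrm2H mulmxH (_ : ((Hhat k w)^T)^H = conjmx (Hhat k w)); last first.
    by apply/matrixP => i j; rewrite !mxE.
  by rewrite -mulmxA iso.
by rewrite /zf_precoder /zf_alpha l2normE nE /beam bE.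
Qed.

Lemma SINR_ae k : {ae P, forall w, SINR Hhat Htilde V p k w = csinr k p (X w)}.
Proof.
apply: ae_imp precoder_ae => w W.
apply: (congr2 (fun a b => a / (p^-1 + b))).
  rewrite cgainE /gain W /channel linearD/= mulmxDl [in LHS]mxE; congr (sqmod (_ + _)).
    by rewrite -dot_conj -gvE dot_beam_sqrt.
  by rewrite /leak errE.
by apply: eq_bigr => l _; rewrite /leakage W /leak errE.
Qed.

Let mHhat k : mxmeas (Hhat k).
Proof. by apply/random_mxP; have [] := zf_Hhat model k. Qed.

Let mHtilde k : mxmeas (Htilde k).
Proof. by apply/random_mxP; have [] := zf_Htilde model k. Qed.

Let mV k : mxmeas (V k).
Proof. by apply/random_mxP; exact: zf_U_random model k. Qed.

Let mprecoder k : mxmeas (zf_precoder Hhat V k).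
Proof.
apply: mxmeasZ.
  apply/cmeasR/measurable_funV.
  have -> : (fun w => l2norm ((Hhat k w)^T *m V k w)) =
      (fun w => Num.sqrt (nrm2 ((Hhat k w)^T *m V k w))) by apply/funext => w; rewrite l2normE.
  apply/measurable_sqrt_comp/measurable_nrm2/mxmeasM => //; exact: mxmeasT.
apply: mxmeasM; last exact: mxmeasJ.
apply: mxmeasM => //; exact/mxmeasJ/mxmeasT.
Qed.

Let mSINR k : measurable_fun setT (SINR Hhat Htilde V p k).
Proof.
apply: measurable_funM.
  apply: measurable_sqmod; apply: mxmeasM => //; apply/mxmeasT.
  exact: mxmeasD.
apply: measurable_funV; apply: measurable_funD => //.
have -> : (fun w => \sum_(l < K | l != k) sqmod (leakage Hhat Htilde V k l w)) =
    (fun w => \sum_l (if l != k then sqmod (leakage Hhat Htilde V k l w) else 0)).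
  by apply/funext => w; rewrite big_mkcond.
apply: measurable_sum => l; case: (l != k) => //; apply: measurable_sqmod.
by apply: mxmeasM => //; exact/mxmeasT.
Qed.

Lemma average_rateE k :
  average_rate Hhat Htilde V P p k = (mean_rate k p m)%:E.
Proof.
have uv0 (u : U) : 0 <= user_var s2 u := user_var_ge0 s20 s21 u.
have pl := polyg_log_csinr (n := n) k p0.
have il := polyg_integrable_gauss uv0 mv pl.
rewrite /average_rate unlock.
transitivity (\int[P]_w (ln (1 + csinr k p (X w)))%:E)%E.
  apply: ae_eq_integral => //.
  - apply/measurable_EFinP; apply: measurableT_comp; first exact: measurable_ln.
    exact: measurable_funD.
  - by apply/measurable_EFinP; exact: (measurableT_comp pl.1 mX).
  - by apply: ae_imp (SINR_ae k) => w -> _.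
have ml : measurable_fun setT (fun x : prodR I R => (ln (1 + csinr k p x))%:E).
  by apply/measurable_EFinP; exact: pl.1.
rewrite [LHS](integral_law mX Xm ml) /mean_rate /Rintegral fineK//.
exact: integrable_fin_num.
Qed.

End transport.

(** * Exchangeability of the users and bounds at fixed size *)

Section user_symmetry.
Context {d : measure_display} {T : measurableType d} {R : realType} {K n : nat}.
Variables (Hhat Htilde : 'I_K -> T -> 'cV[R[i]]_n).
Variable (V : 'I_K -> T -> 'M[R[i]]_(n, n - K + 1)).
Variables (P : probability T R) (s2 : R) (s : 'I_K -> 'I_K).
Hypotheses (model : zf_model Hhat Htilde V P s2) (sK : involutive s).

Let swap (u : 'I_K + 'I_K) : 'I_K + 'I_K :=
  match u with inl k => inl (s k) | inr k => inr (s k) end.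

Let swapK : involutive swap. Proof. by case=> k; rewrite /= sK. Qed.

Lemma zf_model_swap :
  zf_model (Hhat \o s) (Htilde \o s) (V \o s) P s2.
Proof.
split.
- by move=> k; exact: (zf_Hhat model).
- by move=> k; exact: (zf_Htilde model).
- move=> J A JA.
  pose J' := [set swap u | u in J]%SET.
  have := zf_indep model (J := J') (A := A \o swap).
  have -> : \bigcap_(u in [set` J']) (A \o swap) u = \bigcap_(u in [set` J]) A u.
    apply/seteqP; split => w /= h u.
      by move=> uJ; have := h (swap u); rewrite swapK; apply; apply: finset.imset_f.
    by move=> /finset.imsetP[u' u'J ->]; rewrite swapK; exact: h.
  rewrite big_imset/=; last by move=> u u' _ _ /(inv_inj swapK).
  under eq_bigr do rewrite swapK.
  apply=> u /finset.imsetP[u' u'J ->]; rewrite swapK.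
  by have := JA u' u'J; case: u' {u'J}.
- by move=> k; exact: (zf_U_random model).
- move=> k; apply: ae_imp (zf_U_onb model (s k)) => w.
  rewrite (eq_span (Y := [seq map_mx Num.conj ((Hhat \o s) l w) | l : 'I_K in predC1 k])) //.
  move=> z; apply/mapP/mapP => -[l]; rewrite mem_enum !inE => lk ->.
    by exists (s l); rewrite ?mem_enum ?inE /= ?sK// (can2_eq sK sK).
  by exists (s l); rewrite ?mem_enum ?inE//= (inj_eq (inv_inj sK)).
- by move=> k; exact: (zf_U_indep model).
Qed.

Lemma average_rate_swap p k :
  average_rate (Hhat \o s) (Htilde \o s) (V \o s) P p k = average_rate Hhat Htilde V P p (s k).
Proof.
have e : SINR (Hhat \o s) (Htilde \o s) (V \o s) p k = SINR Hhat Htilde V p (s k).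
  apply/funext => w.
  apply: (congr1 (fun b => sqmod (gain Hhat Htilde V (s k) w) / (p^-1 + b))).
  rewrite [RHS](reindex_inj (inv_inj sK)); apply: eq_bigl => l.
  by rewrite (inj_eq (inv_inj sK)).
exact: (congr1 (fun f => 'E_P[fun w => ln (1 + f w)])%E e).
Qed.

End user_symmetry.

Section rate_of_model.
Context {d : measure_display} {T : measurableType d} {R : realType} {K n : nat}.
Variables (Hhat Htilde : 'I_K -> T -> 'cV[R[i]]_n).
Variable (V : 'I_K -> T -> 'M[R[i]]_(n, n - K + 1)).
Variables (P : probability T R) (s2 p : R).
Hypotheses (s20 : 0 <= s2) (s21 : s2 < 1) (Kn : (K <= n)%N) (p0 : 0 < p).
Hypothesis model : zf_model Hhat Htilde V P s2.
Local Notation I := (('I_K + 'I_K)%type * ('I_n * 'I_1 * bool))%type.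

(** Exchanging the users [k] and [k'] gives another model with the same Gaussian law, so the rates
    of all users are one and the same integral. *)
Lemma average_rate_mean_rate (m : probability (prodR I R) R) (k k' : 'I_K) :
  gauss_product (fun c : I => user_var s2 c.1 / 2) m ->
  average_rate Hhat Htilde V P p k' = (mean_rate k p m)%:E.
Proof.
move=> mv; have tK := @tpermK _ k k'.
rewrite -(average_rateE s20 s21 Kn p0 (zf_model_swap model tK) mv).
by rewrite average_rate_swap ?tpermL.
Qed.

End rate_of_model.

Section per_size_bounds.
Context {d : measure_display} {T : measurableType d} {R : realType} {K n : nat}.
Variables (Hhat Htilde : 'I_K -> T -> 'cV[R[i]]_n).
Variable (V : 'I_K -> T -> 'M[R[i]]_(n, n - K + 1)).
Variables (P : probability T R) (s2 p : R).
Hypotheses (s20 : 0 <= s2) (s21 : s2 < 1) (Kn : (K <= n)%N) (p0 : 0 < p).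
Hypothesis model : zf_model Hhat Htilde V P s2.
Local Notation N := (n - K + 1)%N.
Local Notation a := (N%:R * (1 - s2)).
Local Notation D := (p^-1 + s2 * (K%:R - 1)).
Local Notation dev_cst := (@dev_cst K n R).

Lemma average_rate_constant : (0 < K)%N ->
  exists r, forall k, average_rate Hhat Htilde V P p k = r%:E.
Proof.
move=> K0; have [m mv] := model_law_exists model.
exists (mean_rate (Ordinal K0) p m) => k.
exact: (average_rate_mean_rate s20 s21 Kn p0 model (Ordinal K0) k mv).
Qed.

Variables (r rho : R).
Hypotheses (rateE : forall k, average_rate Hhat Htilde V P p k = r%:E)
  (N32 : (32 <= N)%N) (K65 : (65 <= K)%N) (nrho : n%:R <= rho * N%:R).

Let K0 : (0 < K)%N. Proof. exact: leq_trans K65. Qed.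

Lemma rate_weak_bounds (W := (gain_cst rho + ratio_cst rho) / 2) :
  (1 + a) / D * ((a + s2) / (1 + a) - Num.sqrt dev_cst * ((1 + W) / 2) - (1 + a) / D * W)
    <= r <= (1 + a) / D * ((a + s2) / (1 + a) + Num.sqrt dev_cst * ((1 + W) / 2)).
Proof.
have [m mv] := model_law_exists model.
have rE : r = mean_rate (Ordinal K0) p m.
  apply: EFin_inj; rewrite -(rateE (Ordinal K0)).
  exact: (average_rate_mean_rate s20 s21 Kn p0 model (Ordinal K0) _ mv).
rewrite rE; exact: (mean_rate_weak s20 s21 Kn mv N32 K65 (Ordinal K0) p0 nrho).
Qed.

Lemma rate_strong_bounds :
  `|r - ln (1 + a / D)| <= ln (1 + a / D) *
    ((Num.sqrt ((63 * a + 33) / a ^+ 2) + Num.sqrt dev_cst) * ((1 + (1 + ratio_cst rho)) / 2)).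
Proof.
have [m mv] := model_law_exists model.
have rE : r = mean_rate (Ordinal K0) p m.
  apply: EFin_inj; rewrite -(rateE (Ordinal K0)).
  exact: (average_rate_mean_rate s20 s21 Kn p0 model (Ordinal K0) _ mv).
rewrite rE; exact: (mean_rate_strong s20 s21 Kn mv N32 K65 (Ordinal K0) p0 nrho).
Qed.

End per_size_bounds.

(** * Error terms and the passage to the limit *)

Section error_terms.
Context {R : realType}.

Lemma dev_cst_le (K n : nat) (b : R) : (65 <= K)%N -> 0 < b -> b * K%:R <= (n - K + 1)%N%:R ->
  @dev_cst K n R <= 4 * (1 + 13 / 2 / b) / K%:R.
Proof.
move=> K65 b0; rewrite /dev_cst; move: (n - K + 1)%N%:R => N bN.
have K0 : 0 < K%:R :> R by rewrite ltr0n (leq_trans _ K65).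
have K2 : 2 <= K%:R :> R by rewrite ler_nat (leq_trans _ K65).
move: K%:R K0 K2 bN => k k0 k2 bN.
have N0 : 0 < N by apply: lt_le_trans bN; exact: mulr_gt0.
have h1 : k + k ^+ 2 * (13 / 2 / N) <= k * (1 + 13 / 2 / b).
  rewrite mulrDr mulr1 lerD2l expr2 -mulrA ler_wpM2l ?(ltW k0)//.
  by rewrite mulrCA ler_wpM2l ?divr_ge0// ler_pdivrMr// ler_pdivlMl.
have h2 : k ^+ 2 <= 4 * (k - 1) ^+ 2.
  have -> : 4 * (k - 1) ^+ 2 = (2 * (k - 1)) ^+ 2 by ring.
  by apply: lerXn2r; rewrite ?nnegrE; lra.
have k10 : 0 < (k - 1) ^+ 2 by rewrite exprn_gt0//; lra.
rewrite ler_pdivrMr//; apply: le_trans h1 _.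
have -> : 4 * (1 + 13 / 2 / b) / k * (k - 1) ^+ 2 =
    (1 + 13 / 2 / b) * (4 * (k - 1) ^+ 2 / k) by field; rewrite !gt_eqF.
rewrite mulrC ler_wpM2l//; first by rewrite addr_ge0 ?divr_ge0// ltW.
by rewrite ler_pdivlMr// -expr2.
Qed.

(** The ratio factors as r / ((1 + a)/D), close to 1 by hypothesis, times (q + k)/D, which lies
    between 1 and 1 + 2 (1 - s) because D >= k/2. *)
Lemma weak_ratio (r a s e W M k q : R) (D := q + s * k) :
  (1 + a) / D * ((a + s) / (1 + a) - e - (1 + a) / D * W) <= r
    <= (1 + a) / D * ((a + s) / (1 + a) + e) ->
  0 < a <= M -> 2^-1 <= s <= 1 -> 0 <= e -> 0 <= W -> 0 < k -> 0 < q ->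
  `|r / ((1 + a) / (q + k)) - 1| <= 2 * (e + (1 + M) * W * (2 / k) + (1 - s)) + 2 * (1 - s).
Proof.
move=> /andP[lo hi] /andP[a0 aM] /andP[s12 s1] e0 W0 k0 q0.
have sk : 2^-1 * k <= s * k by rewrite ler_pM2r.
have D0 : 0 < D by apply: addr_gt0 => //; apply: mulr_gt0 => //; apply: lt_le_trans s12; rewrite invr_gt0.
have a1 : 0 < 1 + a by rewrite addr_gt0.
have c0 : 0 < (1 + a) / D by rewrite divr_gt0.
pose x := r / ((1 + a) / D); pose psi := (q + k) / D.
have rE : r / ((1 + a) / (q + k)) = x * psi.
  have cancel (A B C : R) : A != 0 -> B != 0 -> C != 0 -> r / (A / C) = r / (A / B) * (C / B).
    by move=> A0 B0 C0; field; rewrite A0 B0 C0.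
  by apply: cancel; rewrite gt_eqF// addr_gt0.
have rx : r = (1 + a) / D * x by rewrite /x mulrC divfK ?gt_eqF.
rewrite rx ler_pM2l// in lo; rewrite rx ler_pM2l// in hi.
have cW : (1 + a) / D * W <= (1 + M) * W * (2 / k).
  rewrite mulrAC; apply: ler_pM; rewrite ?mulr_ge0 ?invr_ge0 ?(ltW D0) ?(ltW a1)//.
    by rewrite ler_wpM2r// lerD2l.
  rewrite -[2 / k]invrK lef_pV2 ?posrE ?invr_gt0 ?divr_gt0// invf_div.
  by rewrite mulrC; apply: le_trans sk _; rewrite lerDr ltW.
have E1 : 1 - (1 - s) <= (a + s) / (1 + a) <= 1.
  rewrite ler_pdivrMr// ler_pdivlMr// mul1r; apply/andP; split; last by lra.
  have : (1 - s) * a >= 0 by rewrite mulr_ge0 ?subr_ge0 ?(ltW a0).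
  lra.
have psi1 : 1 <= psi <= 1 + 2 * (1 - s).
  rewrite /psi ler_pdivlMr// ler_pdivrMr// mul1r; apply/andP; split.
    by rewrite lerD2l ler_piMl// ltW.
  rewrite mulrDl mul1r.
  have : 2 * (1 - s) * (2^-1 * k) <= 2 * (1 - s) * D.
    apply: ler_wpM2l; first by rewrite mulr_ge0// subr_ge0.
    by apply: le_trans sk _; rewrite lerDr ltW.
  rewrite /D; lra.
have xd : `|x - 1| <= e + (1 + M) * W * (2 / k) + (1 - s).
  move: E1 => /andP[]; move: lo hi cW; rewrite ler_norml.
  have := mulr_ge0 (ltW c0) W0.
  set c := (1 + a) / D * W; set c' := (1 + M) * W * (2 / k); set E := (a + s) / (1 + a).
  by move=> c_ge0 lo hi cW E1 E2; apply/andP; split; lra.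
rewrite rE; have -> : x * psi - 1 = (x - 1) * psi + (psi - 1) by ring.
move: psi1 => /andP[p1 p2].
apply: le_trans (ler_normD _ _) _; apply: lerD; last by rewrite ger0_norm; lra.
rewrite normrM mulrC; apply: ler_pM => //; rewrite ger0_norm; lra.
Qed.

Lemma strong_ratio (r L e : R) : 0 < L -> `|r - L| <= L * e -> `|r / L - 1| <= e.
Proof.
move=> L0 h; have -> : r / L - 1 = (r - L) / L by field; rewrite gt_eqF.
by rewrite normrM [`|L^-1|]gtr0_norm ?invr_gt0// ler_pdivrMr// mulrC.
Qed.

Lemma sqrt_inv_cvg0 (u : nat -> R) :
  u K @[K --> \oo] --> +oo -> Num.sqrt (u K)^-1 @[K --> \oo] --> (0 : R).
Proof.
move=> /cvgryPgt uy; apply/cvgr0Pnorm_lt => e e0.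
have := uy (e ^+ 2)^-1; apply: filterS => K uK.
have e20 : 0 < e ^+ 2 by rewrite exprn_gt0.
have u0 : 0 < u K by apply: lt_trans uK; rewrite invr_gt0.
rewrite ger0_norm ?sqrtr_ge0// -[e]gtr0_norm// -sqrtr_sqr ltr_sqrt//.
by rewrite -[ltRHS]invrK ltf_pV2 ?posrE// invr_gt0.
Qed.

Lemma cvg1_of_dist (u b : nat -> R) : (\forall K \near \oo, `|u K - 1| <= b K) ->
  b K @[K --> \oo] --> (0 : R) -> u K @[K --> \oo] --> (1 : R).
Proof.
move=> ub b0; apply/cvgrPdist_lt => e e0.
have /cvgr0Pnorm_lt/(_ e e0) be := b0.
apply: filterS2 ub be => K uK bK; rewrite distrC.
by apply: le_lt_trans uK (le_lt_trans (ler_norm _) bK).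
Qed.

Lemma limn_einf_gt1 (u : nat -> R) : (1 < limn_einf (fun K => (u K)%:E))%E ->
  exists2 b : R, 0 < b & \forall K \near \oo, 1 + b <= u K.
Proof.
have -> : limn_einf (fun K => (u K)%:E) = ereal_sup (range (einfs (fun K => (u K)%:E))).
  by rewrite limn_einf_lim; apply/cvg_lim => //; exact: cvg_einfs_sup.
move=> /ereal_sup_gt[_ [k _ <-]] h1.
have [c c1 ck] : exists2 c : R, 1 < c & (c%:E <= einfs (fun K => (u K)%:E) k)%E.
  move: h1; case: (einfs _ k) => [x|_|//]; first by rewrite lte_fin => x1; exists x.
  by exists 2; rewrite ?leey// ltrDl.
exists (c - 1); first by rewrite subr_gt0.
exists k => // K /= kK; rewrite addrC subrK -lee_fin; apply: le_trans ck _.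
by apply: ereal_inf_lbound; exists K.
Qed.

End error_terms.

Section moment_constants.
Context {R : realType}.
Variable rho : R.
Hypothesis rho0 : 0 <= rho.

Lemma ratio_cst_ge0 : 0 <= ratio_cst rho.
Proof.
by rewrite /ratio_cst; repeat (first [exact: rho0 | exact: ler0n | exact: ler01 |
  apply: mulr_ge0 | apply: addr_ge0 | apply: exprn_ge0]).
Qed.

Lemma gain_cst_ge0 : 0 <= gain_cst rho.
Proof.
by rewrite /gain_cst; repeat (first [exact: rho0 | exact: ler0n | exact: ler01 |
  apply: mulr_ge0 | apply: addr_ge0 | apply: exprn_ge0]).
Qed.

End moment_constants.

(** N > b K, hence n < K + N <= (1 + 1/b) N; the threshold 32/b on K ensures N >= 32. *)
Lemma eventually_large {R : realType} (nt : nat -> nat) (b : R) : 0 < b ->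
  (\forall K \near \oo, 1 + b <= (nt K)%:R / K%:R) ->
  \forall K \near \oo, [/\ (65 <= K)%N, (32 <= nt K - K + 1)%N,
    b * K%:R <= (nt K - K + 1)%N%:R & (nt K)%:R <= (1 + b^-1) * (nt K - K + 1)%N%:R].
Proof.
move=> b0 evb; have ev65 : \forall K \near \oo, (65 <= K)%N by exact: nbhs_infty_ge.
have ev32 : \forall K \near \oo, 32 / b <= K%:R by exact: nbhs_infty_ger.
apply: filterS3 evb ev65 ev32 => K hb K65 h32.
have K0 : 0 < K%:R :> R by rewrite ltr0n (leq_trans _ K65).
rewrite ler_pdivlMr// in hb.
have Kn : (K <= nt K)%N.
  rewrite -(ler_nat R); apply: le_trans hb; rewrite mulrDl mul1r lerDl.
  by rewrite mulr_ge0 ?(ltW b0) ?(ltW K0).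
have NE : (nt K - K + 1)%N%:R = (nt K)%:R - K%:R + 1 :> R by rewrite natrD natrB.
have bN : b * K%:R <= (nt K - K + 1)%N%:R by rewrite NE; lra.
rewrite ler_pdivrMr// in h32.
split => //.
  by rewrite -(ler_nat R); apply: le_trans bN; rewrite mulrC.
have KN : K%:R <= b^-1 * (nt K - K + 1)%N%:R by rewrite ler_pdivlMl.
by rewrite mulrDl mul1r; move: KN; rewrite NE; lra.
Qed.

Lemma inv_le_sqrt_inv {R : realType} (K : nat) : (0 < K)%N ->
  K%:R^-1 <= Num.sqrt (K%:R^-1 : R).
Proof.
move=> K0; have k0 : 0 < K%:R^-1 :> R by rewrite invr_gt0 ltr0n.
rewrite -{1}(sqr_sqrtr (ltW k0)) expr2 ler_piMl ?sqrtr_ge0//.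
rewrite -[leRHS]sqrtr1 ler_sqrt// invf_le1 ?ler1n// ltr0n//.
Qed.

Theorem proposition4 (R : realType) (nt : nat -> nat) (sigma2 Pow : nat -> R)
    (d : nat -> measure_display) (T : forall K, measurableType (d K))
    (P : forall K, probability (T K) R)
    (Hhat Htilde : forall K, 'I_K -> T K -> 'cV[R[i]]_(nt K))
    (U : forall K, 'I_K -> T K -> 'M[R[i]]_(nt K, nt K - K + 1))
    (hnt : forall K, (2 <= K)%N -> (K <= nt K)%N)
    (hsigma2 : forall K, (2 <= K)%N -> 0 <= sigma2 K < 1)
    (hPow : forall K, (2 <= K)%N -> 0 < Pow K)
    (hmodel : forall K, (2 <= K)%N ->
       zf_model (Hhat K) (Htilde K) (U K) (P K) (sigma2 K)) :
  let p K := Pow K / K%:R in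
  let a K := (nt K - K + 1)%N%:R * (1 - sigma2 K) in
  exists Rsym : nat -> R,
    (forall K, (2 <= K)%N -> forall k : 'I_K,
       average_rate (Hhat K) (Htilde K) (U K) (P K) (p K) k = (Rsym K)%:E) /\
    ((1 < limn_einf (fun K => ((nt K)%:R / K%:R : R)%:E))%E ->
       (bounded_near a \oo ->
          Rsym K / ((1 + a K) / ((p K)^-1 + (K%:R - 1))) @[K --> \oo] --> (1 : R)) /\
       (a K @[K --> \oo] --> +oo ->
          Rsym K / ln (1 + a K / ((p K)^-1 + (K%:R - 1) * sigma2 K))
            @[K --> \oo] --> (1 : R))).
Proof.
move=> p a.
have K0 K : (2 <= K)%N -> (0 < K)%N by exact: leq_trans.
have p0 K : (2 <= K)%N -> 0 < p K.
  by move=> K2; rewrite divr_gt0 ?hPow// ltr0n K0.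
have s20 K : (2 <= K)%N -> 0 <= sigma2 K by move=> /hsigma2/andP[].
have s21 K : (2 <= K)%N -> sigma2 K < 1 by move=> /hsigma2/andP[].
have [Rsym RsymE] : exists Rsym : nat -> R, forall K, (2 <= K)%N -> forall k : 'I_K,
    average_rate (Hhat K) (Htilde K) (U K) (P K) (p K) k = (Rsym K)%:E.
  suff /boolp.choice[r rE] : forall K, exists r, (2 <= K)%N -> forall k : 'I_K,
    average_rate (Hhat K) (Htilde K) (U K) (P K) (p K) k = r%:E by exists r.
  move=> K.
  (* Below K = 2 the value 0 is a mere default. *)
  have [K2|K2] := leqP 2 K; last by exists 0.
  have [r rE] := average_rate_constant (s20 K K2) (s21 K K2) (hnt K K2) (p0 K K2)
    (hmodel K K2) (K0 K K2).
  by exists r.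
exists Rsym; split => // /limn_einf_gt1[b b0 /(eventually_large b0) large].
pose rho : R := 1 + b^-1.
have rho0 : 0 <= rho by rewrite addr_ge0// invr_ge0 ltW.
pose Q : R := 4 * (1 + 13 / 2 / b).
have Q0 : 0 <= Q by rewrite mulr_ge0// addr_ge0// divr_ge0// ltW.
(* Every error of regime (i) is O(K^-1/2), the rate imposed by the fluctuations of the
   interference. *)
pose t K : R := Num.sqrt K%:R^-1.
have t0 : t K @[K --> \oo] --> (0 : R) by exact: sqrt_inv_cvg0 cvgr_idn.
have dev_t K : (65 <= K)%N -> b * K%:R <= (nt K - K + 1)%N%:R ->
    Num.sqrt (@dev_cst K (nt K) R) <= Num.sqrt Q * t K.
  move=> K65 bN; rewrite -sqrtrM//; apply: ler_wsqrtr; exact: dev_cst_le.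
split.
- move=> /ex_bound[M evM].
  pose W := (gain_cst rho + ratio_cst rho) / 2.
  have W0 : 0 <= W by rewrite divr_ge0// addr_ge0 ?gain_cst_ge0 ?ratio_cst_ge0.
  (* The terms of [weak_ratio] in units of [t K]: fluctuations of S, quadratic term of the
     logarithm, and 1 - sigma2 (twice). *)
  pose B := 2 * (Num.sqrt Q * ((1 + W) / 2) + (1 + M) * W * 4 + M / b) + 2 * (M / b).
  apply: (@cvg1_of_dist _ _ (fun K => B * t K)); last first.
    by rewrite -[X in _ --> X](mulr0 B); apply: cvgM => //; exact: cvg_cst.
  have evK : \forall K \near \oo, 2 * M / b <= K%:R by exact: nbhs_infty_ger.
  apply: filterS3 large evM evK => K [K65 N32 bN nrho] aM KM.
  have K2 : (2 <= K)%N by exact: leq_trans K65.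
  have k0 : 0 < K%:R :> R by rewrite ltr0n K0.
  have N0 : 0 < (nt K - K + 1)%N%:R :> R by rewrite ltr0n (leq_trans _ N32).
  have v0 : 0 < 1 - sigma2 K by rewrite subr_gt0 s21.
  have a0 : 0 < a K by rewrite mulr_gt0.
  have {}aM : a K <= M by apply: le_trans aM; exact: ler_norm.
  have M0 : 0 < M by exact: lt_le_trans aM.
  (* A bounded [a K] with N of order at least K forces 1 - sigma2 = a/N = O(1/K). *)
  have eta : 1 - sigma2 K <= M / b * K%:R^-1.
    rewrite -mulrA -invfM ler_pdivlMr ?mulr_gt0//; apply: le_trans aM.
    by rewrite mulrC ler_wpM2r ?(ltW v0).
  have eta2 : 1 - sigma2 K <= 2^-1.
    apply: le_trans eta _; rewrite ler_pdivrMr//; move: KM; rewrite -mulrA; lra.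
  have tK : K%:R^-1 <= t K by exact: inv_le_sqrt_inv (K0 K K2).
  have k1 : 0 < K%:R - 1 :> R by rewrite subr_gt0 ltr1n.
  have h := rate_weak_bounds (s20 K K2) (s21 K K2) (hnt K K2) (p0 K K2) (hmodel K K2)
    (RsymE K K2) N32 K65 nrho.
  have pV : 0 < (p K)^-1 by rewrite invr_gt0 p0.
  apply: le_trans (weak_ratio h _ _ _ W0 k1 pV) _.
  + by rewrite a0; exact: aM.
  + by rewrite (ltW (s21 K K2)) andbT; lra.
  + by rewrite mulr_ge0 ?sqrtr_ge0// divr_ge0// addr_ge0.
  have e1 : Num.sqrt (@dev_cst K (nt K) R) * ((1 + W) / 2) <=
      Num.sqrt Q * ((1 + W) / 2) * t K.
    by rewrite mulrAC ler_wpM2r ?dev_t// divr_ge0// addr_ge0.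
  have e2 : (1 + M) * W * (2 / (K%:R - 1)) <= (1 + M) * W * 4 * t K.
    have h4 : 2 / (K%:R - 1) <= 4 * t K.
      apply: (@le_trans _ _ (4 * K%:R^-1)); last exact: ler_wpM2l.
      rewrite ler_pdivrMr// mulrAC ler_pdivlMr//.
      have : 2 <= K%:R :> R by rewrite ler_nat.
      lra.
    have MW : 0 <= (1 + M) * W by rewrite mulr_ge0// addr_ge0// ltW.
    by have := ler_wpM2l MW h4; rewrite [in X in _ <= X -> _]mulrA.
  have e3 : 1 - sigma2 K <= M / b * t K.
    by apply: le_trans eta _; rewrite ler_wpM2l// divr_ge0 ?(ltW M0) ?(ltW b0).
  rewrite /B; move: e1 e2 e3; move: (Num.sqrt Q * _) ((1 + M) * W * 4) (M / b) => A1 A2 A3.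
  move: (Num.sqrt _ * _) ((1 + M) * W * _) (1 - sigma2 K) => x1 x2 x3 e1 e2 e3.
  have -> : (2 * (A1 + A2 + A3) + 2 * A3) * t K = 2 * (A1 * t K + A2 * t K + A3 * t K)
    + 2 * (A3 * t K) by ring.
  lra.
- move=> aoo; pose w := (1 + (1 + ratio_cst rho)) / 2.
  have w0 : 0 <= w by rewrite divr_ge0// !addr_ge0// ratio_cst_ge0.
  pose ta K := Num.sqrt (a K)^-1.
  have ta0 : ta K @[K --> \oo] --> (0 : R) by exact: sqrt_inv_cvg0 aoo.
  apply: (@cvg1_of_dist _ _ (fun K => (Num.sqrt 96 * ta K + Num.sqrt Q * t K) * w)); last first.
    have c1 : Num.sqrt 96 * ta K @[K --> \oo] --> (0 : R).
      by rewrite -[X in _ --> X](mulr0 (Num.sqrt 96)); apply: cvgM => //; exact: cvg_cst.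
    have c2 : Num.sqrt Q * t K @[K --> \oo] --> (0 : R).
      by rewrite -[X in _ --> X](mulr0 (Num.sqrt Q)); apply: cvgM => //; exact: cvg_cst.
    rewrite -[X in _ --> X](mul0r w) -[X in X * w](addr0 0).
    apply: cvgM; last exact: cvg_cst.
    exact: cvgD c1 c2.
  have ev1 : \forall K \near \oo, 1 <= a K by move/cvgryPge: aoo; exact.
  apply: filterS2 large ev1 => K [K65 N32 bN nrho] a1.
  have K2 : (2 <= K)%N by exact: leq_trans K65.
  have a0 : 0 < a K by exact: lt_le_trans a1.
  have k1 : 0 < K%:R - 1 :> R by rewrite subr_gt0 ltr1n.
  have D0 : 0 < (p K)^-1 + (K%:R - 1) * sigma2 K.
    by rewrite ltr_wpDr ?invr_gt0 ?p0// mulr_ge0 ?s20// ltW.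
  have h := rate_strong_bounds (s20 K K2) (s21 K K2) (hnt K K2) (p0 K K2) (hmodel K K2)
    (RsymE K K2) N32 K65 nrho.
  rewrite (mulrC (sigma2 K)) in h.
  have L0 : 0 < ln (1 + a K / ((p K)^-1 + (K%:R - 1) * sigma2 K)).
    by rewrite ln_gt0// ltrDl divr_gt0.
  apply: le_trans (strong_ratio L0 h) _; rewrite -/w; apply: ler_wpM2r => //.
  apply: lerD; last exact: dev_t.
  rewrite -sqrtrM//; apply: ler_wsqrtr; rewrite -/(a K).
  (* 63 a + 33 <= 96 a because a >= 1. *)
  have -> : 96 / a K = 96 * a K / a K ^+ 2 by field; rewrite gt_eqF.
  by rewrite ler_pM2r ?invr_gt0 ?exprn_gt0//; lra.
Qed.
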